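(* For every admissible mesh $\mathcal{T}_h$ there exists a unique pair $(u_h,\varphi_h)\in \mathcal{S}^1(\mathcal{T}_h)\times \mathcal{S}^1_0(\mathcal{T}_h)$ such that $$(\lambda+1)(u_h,v_h)_\Omega+\lambda(\nabla u_h,\nabla v_h)_\Omega+(\nabla\varphi_h,\nabla v_h)_\Omega=(u_d,v_h)_\Omega,\qquad (\nabla u_h,\nabla\psi_h)_\Omega=0$$ for all $(v_h,\psi_h)\in \mathcal{S}^1(\mathcal{T}_h)\times \mathcal{S}^1_0(\mathcal{T}_h)$. Furthermore, let $u\in \widetilde H^1(\Omega)$ be the unique minimizer over $\widetilde H^1(\Omega)$ of $$v\mapsto \tfrac12\|v-u_d\|_{L_2(\Omega)}^2+\tfrac{\lambda}{2}\|v\|_{H^1(\Omega)}^2 .$$ Then there is a constant $C>0$, independent of the mesh $\mathcal{T}_h$ except through the shape-regularity constant $\kappa$ (it may depend on $\Omega$, $\lambda$, $\kappa$, $p$ and $u_d$), such that $$\|u-u_h\|_{H^1(\Omega)}\le C\Bigl(\inf_{w_h\in \mathcal{S}^1(\mathcal{T}_h)}\|u-w_h\|_{H^1(\Omega)}+\sup_{\|f\|_{L_2(\Omega)}=1}\ \inf_{v_h\in \mathcal{S}^1_0(\mathcal{T}_h)}\|v_f-v_h\|_{H^1(\Omega)}\Bigr),$$ where, for $f\in L_2(\Omega)$, $v_f\in H^1_0(\Omega)$ is the weak solution of $-\Delta v_f=f$ in $\Omega$, $v_f=0$ on $\Gamma$.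
   Context: $\Omega\subset\mathbb{R}^d$ is a bounded polyhedral Lipschitz domain with boundary $\Gamma$; $\lambda>0$ and $u_d\in L_2(\Omega)$ are given. $(\cdot,\cdot)_\Omega$ is the $L_2(\Omega)$ scalar product and $\|v\|_{H^1(\Omega)}^2=\|v\|_{L_2(\Omega)}^2+\|\nabla v\|_{L_2(\Omega)}^2$. $H^1_0(\Omega)$ is the space of $H^1(\Omega)$ functions with vanishing trace on $\Gamma$. The space of weakly harmonic functions is $\widetilde H^1(\Omega)=\{u\in H^1(\Omega): (\nabla u,\nabla v)_\Omega=0 \text{ for all } v\in H^1_0(\Omega)\}$. $\mathcal{T}_h$ is a regular, $\kappa$-shape regular mesh: a finite set of open $d$-dimensional simplices $K$ with $\overline\Omega=\bigcup_{K\in\mathcal{T}_h}\overline K$, without hanging nodes, with $h_K^d\le\kappa|K|$ for all $K$, where $h_K=\mathrm{diam}(K)$. $\mathcal{S}^1(\mathcal{T}_h)$ is the space of continuous functions on $\Omega$ whose restriction to each $K\in\mathcal{T}_h$ is a polynomial of degree at most $p$, for a fixed integer $p\ge1$, and $\mathcal{S}^1_0(\mathcal{T}_h)=\mathcal{S}^1(\mathcal{T}_h)\cap H^1_0(\Omega)$. *)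

(* Defs.v *)
From HB Require Import structures.
From mathcomp Require Import all_boot all_order all_algebra.
From mathcomp Require Import all_classical all_reals all_analysis.

Set Implicit Arguments.
Unset Strict Implicit.
Unset Printing Implicit Defensive.
Import Order.TTheory GRing.Theory Num.Theory.
Import numFieldNormedType.Exports.
Local Open Scope classical_set_scope.
Local Open Scope ring_scope.

(* The Borel sigma-algebra of R^n, generated by the coordinate maps. *)
Fact rV_display : measure_display. Proof. exact: default_measure_display. Qed.

Section rV_measurable.
Context (R : realType) (n : nat).

Definition rV_coord (i : 'I_n) (x : 'rV[R]_n) : measurableTypeR R := x 0 i.

Let rV_set0 : g_sigma_preimage rV_coord set0.
Proof. exact: sigma_algebra0. Qed.

Let rV_setC A : g_sigma_preimage rV_coord A -> g_sigma_preimage rV_coord (~` A).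
Proof. exact: sigma_algebraC. Qed.

Let rV_bigcup (F : _^nat) : (forall i, g_sigma_preimage rV_coord (F i)) ->
  g_sigma_preimage rV_coord (\bigcup_i (F i)).
Proof. exact: sigma_algebra_bigcup. Qed.

HB.instance Definition _ := @isMeasurable.Build
  rV_display 'rV[R]_n
  (g_sigma_preimage rV_coord) rV_set0 rV_setC rV_bigcup.

End rV_measurable.

Lemma measurable_fun_rV (R : realType) n d (T : measurableType d)
    (f : T -> 'rV[R]_n) :
  (forall i, measurable_fun [set: T] (fun t => f t 0 i : measurableTypeR R)) ->
  measurable_fun [set: T] f.
Proof.
move=> mf.
have : g_sigma_preimage (fun i => @rV_coord R n i \o f) `<=` measurable.
  apply: smallest_sub; first exact: sigma_algebra_measurable.
  case: n => [|n] in f mf *; first by rewrite big_ord0.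
  rewrite -bigcup_mkord_ord; apply: bigcup_sub => i Ii.
  by move=> A [B mB <-]; exact: mf.
rewrite g_sigma_preimage_comp => prefS _ A mA.
by apply: prefS; exists A.
Qed.

Lemma measurable_rV_coord (R : realType) n (i : 'I_n) :
  measurable_fun [set: 'rV[R]_n] (@rV_coord R n i).
Proof.
move=> _ A mA; rewrite setTI; apply: sub_sigma_algebra => /=.
rewrite -bigcup_seq/=; exists i => /=; first by rewrite mem_index_enum.
by exists A => //; rewrite setTI.
Qed.

(* Lebesgue measure on R^n, by recursion on n: the image of the product
   measure on R * R^n under (t, x) |-> (t, x_0, ..., x_(n-1)). *)
Section lebesgue_rV_succ.
Context (R : realType) (n : nat).

Definition cons_rV (tx : measurableTypeR R * 'rV[R]_n) : 'rV[R]_n.+1 :=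
  row_mx (tx.1%:M : 'rV[R]_1) tx.2.

Definition split_rV (x : 'rV[R]_n.+1) : measurableTypeR R * 'rV[R]_n :=
  (x 0 0, rsubmx (x : 'rV[R]_(1 + n))).

Lemma cons_rVK : cancel cons_rV split_rV.
Proof.
move=> [t x]; rewrite /split_rV /cons_rV/= row_mxKr; congr pair.
rewrite -[LHS](_ : row_mx (t%:M : 'rV[R]_1) x 0 (lshift n 0) = _).
  by rewrite row_mxEl mxE mulr1n.
by congr (row_mx _ _ _ _); exact/val_inj.
Qed.

Lemma measurable_cons_rV : measurable_fun [set: _ * _] cons_rV.
Proof.
apply: measurable_fun_rV => i.
have [h|[j ji]] : (i = 0) + {j : 'I_n | i = rshift 1 j}.
- have [->|i0] := eqVneq i 0; first by left.
  have i1n : (i.-1 < n)%N by rewrite prednK ?lt0n// -ltnS.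
  right; exists (Ordinal i1n).
  by apply/val_inj; rewrite /= add1n prednK// lt0n.
- rewrite (_ : (fun _ => _) = fst) ?measurable_fst//; apply/funext => tx.
  by rewrite h -[in RHS](cons_rVK tx).
- rewrite (_ : (fun _ => _) = @rV_coord R n j \o snd); last first.
    apply/funext => -[t x]; rewrite ji.
    exact: (row_mxEr (t%:M : 'rV[R]_1) x 0 j).
  by apply: measurableT_comp => //; exact: measurable_rV_coord.
Qed.

Lemma measurable_split_rV : measurable_fun [set: 'rV[R]_n.+1] split_rV.
Proof.
apply: measurable_fun_pair; first exact: measurable_rV_coord.
apply: measurable_fun_rV => i.
rewrite (_ : (fun _ => _) = @rV_coord R n.+1 (rshift 1 i)).
  exact: measurable_rV_coord.
by apply/funext => x; rewrite mxE.
Qed.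

Variable mu : {sigma_finite_measure set 'rV[R]_n -> \bar R}.

Definition lebesgue_rV_succ : set 'rV[R]_n.+1 -> \bar R :=
  pushforward (@lebesgue_measure R \x mu)%E cons_rV.

Let mu0 : lebesgue_rV_succ set0 = 0%E.
Proof. by rewrite /lebesgue_rV_succ /pushforward preimage_set0 measure0. Qed.

Let mu_ge0 A : (0 <= lebesgue_rV_succ A)%E.
Proof. by rewrite /lebesgue_rV_succ /pushforward. Qed.

Let mu_sigma_additive : semi_sigma_additive lebesgue_rV_succ.
Proof.
move=> F mF tF mUF; rewrite /lebesgue_rV_succ /pushforward preimage_bigcup.
apply: measure_semi_sigma_additive.
- by move=> k; rewrite -[X in measurable X]setTI; exact: measurable_cons_rV.
- apply/trivIsetP => /= i j _ _ ij; rewrite -preimage_setI.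
  by move/trivIsetP : tF => /(_ _ _ _ _ ij) ->//; rewrite preimage_set0.
- rewrite -preimage_bigcup -[X in measurable X]setTI.
  exact: measurable_cons_rV.
Qed.

HB.instance Definition _ := isMeasure.Build _ _ _
  lebesgue_rV_succ mu0 mu_ge0 mu_sigma_additive.

Let mu_sigma_finite : sigma_finite setT lebesgue_rV_succ.
Proof.
have /sigma_finiteP[F [TF ndF Foo]] := sigma_finiteT (@lebesgue_measure R).
have /sigma_finiteP[G [TG ndG Goo]] := sigma_finiteT mu.
exists (fun k => split_rV @^-1` (F k `*` G k)).
  rewrite -preimage_bigcup; apply/esym; rewrite -subTset => x _ /=.
  have [i _ Fi] : (\bigcup_k F k) (split_rV x).1 by rewrite -TF.
  have [j _ Gj] : (\bigcup_k G k) (split_rV x).2 by rewrite -TG.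
  exists (maxn i j) => //; split.
  - by move: Fi; exact/subsetPset/ndF/leq_maxl.
  - by move: Gj; exact/subsetPset/ndG/leq_maxr.
move=> k; have [mF Fk] := Foo k; have [mG Gk] := Goo k; split.
  rewrite -[X in measurable X]setTI; apply: measurable_split_rV => //.
  exact: measurableX.
rewrite /lebesgue_rV_succ /pushforward -comp_preimage.
rewrite (_ : _ \o _ = id); last exact/funext/cons_rVK.
by rewrite preimage_id product_measure1E// lte_mul_pinfty// ge0_fin_numE.
Qed.

HB.instance Definition _ := Measure_isSigmaFinite.Build _ _ _
  lebesgue_rV_succ mu_sigma_finite.

End lebesgue_rV_succ.

Fixpoint lebesgue_rV (R : realType) (n : nat) :
    {sigma_finite_measure set 'rV[R]_n -> \bar R} :=
  match n with
  | 0 => [the {sigma_finite_measure set 'rV[R]_0 -> \bar R} of \d_(0 : 'rV[R]_0)]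
  | m.+1 => [the {sigma_finite_measure set 'rV[R]_m.+1 -> \bar R} of
              lebesgue_rV_succ (lebesgue_rV R m)]
  end.

Lemma measurable_rV_box (R : realType) n (A : 'I_n -> set (measurableTypeR R)) :
  (forall i, measurable (A i)) ->
  measurable [set x : 'rV[R]_n | forall i, A i (x 0 i)].
Proof.
move=> mA.
rewrite (_ : mkset _ = \bigcap_i (rV_coord i @^-1` A i)); last first.
  by apply/seteqP; split=> x /= xA i => [_|]; exact: xA.
apply: fin_bigcap_measurable => // i _; rewrite -[X in measurable X]setTI.
exact: measurable_rV_coord.
Qed.

Lemma lebesgue_rV_box (R : realType) n (A : 'I_n -> set (measurableTypeR R)) :
  (forall i, measurable (A i)) ->
  lebesgue_rV R n [set x | forall i, A i (x 0 i)] =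
  (\prod_i lebesgue_measure (A i))%E.
Proof.
elim: n A => [|n IH] A mA.
  by rewrite big_ord0 /= diracE mem_set// => -[].
rewrite big_ord_recl -(IH (A \o lift ord0)); last by move=> i; exact: mA.
rewrite /= /lebesgue_rV_succ /pushforward -product_measure1E//; last first.
  by apply: (@measurable_rV_box R n (A \o lift ord0)) => i; exact: mA.
have tail (t : measurableTypeR R) x (i : 'I_n) : cons_rV (t, x) 0 (lift ord0 i) = x 0 i.
  rewrite -[RHS](row_mxEr (t%:M : 'rV[R]_1) x 0 i).
  by congr (row_mx _ _ _ _); exact/val_inj.
have head (t : measurableTypeR R) (x : 'rV[R]_n) : cons_rV (t, x) 0 ord0 = t.
  by rewrite -[RHS](congr1 fst (cons_rVK (t, x))).
congr (product_measure1 _ _ _); apply/seteqP; split=> -[t x] /=.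
  move=> tx; split; first by rewrite -(head t x); exact: tx.
  by move=> i; rewrite -(tail t); exact: tx.
move=> [At Ax] i; have [->|i0] := eqVneq i ord0; first by rewrite head.
by move: i0; rewrite eq_sym => /unlift_some[j -> _]; rewrite tail; exact: Ax.
Qed.

Section geometry.
Context (R : realType) (n : nat).
Implicit Types (x : 'rV[R]_n) (A K : set 'rV[R]_n).

(* The norm that the library puts on 'rV[R]_n is the maximum norm. *)
Definition enorm x : R := Num.sqrt (\sum_i x 0 i ^+ 2).

(* Euclidean diameter, with value 0 on the empty set. *)
Definition ediam A : \bar R :=
  ereal_sup ([set 0%E] `|` [set (enorm (z.1 - z.2))%:E | z in A `*` A]).

(* s-dimensional Hausdorff measure, normalised so that a set E of a covering
   costs diam(E)^s.  On s-dimensional hypersurfaces it is the surface measure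
   up to a positive factor depending on s only. *)
Definition hausdorff_gauge (s : nat) (delta : R) A : \bar R :=
  if A == set0 then 0%E
  else if (ediam A <= delta%:E)%E then (ediam A ^+ s)%E else +oo%E.

Definition hausdorff (s : nat) A : \bar R :=
  ereal_sup [set mu_ext (hausdorff_gauge s delta) A | delta in [set e | 0 < e]].

Definition convex_hull A : set 'rV[R]_n :=
  [set x | exists (k : nat) (t : 'I_k -> R) (y : 'I_k -> 'rV[R]_n),
    [/\ forall i, A (y i), forall i, 0 <= t i, \sum_i t i = 1
      & x = \sum_i t i *: y i]].

(* The n+1 vertices of a simplex are the rows of V. *)
Definition vertices (V : 'M[R]_(n.+1, n)) : set 'rV[R]_n := [set row i V | i in [set: 'I_n.+1]].

Definition affinely_independent (V : 'M[R]_(n.+1, n)) : Prop :=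
  row_free (\matrix_(i < n) (row (lift ord0 i) V - row ord0 V)).

Definition open_simplex (V : 'M[R]_(n.+1, n)) : set 'rV[R]_n :=
  [set x | exists t : 'I_n.+1 -> R,
    [/\ forall i, 0 < t i, \sum_i t i = 1 & x = \sum_i t i *: row i V]].

Definition is_open_simplex K : Prop :=
  exists2 V, affinely_independent V & K = open_simplex V.

End geometry.

Section domains.
Context (R : realType) (n : nat).
Implicit Types (Omega : set 'rV[R]_n.+1).

Definition boundary Omega : set 'rV[R]_n.+1 := closure Omega `\` Omega°.

(* Around each boundary point, in suitable rotated Cartesian coordinates,
   Omega is the set of points strictly above a Lipschitz graph. *)
Definition lipschitz_boundary Omega : Prop :=
  forall x, boundary Omega x ->
  exists (r : R) (Q : 'M[R]_n.+1) (g : 'rV[R]_n -> R),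
    [/\ 0 < r, Q *m Q^T = 1%:M, lipschitz g
      & forall y, enorm (y - x) < r ->
          Omega y <-> g (col' ord0 (y *m Q)) < (y *m Q) 0 ord0].

Definition polyhedral Omega : Prop :=
  exists2 P : set (set 'rV[R]_n.+1),
    finite_set P /\ (forall K, P K -> is_open_simplex K)
    & closure Omega = \bigcup_(K in P) closure K.

Definition polyhedral_lipschitz_domain Omega : Prop :=
  [/\ open Omega, connected Omega, Omega !=set0 & bounded_set Omega] /\
  lipschitz_boundary Omega /\ polyhedral Omega.

Record shape_regular_mesh Omega (kappa : R) (T : set (set 'rV[R]_n.+1)) : Prop := {
  mesh_finite : finite_set T;
  mesh_simplex : forall K, T K -> is_open_simplex K;
  mesh_cover : closure Omega = \bigcup_(K in T) closure K;
  mesh_no_hanging_node : forall V W,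
    affinely_independent V -> affinely_independent W ->
    T (open_simplex V) -> T (open_simplex W) ->
    closure (open_simplex V) `&` closure (open_simplex W) =
    convex_hull (vertices V `&` vertices W);
  mesh_shape_regular : forall K, T K ->
    (ediam K ^+ n.+1 <= kappa%:E * lebesgue_rV R n.+1 K)%E }.

End domains.

Section function_spaces.
Context (R : realType) (n : nat).
Local Notation Rd := 'rV[R]_n.+1.
Local Notation mu := (lebesgue_rV R n.+1).
Implicit Types (Omega : set Rd) (u v f g q phi : Rd -> R).

Definition partial (i : 'I_n.+1) f : Rd -> R :=
  fun x => 'D_(delta_mx 0 i) f x.

Definition smooth f : Prop :=
  forall (s : seq 'I_n.+1) x, differentiable (foldr partial f s) x.

Definition test_function Omega phi : Prop :=
  [/\ smooth phi, compact (closure [set x | phi x != 0])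
    & closure [set x | phi x != 0] `<=` Omega].

(* Elements of L_2(Omega) and H^1(Omega) are represented by functions on the
   whole space, of which only the values on Omega matter. *)
Definition in_L2 Omega f : Prop :=
  measurable_fun Omega f /\ (\int[mu]_(x in Omega) (f x ^+ 2)%:E < +oo)%E.

Definition ip Omega f g : R := \int[mu]_(x in Omega) (f x * g x).

Definition norm_L2 Omega f : R := Num.sqrt (ip Omega f f).

Definition is_weak_partial Omega i u g : Prop :=
  forall phi, test_function Omega phi ->
    ip Omega u (partial i phi) = - ip Omega g phi.

Definition in_H1 Omega u : Prop :=
  in_L2 Omega u /\
  forall i, exists2 g, in_L2 Omega g & is_weak_partial Omega i u g.

(* A representative of the i-th weak derivative, which is unique almost
   everywhere; the value is junk when u is not in H^1(Omega). *)
Definition weak_partial Omega i u : Rd -> R :=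
  xget (cst 0) [set g | in_L2 Omega g /\ is_weak_partial Omega i u g].

Definition grad_ip Omega u v : R :=
  \sum_i ip Omega (weak_partial Omega i u) (weak_partial Omega i v).

Definition norm_H1 Omega u : R :=
  Num.sqrt (norm_L2 Omega u ^+ 2 + grad_ip Omega u u).

(* The trace operator H^1(Omega) -> L_2(Gamma) is the continuous extension of
   the restriction to Gamma of functions that are smooth up to the boundary:
   g is the trace of u if smooth functions w_k tend to u in H^1(Omega) while
   their restrictions to Gamma tend to g in L_2(Gamma). *)
Definition is_trace Omega u g : Prop :=
  measurable_fun (boundary Omega) g /\
  exists w : nat -> Rd -> R,
    [/\ forall k, smooth (w k),
        norm_H1 Omega (w k \- u) @[k --> \oo] --> (0 : R)
      & (\int[hausdorff n]_(x in boundary Omega) ((w k x - g x) ^+ 2)%:E)%E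
          @[k --> \oo] --> 0%E].

Definition in_H10 Omega u : Prop := in_H1 Omega u /\ is_trace Omega u (cst 0).

Definition weakly_harmonic Omega u : Prop :=
  in_H1 Omega u /\ forall v, in_H10 Omega v -> grad_ip Omega u v = 0.

(* Polynomial functions of total degree at most p. *)
Definition is_polynomial (p : nat) q : Prop :=
  exists c : {ffun 'I_n.+1 -> 'I_p.+1} -> R, forall x,
    q x = \sum_(a : {ffun 'I_n.+1 -> 'I_p.+1} | (\sum_i a i <= p)%N)
            c a * \prod_i x 0 i ^+ a i.

Definition in_S Omega (T : set (set Rd)) (p : nat) v : Prop :=
  {within Omega, continuous v} /\
  forall K, T K -> exists2 q, is_polynomial p q & forall x, K x -> v x = q x.

Definition in_S0 Omega T p v : Prop := in_S Omega T p v /\ in_H10 Omega v.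

(* The weak solution of - Delta v = f in Omega, v = 0 on the boundary. *)
Definition poisson_solution Omega f v : Prop :=
  in_H10 Omega v /\
  forall w, in_H10 Omega w -> grad_ip Omega v w = ip Omega f w.

End function_spaces.

Section control_problem.
Context (R : realType) (n : nat) (Omega : set 'rV[R]_n.+1).
Context (lambda : R) (ud : 'rV[R]_n.+1 -> R).
Implicit Types (u v phi : 'rV[R]_n.+1 -> R).

Definition cost v : R :=
  2^-1 * norm_L2 Omega (v \- ud) ^+ 2 + lambda / 2 * norm_H1 Omega v ^+ 2.

Definition is_minimizer u : Prop :=
  weakly_harmonic Omega u /\
  forall v, weakly_harmonic Omega v -> cost u <= cost v.

Definition discrete_solution T (p : nat) u phi : Prop :=
  [/\ in_S Omega T p u, in_S0 Omega T p phi,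
      forall v, in_S Omega T p v ->
        (lambda + 1) * ip Omega u v + lambda * grad_ip Omega u v
          + grad_ip Omega phi v = ip Omega ud v
    & forall psi, in_S0 Omega T p psi -> grad_ip Omega u psi = 0].

(* The two approximation errors on the right-hand side of the estimate. *)
Definition best_error_S T p u : \bar R :=
  ereal_inf [set (norm_H1 Omega (u \- w))%:E | w in in_S Omega T p].

Definition best_error_S0 T p v : \bar R :=
  ereal_inf [set (norm_H1 Omega (v \- w))%:E | w in in_S0 Omega T p].

Definition poisson_error T p : \bar R :=
  ereal_sup [set e | exists f v,
    [/\ in_L2 Omega f, norm_L2 Omega f = 1, poisson_solution Omega f v
      & e = best_error_S0 T p v]].

End control_problem.

(* Main.v *)
(* Both optimality systems are saddle point problems for the semi-inner products
   (u, v) and (grad u, grad v): the state is the Riesz representer of (ud, .) for the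
   energy form on the functions orthogonal to the multiplier space, and the
   multiplier is a Riesz representer on the multiplier space itself.  Riesz
   representation holds on the finite element spaces because they are finite
   dimensional, and on H^1, H^1_0 and the weakly harmonic functions by completeness.
   For the estimate, w in S is corrected by the gradient projection of w - u onto
   S_0, so that it becomes discretely harmonic; coercivity then bounds the distance
   of u_h to it by the errors of approximating u and the continuous multiplier phi.
   Testing with H^1_0 shows that phi solves the Poisson problem with right-hand side
   ud - (lambda + 1) u, so scaling bounds its approximation error by the supremum.
   The Poincare inequality is derived from the definition of the trace: a smooth w is
   estimated on lines by its value where the line leaves Omega, and the boundary term
   is controlled since projections do not increase Hausdorff measure by more than a
   constant; smooth approximations with small boundary integral then give the claim. *)
From HB Require Import structures.
Require Import Defs.
From mathcomp Require Import all_boot all_order all_algebra.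
From mathcomp Require Import all_classical all_reals all_analysis.
From mathcomp Require Import measurable_realfun ring lra.
Import Order.TTheory GRing.Theory Num.Theory.
Import numFieldNormedType.Exports.
Local Open Scope classical_set_scope.
Local Open Scope ring_scope.
Set Implicit Arguments.
Unset Strict Implicit.
Unset Printing Implicit Defensive.

(** * Riesz representation and saddle points for semi-inner products *)

(** Elements of L2 and H^1 are functions rather than classes, and [weak_partial] is an arbitrary
    choice among representatives, so every form here is degenerate: functions vanishing almost
    everywhere have length zero. The abstract part therefore works with semi-inner products relative
    to a set of functions, proves existence of representers without uniqueness, and expresses
    equality as the vanishing of a form; pointwise uniqueness of the discrete pair is recovered
    afterwards from continuity. A second obstacle is that the boundary term of the trace is an
    integral against something used only as an outer measure, so that even the stability of H^1_0
    under sums has to be drawn from subadditivity. Weak differentiability of finite element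
    functions is proved on lines parallel to the axes, which avoids surface integrals over facets.
    The final constant is built from [lambda], the size of a cube containing [Omega], and the L2
    norm of [ud - (lambda + 1) u]; no quantity of the mesh enters it. *)

Lemma small_inv (R : realType) (e : R) : 0 < e ->
  exists N, forall k, (N <= k)%N -> k.+1%:R^-1 < e :> R.
Proof.
move=> e0; exists (Num.trunc e^-1).+1 => k Nk.
rewrite invf_plt ?posrE//; apply: (lt_le_trans (truncnS_gt _)); rewrite ler_nat.
exact: leqW.
Qed.

Section semi_inner_product.
Context (R : realType) (V : lmodType R).
Implicit Types (X Y : set V) (B m g : V -> V -> R) (L : V -> R) (u v w : V).

Definition subspace_of X := X 0 /\ forall a u v, X u -> X v -> X (a *: u + v).

Definition linear_on X L :=
  forall a u v, X u -> X v -> L (a *: u + v) = a * L u + L v.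

(** Definiteness is left out on purpose, and all laws are relative to [X]: integrals are linear only
    on integrable functions, and null functions have length zero. *)
Definition semi_inner X B :=
  [/\ forall u v, X u -> X v -> B u v = B v u,
      forall w, X w -> linear_on X (B^~ w) & forall u, X u -> 0 <= B u u].

(** Squares avoid roots of [B u u]. The sign of [C] is free, so proofs replace it by
    [Num.max C 0]. *)
Definition bounded_by X B L := exists C, forall u, X u -> L u ^+ 2 <= C * B u u.

(** Existence only: with a degenerate form the representer is determined up to vectors of length
    zero. *)
Definition riesz X B := forall L, linear_on X L -> bounded_by X B L ->
  exists2 u, X u & forall v, X v -> B u v = L v.

Definition complete_for X B := forall u : nat -> V, (forall k, X (u k)) ->
  (forall e : R, 0 < e -> exists N, forall i j, (N <= i)%N -> (N <= j)%N ->
     B (u i - u j) (u i - u j) < e) ->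
  exists2 l, X l & forall e : R, 0 < e -> exists N, forall i, (N <= i)%N ->
     B (u i - l) (u i - l) < e.

Definition orthonormal X B k (f : 'I_k -> V) :=
  (forall i, X (f i)) /\ forall i j, B (f i) (f j) = (i == j)%:R.

(** The minimum of the parabola is at [- b / c]. The lemma serves both the Cauchy-Schwarz inequality
    and the optimality of near-minimisers in the Riesz theorem. *)
Lemma discriminant_le (a b c : R) : 0 <= c ->
  (forall t, 0 <= a + 2 * b * t + c * t ^+ 2) -> b ^+ 2 <= a * c.
Proof.
move=> c0 H; have [cz|cn] := eqVneq c 0.
  suff -> : b = 0 by rewrite cz mulr0 expr0n.
  apply/eqP; apply: contraT => bn.
  (* For [c = 0] the function is affine, and at this point it takes the value -1. *)
  have := H (- (a + 1) / (2 * b)); rewrite cz mul0r addr0.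
  have -> : 2 * b * (- (a + 1) / (2 * b)) = - (a + 1) by field.
  lra.
have cp : 0 < c by rewrite lt_neqAle eq_sym cn.
have := H (- b / c).
have -> : a + 2 * b * (- b / c) + c * (- b / c) ^+ 2 = (a * c - b ^+ 2) / c by field.
by rewrite pmulr_lge0 ?invr_gt0// subr_ge0.
Qed.

Lemma sqrB_le (x y : R) : (x - y) ^+ 2 <= 2 * x ^+ 2 + 2 * y ^+ 2.
Proof. by have := sqr_ge0 (x + y); rewrite sqrrD sqrrB; lra. Qed.

Section form.
Context X B (hX : subspace_of X) (hB : semi_inner X B).

Lemma subspace0 : X 0. Proof. by case: hX. Qed.

Lemma subspaceP a u v : X u -> X v -> X (a *: u + v).
Proof. by case: hX => _; exact. Qed.

Lemma subspaceD u v : X u -> X v -> X (u + v).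
Proof. by move=> Xu Xv; rewrite -(scale1r u); exact: subspaceP. Qed.

Lemma subspaceZ a u : X u -> X (a *: u).
Proof. by move=> Xu; rewrite -[_ *: _]addr0; apply: subspaceP => //; exact: subspace0. Qed.

Lemma subspaceB u v : X u -> X v -> X (u - v).
Proof. by move=> Xu Xv; rewrite addrC -scaleN1r; exact: subspaceP. Qed.

Lemma subspace_sum k (a : 'I_k -> R) (f : 'I_k -> V) :
  (forall i, X (f i)) -> X (\sum_i a i *: f i).
Proof.
move=> Xf; apply: (big_ind X); [exact: subspace0|exact: subspaceD|].
by move=> i _; exact: subspaceZ.
Qed.

Section functional.
Context L (hL : linear_on X L).

Lemma linear_on0 : L 0 = 0.
Proof.
have := hL 1 subspace0 subspace0; rewrite scale1r addr0 mul1r => /eqP.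
by rewrite -subr_eq subrr eq_sym => /eqP.
Qed.

Lemma linear_onZ a u : X u -> L (a *: u) = a * L u.
Proof.
by move=> Xu; rewrite -[_ *: _]addr0 hL ?linear_on0 ?addr0//; exact: subspace0.
Qed.

Lemma linear_onD u v : X u -> X v -> L (u + v) = L u + L v.
Proof. by move=> Xu Xv; rewrite -(scale1r u) hL// scale1r mul1r. Qed.

Lemma linear_onB u v : X u -> X v -> L (u - v) = L u - L v.
Proof. by move=> Xu Xv; rewrite addrC -scaleN1r hL// mulN1r addrC. Qed.

Lemma linear_on_sum k (a : 'I_k -> R) (f : 'I_k -> V) :
  (forall i, X (f i)) -> L (\sum_i a i *: f i) = \sum_i a i * L (f i).
Proof.
move=> Xf; elim: k a f Xf => [|k IH] a f Xf; first by rewrite !big_ord0 linear_on0.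
rewrite !big_ord_recl linear_onD ?linear_onZ ?IH//.
- exact: subspaceZ.
- exact: (@subspace_sum _ (fun i => a (lift ord0 i)) (fun i => f (lift ord0 i))).
Qed.

End functional.

Lemma formC u v : X u -> X v -> B u v = B v u. Proof. by case: hB => + _ _; apply. Qed.
Lemma form_ge0 u : X u -> 0 <= B u u. Proof. by case: hB => _ _; apply. Qed.
Lemma form_linl w : X w -> linear_on X (B^~ w). Proof. by case: hB => _ + _; apply. Qed.
Lemma form_linr w : X w -> linear_on X (B w).
Proof.
move=> Xw a u v Xu Xv; rewrite !(formC Xw)//; first exact: form_linl.
exact: subspaceP.
Qed.
Lemma formBl u v w : X u -> X v -> X w -> B (u - v) w = B u w - B v w.
Proof. by move=> Xu Xv Xw; rewrite (linear_onB (form_linl Xw)). Qed.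
Lemma formBr u v w : X u -> X v -> X w -> B w (u - v) = B w u - B w v.
Proof. by move=> Xu Xv Xw; rewrite (linear_onB (form_linr Xw)). Qed.
Lemma formDl u v w : X u -> X v -> X w -> B (u + v) w = B u w + B v w.
Proof. by move=> Xu Xv Xw; rewrite (linear_onD (form_linl Xw)). Qed.
Lemma formDr u v w : X u -> X v -> X w -> B w (u + v) = B w u + B w v.
Proof. by move=> Xu Xv Xw; rewrite (linear_onD (form_linr Xw)). Qed.
Lemma formZl a u w : X u -> X w -> B (a *: u) w = a * B u w.
Proof. by move=> Xu Xw; rewrite (linear_onZ (form_linl Xw)). Qed.
Lemma formZr a u w : X u -> X w -> B w (a *: u) = a * B w u.
Proof. by move=> Xu Xw; rewrite (linear_onZ (form_linr Xw)). Qed.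

Lemma formB_sqr u v : X u -> X v -> B (u - v) (u - v) = B u u - 2 * B u v + B v v.
Proof.
move=> Xu Xv; rewrite formBl ?formBr//; last exact: subspaceB.
by rewrite (formC Xv Xu); ring.
Qed.

Lemma cauchy_schwarz u v : X u -> X v -> B u v ^+ 2 <= B u u * B v v.
Proof.
move=> Xu Xv; apply: discriminant_le; first exact: form_ge0.
move=> t; have Xtv := subspaceZ t Xv.
have := form_ge0 (subspaceD Xu Xtv).
rewrite formDl ?formDr//; try exact: subspaceD.
rewrite (formZl _ Xv Xu) (formZr _ Xv Xu) (formZr _ Xv Xtv) (formZl _ Xv Xv) (formC Xv Xu).
by congr (_ <= _); ring.
Qed.

Lemma form_eq0 u v : X u -> X v -> B u u = 0 -> B u v = 0.
Proof.
move=> Xu Xv u0; have := cauchy_schwarz Xu Xv; rewrite u0 mul0r => h.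
by apply/eqP; rewrite -sqrf_eq0 eq_le h sqr_ge0.
Qed.

Lemma cauchy_schwarz_sqrt u v : X u -> X v ->
  B u v <= Num.sqrt (B u u) * Num.sqrt (B v v).
Proof.
move=> Xu Xv; rewrite -sqrtrM ?form_ge0//.
by apply: le_trans (ler_norm _) _; rewrite -sqrtr_sqr ler_wsqrtr ?cauchy_schwarz.
Qed.

Lemma form_triangle u v : X u -> X v ->
  Num.sqrt (B (u + v) (u + v)) <= Num.sqrt (B u u) + Num.sqrt (B v v).
Proof.
move=> Xu Xv; rewrite -[leRHS]ger0_norm ?addr_ge0 ?sqrtr_ge0// -sqrtr_sqr.
apply: ler_wsqrtr; rewrite sqrrD !sqr_sqrtr ?form_ge0//.
rewrite formDl ?formDr//; try exact: subspaceD.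
by have := cauchy_schwarz_sqrt Xu Xv; rewrite (formC Xv Xu); lra.
Qed.

Lemma form_sqr_dist u v : X u -> X v -> B (u - v) (u - v) = B (v - u) (v - u).
Proof.
move=> Xu Xv; have Xvu := subspaceB Xv Xu.
rewrite -(opprB v u) -(scaleN1r (v - u)) formZl ?formZr//; first by ring.
exact: subspaceZ.
Qed.

Lemma formD_le u v : X u -> X v -> B (u + v) (u + v) <= 2 * (B u u + B v v).
Proof.
move=> Xu Xv; have := form_ge0 (subspaceB Xu Xv).
rewrite formB_sqr// formDl ?formDr//; last exact: subspaceD.
by rewrite (formC Xv Xu); lra.
Qed.

End form.

Lemma semi_innerS X Y B : Y `<=` X -> semi_inner X B -> semi_inner Y B.
Proof.
move=> YX [h1 h2 h3]; split; first by move=> u v /YX Xu /YX; exact: h1.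
- by move=> w /YX Xw a u v /YX Xu /YX; exact: h2.
- by move=> u /YX; exact: h3.
Qed.

Lemma semi_inner_comb X B g a b : 0 <= a -> 0 <= b ->
  semi_inner X B -> semi_inner X g ->
  semi_inner X (fun u v => a * B u v + b * g u v).
Proof.
move=> a0 b0 [B1 B2 B3] [g1 g2 g3]; split.
- by move=> u v Xu Xv; rewrite B1// g1.
- by move=> w Xw c u v Xu Xv /=; rewrite B2// g2//; ring.
- by move=> u Xu; rewrite addr_ge0// mulr_ge0 ?B3 ?g3.
Qed.

(* The representer minimises [B v v - 2 L v]. *)
Lemma riesz_complete X B : subspace_of X -> semi_inner X B ->
  complete_for X B -> riesz X B.
Proof.
move=> hX hB cX L hL [C0 hC0]; pose C := Num.max C0 0.
have C_ge0 : 0 <= C by rewrite le_max lexx orbT.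
have hC u : X u -> L u ^+ 2 <= C * B u u.
  move=> Xu; apply: le_trans (hC0 u Xu) _.
  by rewrite ler_wpM2r ?(form_ge0 hB)// le_max lexx.
pose J v := B v v - 2 * L v.
(* If [L v > 0], then (2 L v)^2 <= 4 C (B v v) <= (B v v + C)^2. *)
have Jlb v : X v -> - C <= J v.
  move=> Xv; have b0 := form_ge0 hB Xv; have := hC v Xv; rewrite /J.
  have [Lneg|Lpos] := leP (L v) 0; first by lra.
  move=> h; have : (2 * L v) ^+ 2 <= (B v v + C) ^+ 2.
    by have := sqr_ge0 (B v v - C); rewrite sqrrB sqrrD exprMn; lra.
  by rewrite ler_pXn2r// ?nnegrE; lra.
pose E := [set J v | v in X].
have Ei : has_inf E.
  split; first by exists (J 0), 0 => //; exact: subspace0 hX.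
  by exists (- C) => _ [v Xv <-]; exact: Jlb.
have mJ v : X v -> inf E <= J v.
  by move=> Xv; apply: ge_inf; [case: Ei|exists v].
have /choice[u hu] : forall k, exists v, X v /\ J v < inf E + k.+1%:R^-1.
  move=> k; have k0 : 0 < k.+1%:R^-1 :> R by rewrite invr_gt0.
  by have [_ [v Xv <-] vE] := inf_adherent k0 Ei; exists v.
have Xu k : X (u k) by have [] := hu k.
have Ju k : J (u k) < inf E + k.+1%:R^-1 by have [] := hu k.
have JD v w t : X v -> X w -> J (v + t *: w) =
    J v + 2 * (B v w - L w) * t + B w w * t ^+ 2.
  move=> Xv Xw; have Xtw := subspaceZ hX t Xw; have Xs := subspaceD hX Xv Xtw.
  rewrite /J (formDl hB Xv Xtw Xs) (formDr hX hB Xv Xtw Xv) (formDr hX hB Xv Xtw Xtw).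
  rewrite (formZl hX hB _ Xw Xv) (formZr hX hB _ Xw Xv) (formZr hX hB _ Xw Xtw).
  rewrite (formZl hX hB _ Xw Xw) (formC hB Xw Xv) (linear_onD hL Xv Xtw).
  by rewrite (linear_onZ hX hL _ Xw); ring.
(* Parallelogram law: [J] at the midpoint of [v] and [w] is at least the infimum. Hence minimising
   sequences are Cauchy. *)
have par v w : X v -> X w -> B (v - w) (v - w) <= 2 * (J v + J w - 2 * inf E).
  move=> Xv Xw; have Xd := subspaceB hX Xv Xw.
  have := mJ _ (subspaceD hX Xw (subspaceZ hX 2^-1 Xd)).
  have vE : J v = J (w + 1 *: (v - w)) by rewrite scale1r subrKC.
  by rewrite vE !JD//; lra.
have [l Xl hl] : exists2 l, X l & forall e : R, 0 < e -> exists N, forall i,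
    (N <= i)%N -> B (u i - l) (u i - l) < e.
  apply: cX => // e e0.
  have e4 : 0 < e / 4 by rewrite divr_gt0.
  have [N hN] := small_inv e4.
  exists N => i j Ni Nj; apply: le_lt_trans (par _ _ (Xu i) (Xu j)) _.
  move: (Ju i) (Ju j) (hN i Ni) (hN j Nj).
  set x := _^-1; set y := _^-1; set Ji := J _; set Jj := J _; set E0 := inf _.
  by clearbody x y Ji Jj E0; lra.
exists l => // v Xv; have Bv := form_ge0 hB Xv.
apply/eqP; rewrite -subr_eq0 -sqrf_eq0 eq_le sqr_ge0 andbT.
apply/ler_addgt0Pr => e e0; rewrite add0r.
(* Two squares, each at most [d * B v v <= e / 4], will be doubled by [sqrB_le]. *)
pose d := e / (4 * (B v v + 1)).
have d0 : 0 < d by rewrite divr_gt0// mulr_gt0// ltr_wpDl.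
have [N1 h1] := small_inv d0; have [N2 h2] := hl _ d0.
pose k := maxn N1 N2.
have {}h1 := h1 k (leq_maxl _ _); have {}h2 := h2 k (leq_maxr _ _).
(* Since [u k] misses the infimum by less than 1/(k+1), the parabola t -> J (u k + t v) - J (u k) +
   1/(k+1) is nonnegative; its discriminant gives an approximate Euler equation. *)
have D1 : (B (u k) v - L v) ^+ 2 <= k.+1%:R^-1 * B v v.
  apply: discriminant_le => // t.
  have := mJ _ (subspaceD hX (Xu k) (subspaceZ hX t Xv)).
  rewrite JD//; move: (Ju k).
  set x := _^-1; set Jk := J _; set E0 := inf _; set b := B _ _ - _.
  by clearbody x Jk E0 b; lra.
have Xd := subspaceB hX (Xu k) Xl.
have D2 := cauchy_schwarz hX hB Xd Xv.
have D3 : B l v - L v = (B (u k) v - L v) - B (u k - l) v.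
  by rewrite (formBl hB)//; ring.
rewrite D3.
set x := B (u k) v - L v in D1 *; set y := B (u k - l) v in D2 *.
apply: le_trans (sqrB_le _ _) _.
have E1 : x ^+ 2 <= d * B v v by apply: le_trans D1 _; rewrite ler_wpM2r// ltW.
have E2 : y ^+ 2 <= d * B v v by apply: le_trans D2 _; rewrite ler_wpM2r// ltW.
have E3 : d * B v v <= e / 4.
  rewrite /d; have -> : e / (4 * (B v v + 1)) * B v v = e / 4 * (B v v / (B v v + 1)).
    by field; rewrite lt0r_neq0// ltr_wpDl.
  rewrite ler_piMr ?divr_ge0 ?ltW// ltr_pdivrMr ?mul1r ?ltrDl//.
  by rewrite ltr_wpDl.
by clearbody x y d; lra.
Qed.

(** Take an orthonormal family of maximal size. The residual of any vector after projection has
    length zero, since otherwise its normalisation would extend the family, and a bounded functional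
    vanishes on vectors of length zero. So [L] is determined by its values on the family. *)
Lemma riesz_finite_dim X B (N : nat) : subspace_of X -> semi_inner X B ->
  (forall k (f : 'I_k -> V), orthonormal X B f -> (k <= N)%N) -> riesz X B.
Proof.
move=> hX hB hN L hL [C hC].
pose P k := `[< exists f : 'I_k -> V, orthonormal X B f >].
have P0 : exists k, P k by exists 0; apply/asboolP; exists (fun=> 0); split; case.
have PN k : P k -> (k <= N)%N by move=> /asboolP[f /hN].
case: (ex_maxnP P0 PN) => k /asboolP[f [Xf fo]] kmax.
pose r v := v - \sum_i B v (f i) *: f i.
have Xs v : X (\sum_i B v (f i) *: f i).
  exact: (@subspace_sum _ hX _ (fun i => B v (f i)) f).
have Xr v : X v -> X (r v) by move=> Xv; exact: subspaceB.
have ro v j : X v -> B (r v) (f j) = 0.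
  move=> Xv; rewrite /r (formBl hB)//.
  rewrite (@linear_on_sum _ hX _ (form_linl hB (Xf j)) _ (fun i => B v (f i)) f)//.
  rewrite (bigD1 j)//= fo eqxx mulr1 big1 ?addr0 ?subrr// => i ij.
  by rewrite fo (negbTE ij) mulr0.
have r0 v : X v -> B (r v) (r v) = 0.
  move=> Xv; apply/eqP; apply: contraT => rn.
  have rp : 0 < B (r v) (r v) by rewrite lt_neqAle eq_sym rn (form_ge0 hB (Xr v Xv)).
  pose c := (Num.sqrt (B (r v) (r v)))^-1.
  suff /kmax : P k.+1 by rewrite ltnn.
  apply/asboolP; exists (fun i => if unlift ord0 i is Some j then f j else c *: r v).
  have Xcr : X (c *: r v) by apply: subspaceZ => //; exact: Xr.
  split=> [i|i j]; first by case: (unlift ord0 i).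
  case: (unliftP ord0 i) => [i' ->|->]; case: (unliftP ord0 j) => [j' ->|->].
  - by rewrite fo (inj_eq lift_inj).
  - rewrite (formZr hX hB)// ?(formC hB (Xf i') (Xr _ Xv)) ?ro ?mulr0//; last exact: Xr.
  - rewrite (formZl hX hB)// ?ro ?mulr0//; last exact: Xr.
  - rewrite eqxx (formZr hX hB)// ?(formZl hX hB)//; try exact: Xr.
    by rewrite mulrA -expr2 exprVn sqr_sqrtr ?ltW// mulVf.
exists (\sum_i L (f i) *: f i).
  exact: (@subspace_sum _ hX _ (fun i => L (f i)) f).
move=> v Xv.
have Lr : L (r v) = 0.
  apply/eqP; rewrite -sqrf_eq0 eq_le sqr_ge0 andbT.
  by apply: le_trans (hC _ (Xr v Xv)) _; rewrite r0// mulr0.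
rewrite (@linear_on_sum _ hX _ (form_linl hB Xv) _ (fun i => L (f i)) f)//.
move/eqP: Lr; rewrite /r (linear_onB hL)// subr_eq0 => /eqP ->.
rewrite (@linear_on_sum _ hX _ hL _ (fun i => B v (f i)) f)//.
by apply: eq_bigr => i _; rewrite (formC hB (Xf i) Xv) mulrC.
Qed.

(** * Saddle point problems and their discretisation *)

Section mixed.
Context (lambda K : R) (lambda_gt0 : 0 < lambda) (K_ge0 : 0 <= K).
Context (X : set V) (m g : V -> V -> R) (hX : subspace_of X).
Context (hm : semi_inner X m) (hg : semi_inner X g).

(** Second derivative of the control cost: [lambda + 1] collects the misfit and the L2 part of the
    regularisation, [lambda] the gradient part. *)
Let a u v := (lambda + 1) * m u v + lambda * g u v.
Let H u v := 1 * m u v + 1 * g u v.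

Lemma semi_inner_energy : semi_inner X a.
Proof. by apply: semi_inner_comb; rewrite ?addr_ge0 ?ltW. Qed.

Lemma semi_inner_sum : semi_inner X H.
Proof. exact: semi_inner_comb. Qed.

Definition saddle_point (S S0 : set V) L u phi :=
  [/\ S u, S0 phi, forall v, S v -> a u v + g phi v = L v
    & forall psi, S0 psi -> g u psi = 0].

Section pair.
Context (S S0 : set V) (SX : S `<=` X) (S0S : S0 `<=` S).
Context (hS : subspace_of S) (hS0 : subspace_of S0).
Context (poincare : forall psi, S0 psi -> m psi psi <= K * g psi psi).

Let S0X : S0 `<=` X. Proof. exact: subset_trans SX. Qed.
Let ha := semi_inner_energy.

(** Weakly harmonic functions for the continuous pair of spaces, discretely harmonic ones for the
    finite element pair. *)
Definition orthogonal_in := [set v | S v /\ forall psi, S0 psi -> g v psi = 0].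

Lemma subspace_orthogonal : subspace_of orthogonal_in.
Proof.
split.
  split=> [|psi S0psi]; first exact: subspace0 hS.
  have h := linear_on0 hX (form_linl hg (S0X S0psi)). exact: h.
move=> c u v [Su uo] [Sv vo]; split; first exact: subspaceP.
move=> psi S0psi; rewrite (form_linl hg (S0X S0psi))//; try exact: SX.
by rewrite uo// vo// mulr0 addr0.
Qed.

(** The component [v0] is the [g]-projection onto [S0], obtained as the representer of [g v]. *)
Lemma orthogonal_split : riesz S0 g -> forall v, S v ->
  exists2 v0, S0 v0 & orthogonal_in (v - v0).
Proof.
move=> rg v Sv.
have [v0 S0v0 hv0] : exists2 v0, S0 v0 & forall w, S0 w -> g v0 w = g v w.
  apply: rg; first by move=> c u w /S0X Xu /S0X Xw; exact: (form_linr hX hg (SX Sv)).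
  by exists (g v v) => u /S0X Xu; apply: (cauchy_schwarz hX hg) => //; exact: SX.
exists v0 => //; split; first by apply: subspaceB => //; exact: S0S.
move=> psi S0psi; rewrite (formBl hg) ?hv0 ?subrr//; try exact: S0X.
exact: SX.
Qed.

(** Null space method: [u] solves the equation tested with the constraint space, where the
    multiplier drops out, and [phi] represents the remaining residual on [S0]. A general test
    function is split by [orthogonal_split]. *)
Lemma saddle_point_exists L : riesz S0 g -> riesz orthogonal_in a ->
  linear_on S L -> bounded_by S m L -> exists u phi, saddle_point S S0 L u phi.
Proof.
move=> rg ra hL [C hC].
have m0 u : S u -> 0 <= m u u by move=> /SX; exact: form_ge0.
have g0 u : S u -> 0 <= g u u by move=> /SX; exact: form_ge0.
wlog C0 : C hC / 0 <= C.
  move=> /(_ (Num.max C 0)); apply; last by rewrite le_max lexx orbT.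
  by move=> u Su; apply: le_trans (hC u Su) _; rewrite ler_wpM2r ?m0// le_max lexx.
have [u [Su uo] ua] : exists2 u, orthogonal_in u &
    forall v, orthogonal_in v -> a u v = L v.
  apply: ra; first by move=> c u v [Su _] [Sv _]; exact: hL.
  exists C => u [Su _]; apply: le_trans (hC u Su) _; rewrite ler_wpM2l// /a.
  have := mulr_ge0 (ltW lambda_gt0) (m0 u Su).
  by have := mulr_ge0 (ltW lambda_gt0) (g0 u Su); lra.
have Xu := SX Su.
have [phi S0phi hphi] : exists2 phi, S0 phi &
    forall psi, S0 psi -> g phi psi = L psi - (lambda + 1) * m u psi.
  apply: rg.
    move=> c v w S0v S0w; have Xv := S0X S0v; have Xw := S0X S0w.
    by rewrite hL ?(form_linr hX hm Xu)//; [ring|exact: S0S|exact: S0S].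
  (* The residual has two terms, each bounded in [m]; [sqrB_le] gives the factor 2, and the Poincare
     inequality the factor [K] that turns [m] into [g]. *)
  exists (2 * (C + (lambda + 1) ^+ 2 * m u u) * K) => v S0v; have Sv := S0S S0v.
  set x := L v; set y := (lambda + 1) * m u v.
  apply: le_trans (sqrB_le _ _) _.
  have x2 : x ^+ 2 <= C * m v v by exact: hC.
  have y2 : y ^+ 2 <= (lambda + 1) ^+ 2 * m u u * m v v.
    rewrite exprMn -mulrA ler_wpM2l ?sqr_ge0// (cauchy_schwarz hX hm)//.
    exact: SX.
  apply: (@le_trans _ _ (2 * (C + (lambda + 1) ^+ 2 * m u u) * m v v)); first by clearbody x y; lra.
  rewrite -[leRHS]mulrA ler_wpM2l ?poincare// mulr_ge0// addr_ge0// mulr_ge0 ?m0//.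
  exact: sqr_ge0.
exists u, phi; split=> // v Sv.
have [v0 S0v0 [Sd dO]] := orthogonal_split rg Sv.
have Xv0 := S0X S0v0; have Xd := SX Sd; have Xphi := S0X S0phi.
have vE : v = v0 + (v - v0) by rewrite subrKC.
rewrite vE (formDr hX ha)// (formDr hX hg)// (linear_onD hL (S0S S0v0) Sd).
rewrite (ua (v - v0)) //.
by rewrite hphi// (formC hg Xphi Xd) dO// /a uo//; ring.
Qed.

(** Testing with the difference of the states removes the multiplier and leaves the energy of that
    difference; testing with the difference of the multipliers then leaves its gradient, and the
    Poincare inequality bounds its length. *)
Lemma saddle_point_unique L u phi u' phi' :
  saddle_point S S0 L u phi -> saddle_point S S0 L u' phi' ->
  m (u' - u) (u' - u) = 0 /\ m (phi' - phi) (phi' - phi) = 0.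
Proof.
move=> [Su S0p hu uo] [Su' S0p' hu' uo'].
have Xu := SX Su; have Xu' := SX Su'; have Xp := S0X S0p; have Xp' := S0X S0p'.
have S0d := subspaceB hS0 S0p' S0p; have Sd := subspaceB hS Su' Su.
have Xd := SX Sd; have Xpd := S0X S0d.
have eqd v : S v -> a (u' - u) v + g (phi' - phi) v = 0.
  move=> Sv; have Xv := SX Sv.
  by rewrite (formBl ha)// (formBl hg)//; have := hu v Sv; have := hu' v Sv; lra.
have gd psi : S0 psi -> g (u' - u) psi = 0.
  move=> S0psi; have Xpsi := S0X S0psi.
  by rewrite (formBl hg)// uo// uo'// subrr.
have mu0 : m (u' - u) (u' - u) = 0.
  have := eqd _ Sd; rewrite (formC hg Xpd Xd) gd// addr0 /a => h.
  have := form_ge0 hm Xd; have := form_ge0 hg Xd.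
  move=> g0 m0; have lg := mulr_ge0 (ltW lambda_gt0) g0.
  have lm := mulr_ge0 (ltW lambda_gt0) m0.
  by apply/eqP; rewrite eq_le m0 andbT; lra.
split=> //.
have := eqd _ (S0S S0d); rewrite /a gd// (form_eq0 hX hm Xd Xpd mu0) !mulr0 !add0r => g0.
apply/eqP; rewrite eq_le (form_ge0 hm Xpd) andbT.
by apply: le_trans (poincare S0d) _; rewrite g0 mulr0.
Qed.

End pair.

(* [w] is made orthogonal to [S0] by subtracting the projection [z] of [w - u], which
   costs the Poincare constant; then [uh - (w - z)] only sees [phi - psi]. *)
Lemma quasi_optimality (X0 S S0 : set V) L u phi uh phih w psi :
  X0 `<=` X -> S `<=` X -> S0 `<=` S -> S0 `<=` X0 ->
  subspace_of X0 -> subspace_of S -> subspace_of S0 ->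
  (forall z, X0 z -> m z z <= K * g z z) -> riesz S0 g ->
  saddle_point X X0 L u phi -> saddle_point S S0 L uh phih ->
  S w -> S0 psi ->
  Num.sqrt (H (u - uh) (u - uh)) <=
    ((1 + (lambda + 1) / lambda) * (1 + Num.sqrt (K + 1)) + lambda^-1) *
    (Num.sqrt (H (u - w) (u - w)) + Num.sqrt (H (phi - psi) (phi - psi))).
Proof.
move=> X0X SX S0S S0X0 hX0 hS hS0 poincare rg [Xu X0phi hu uo] [Suh S0phih huh uoh] Sw S0psi.
have hH := semi_inner_sum; have ha := semi_inner_energy.
have S0X : S0 `<=` X by exact: subset_trans S0S SX.
have Xw := SX _ Sw; have Xphi := X0X _ X0phi; have Xpsi := S0X _ S0psi.
have Xuh := SX _ Suh; have Xphih := S0X _ S0phih.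
have Xwu := subspaceB hX Xw Xu; have Xpp := subspaceB hX Xphi Xpsi.
pose N v := Num.sqrt (H v v).
have N0 v : 0 <= N v by exact: sqrtr_ge0.
have N2 v : X v -> N v ^+ 2 = H v v by move=> Xv; rewrite sqr_sqrtr ?(form_ge0 hH Xv).
have [z S0z hz] : exists2 z, S0 z & forall q, S0 q -> g z q = g (w - u) q.
  apply: rg; first by move=> c v q /S0X Xv /S0X Xq; exact: (form_linr hX hg Xwu).
  by exists (g (w - u) (w - u)) => v /S0X Xv; exact: (cauchy_schwarz hX hg).
have Xz := S0X _ S0z.
(* A projection does not increase the seminorm: expand g at z - (w - u), using g z z = g (w - u)
   z. *)
have gz : g z z <= g (w - u) (w - u).
  have zz := hz _ S0z; have := form_ge0 hg (subspaceB hX Xz Xwu).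
  by rewrite (formB_sqr hX hg)// (formC hg Xz Xwu); lra.
(* Here H z z = m z z + g z z <= (K + 1) g z z, which explains [K + 1]. *)
have Nz : N z <= Num.sqrt (K + 1) * N (u - w).
  rewrite /N -sqrtrM; last by rewrite addr_ge0.
  apply: ler_wsqrtr; rewrite (form_sqr_dist hX hH Xu Xw) /H !mul1r.
  have := poincare _ (S0X0 _ S0z); have := ler_wpM2l K_ge0 gz.
  have := form_ge0 hm Xwu => m0; have := mulr_ge0 K_ge0 m0.
  by lra.
pose wt := w - z; have Swt : S wt by apply: subspaceB => //; exact: S0S.
have Xwt := SX _ Swt; have Xuwt := subspaceB hX Xu Xwt.
have Nuwt : N (u - wt) <= (1 + Num.sqrt (K + 1)) * N (u - w).
  have -> : u - wt = (u - w) + z by rewrite /wt opprB addrCA addrC.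
  apply: le_trans (form_triangle hX hH (subspaceB hX Xu Xw) Xz) _.
  by rewrite mulrDl mul1r lerD2l.
pose e := uh - wt; have Se : S e by exact: subspaceB.
have Xe := SX _ Se.
have eo q : S0 q -> g e q = 0.
  move=> S0q; have Xq := S0X _ S0q; rewrite /e /wt.
  rewrite (formBl hg)// uoh// (formBl hg)// hz// (formBl hg)// uo; last exact: S0X0.
  by ring.
(* Difference of the two first equations. As [e] is orthogonal to [S0], the term of [phih]
   disappears and [psi] can be inserted at no cost. *)
have ae : a e e = g (phi - psi) e + a (u - wt) e.
  have := hu e Xe; have := huh e Se.
  rewrite (formC hg Xphih Xe) eo// addr0 => h1 h2.
  rewrite (formBl hg)// (formC hg Xpsi Xe) eo// subr0.
  have -> : a e e = a uh e - a wt e by rewrite -(formBl ha).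
  by rewrite (formBl ha)//; lra.
(* Coercivity and continuity of the energy: a = lambda H + m, and m <= H. *)
have aN v : X v -> lambda * N v ^+ 2 <= a v v <= (lambda + 1) * N v ^+ 2.
  move=> Xv; rewrite N2// /a /H.
  have m0 := form_ge0 hm Xv; have g0 := form_ge0 hg Xv.
  by have := mulr_ge0 (ltW lambda_gt0) g0; lra.
have l1 : 0 <= lambda + 1 by rewrite addr_ge0// ltW.
have aCS v q : X v -> X q -> a v q <= (lambda + 1) * (N v * N q).
  move=> Xv Xq; apply: le_trans (cauchy_schwarz_sqrt hX ha Xv Xq) _.
  have sq t : X t -> Num.sqrt (a t t) <= Num.sqrt (lambda + 1) * N t.
    move=> Xt; rewrite -(ger0_norm (N0 t)) -sqrtr_sqr -sqrtrM//.
    by apply: ler_wsqrtr; have /andP[] := aN t Xt.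
  have -> : (lambda + 1) * (N v * N q) =
      (Num.sqrt (lambda + 1) * N v) * (Num.sqrt (lambda + 1) * N q).
    by rewrite mulrACA -expr2 sqr_sqrtr.
  by apply: ler_pM; rewrite ?sqrtr_ge0// sq.
have gCS v q : X v -> X q -> g v q <= N v * N q.
  move=> Xv Xq; apply: le_trans (cauchy_schwarz_sqrt hX hg Xv Xq) _.
  have sq t : X t -> Num.sqrt (g t t) <= N t.
    by move=> Xt; apply: ler_wsqrtr; rewrite /H !mul1r lerDr (form_ge0 hm).
  by apply: ler_pM; rewrite ?sqrtr_ge0// sq.
have Ne : lambda * N e <= N (phi - psi) + (lambda + 1) * N (u - wt).
  have /andP[h _] := aN e Xe; rewrite ae in h.
  have h1 := gCS _ _ Xpp Xe; have h2 := aCS _ _ Xuwt Xe.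
  have [->|ne] := eqVneq (N e) 0.
    by rewrite mulr0 addr_ge0// mulr_ge0.
  have ep : 0 < N e by rewrite lt_neqAle eq_sym ne N0.
  rewrite -(ler_pM2r ep) -mulrA -expr2.
  by apply: le_trans h _; rewrite mulrDl -mulrA lerD.
have {}Ne : N e <= lambda^-1 * N (phi - psi) + (lambda + 1) / lambda * N (u - wt).
  rewrite -(ler_pM2l lambda_gt0); apply: le_trans Ne _.
  by rewrite le_eqVlt; apply/orP; left; apply/eqP; field; rewrite lt0r_neq0.
have Nfin : N (u - uh) <= N (u - wt) + N e.
  have -> : u - uh = (u - wt) + (wt - uh) by rewrite addrA subrK.
  apply: le_trans (form_triangle hX hH Xuwt (subspaceB hX Xwt Xuh)) _.
  by rewrite lerD2l /N (form_sqr_dist hX hH Xwt Xuh).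
rewrite -/(N _) -/(N (u - w)) -/(N (phi - psi)).
apply: le_trans Nfin _; apply: le_trans (lerD (lexx _) Ne) _.
set x := N (u - w); set y := N (phi - psi) in Ne *; set c := (lambda + 1) / lambda.
have c0 : 0 <= c by rewrite divr_ge0// ltW.
set k := 1 + Num.sqrt (K + 1) in Nuwt *.
have k0 : 0 <= k by rewrite addr_ge0// sqrtr_ge0.
have x0 : 0 <= x by exact: N0.
have y0 : 0 <= y by exact: N0.
have li0 : 0 <= lambda^-1 by rewrite invr_ge0 ltW.
have h1 : (1 + c) * N (u - wt) <= (1 + c) * (k * x) by rewrite ler_wpM2l// addr_ge0.
have h2 := mulr_ge0 li0 x0.
have h3 : 0 <= (1 + c) * k * y by rewrite !mulr_ge0// addr_ge0.
by clearbody c k x y; lra.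
Qed.

End mixed.
End semi_inner_product.

(** * The space of square integrable functions *)

Section square_integrable.
Context d (T : measurableType d) (R : realType).
Context (mu : {measure set T -> \bar R}) (D : set T) (mD : measurable D).
Implicit Types f g : T -> R.

(** Stated over a general measure, as it serves both the domain in R^d and segments of a line; on
    [Omega] it unfolds to [in_L2]. *)
Definition L2_fun f := measurable_fun D f /\ (\int[mu]_(x in D) (f x ^+ 2)%:E < +oo)%E.

Let I f g : R := \int[mu]_(x in D) (f x * g x).

Lemma measurable_sqr f : measurable_fun D f -> measurable_fun D (EFin \o (fun x => f x ^+ 2 : R)).
Proof. by move=> mf; apply/measurable_EFinP; exact: measurable_funX. Qed.

Lemma integrable_sqr f : L2_fun f -> mu.-integrable D (fun x => (f x ^+ 2)%:E).
Proof.
move=> [mf fi]; apply/integrableP; split; first exact: measurable_sqr.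
by under eq_integral do rewrite gee0_abs ?lee_fin ?sqr_ge0//.
Qed.

Lemma integrable_mul f g : L2_fun f -> L2_fun g ->
  mu.-integrable D (EFin \o (fun x => f x * g x)).
Proof.
move=> Lf Lg; have mf := Lf.1; have mg := Lg.1.
apply: (@le_integrable _ _ _ mu D mD _ (fun x => (f x ^+ 2)%:E + (g x ^+ 2)%:E)%E).
- by apply/measurable_EFinP; exact: measurable_funM.
- move=> x _; rewrite /= lee_fin normrM [leRHS]ger0_norm ?addr_ge0 ?sqr_ge0//.
  rewrite -(real_normK (num_real (f x))) -(real_normK (num_real (g x))).
  have := sqr_ge0 (`|f x| - `|g x|); rewrite sqrrB.
  by have := mulr_ge0 (normr_ge0 (f x)) (normr_ge0 (g x)); lra.
- by apply: integrableD => //; exact: integrable_sqr.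
Qed.

Lemma L2_subspace : subspace_of (L2_fun : set (T -> R)).
Proof.
split.
  split; first exact: measurable_cst.
  by under eq_integral do rewrite expr0n/=; rewrite integral0.
move=> a f g Lf Lg; have [mf fi] := Lf; have [mg gi] := Lg.
have mfg : measurable_fun D (a *: f + g).
  by apply: measurable_funD => //; exact: measurable_funM.
split=> //.
apply: (@le_lt_trans _ _ (\int[mu]_(x in D)
    ((2 * a ^+ 2)%:E * (f x ^+ 2)%:E + 2%:E * (g x ^+ 2)%:E))%E).
  apply: ge0_le_integral => //.
  - by move=> x _; rewrite lee_fin sqr_ge0.
  - exact: measurable_sqr.
  - by apply: emeasurable_funD; apply: measurable_funeM; exact: measurable_sqr.
  move=> x _; rewrite -!EFinM -EFinD lee_fin.
  have -> : (a *: f + g) x = a * f x - - g x by rewrite opprK.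
  by apply: le_trans (sqrB_le _ _) _; rewrite sqrrN exprMn mulrA.
have hf := integrable_sqr Lf; have hg := integrable_sqr Lg.
have := integrable_fin_num mD (@integrableD _ _ _ mu D mD _ _
  (integrableZl mD (2 * a ^+ 2) hf) (integrableZl mD 2 hg)).
by rewrite fin_num_abs; apply: le_lt_trans; exact: lee_abs.
Qed.

Lemma L2_semi_inner : semi_inner (L2_fun : set (T -> R)) I.
Proof.
split.
- by move=> f g _ _; apply: eq_Rintegral => x _; rewrite mulrC.
- move=> h Lh a f g Lf Lg; rewrite /I -RintegralZl//; last exact: integrable_mul.
  rewrite -RintegralD//.
  + by apply: eq_Rintegral => x _ /=; rewrite mulrDl -scalerAl.
  + by have := integrableZl mD a (integrable_mul Lf Lh).
  + exact: integrable_mul.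
- by move=> f _; apply: Rintegral_ge0 => x _; rewrite -expr2 sqr_ge0.
Qed.

Lemma L2_ipE f : L2_fun f -> (I f f)%:E = (\int[mu]_(x in D) (f x ^+ 2)%:E)%E.
Proof.
move=> Lf; rewrite /I /Rintegral fineK//.
by apply: integrable_fin_num => //; exact: integrable_sqr.
Qed.

Lemma L2_ip_eq0 f : L2_fun f -> I f f = 0 -> {ae mu, forall x, D x -> f x = 0}.
Proof.
move=> Lf f0; have := L2_ipE Lf; rewrite f0 => /esym h.
have /ae_eq_integral_abs : measurable_fun D (EFin \o (fun x => f x ^+ 2 : R)).
  exact: measurable_sqr Lf.1.
move=> /(_ mu mD)[+ _]; under eq_integral do rewrite gee0_abs ?lee_fin ?sqr_ge0//.
move=> /(_ h); apply: filterS => x /= hx Dx.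
by have [/eqP] := hx Dx; rewrite sqrf_eq0 => /eqP.
Qed.

Lemma ae_L2 f g : measurable_fun D g -> {ae mu, forall x, D x -> f x = g x} ->
  L2_fun f -> L2_fun g.
Proof.
move=> mg fg [mf fi]; split=> //.
rewrite -(@ae_eq_integral _ _ _ mu D (fun x => (g x ^+ 2)%:E) (fun x => (f x ^+ 2)%:E))//;
  try exact: measurable_sqr.
by apply: filterS fg => x /= h Dx; rewrite h.
Qed.

Lemma ae_ip f g h : L2_fun f -> L2_fun g -> L2_fun h ->
  {ae mu, forall x, D x -> f x = g x} -> I f h = I g h.
Proof.
move=> [mf _] [mg _] [mh _] fg; rewrite /I /Rintegral; congr fine.
apply: ae_eq_integral => //; try by apply/measurable_EFinP; exact: measurable_funM.
by apply: filterS fg => x /= e Dx; rewrite e.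
Qed.


(* A subsequence with [|f_(k+1) - f_k|^2 < 8^-(k+1)] makes [\sum_k 4^k (f_(k+1) - f_k)^2]
   integrable, hence almost everywhere finite, and then it converges geometrically. *)
Lemma L2_complete : complete_for (L2_fun : set (T -> R)) I.
Proof.
have hX := L2_subspace; have hI := L2_semi_inner.
move=> u Lu cu.
have /choice[N hN] : forall k, exists N, forall i j, (N <= i)%N -> (N <= j)%N ->
    I (u i - u j) (u i - u j) < (8^-1) ^+ k.+1.
  by move=> k; apply: cu; rewrite exprn_gt0 ?invr_gt0.
(* The maximum makes [phi] monotone and at least [N k]; the summand [k] makes it tend to infinity,
   which the Fatou argument needs. *)
pose phi k := (k + \max_(j < k.+1) N j)%N.
have Nphi k : (N k <= phi k)%N 
  by apply: leq_trans (leq_addl _ _); exact: (leq_bigmax (Ordinal (ltnSn k))).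
have phiS k : (phi k <= phi k.+1)%N 
  by rewrite /phi; apply: leq_add => //; rewrite [leqRHS]big_ord_recr leq_maxl.
pose dd k := u (phi k.+1) - u (phi k).
have Ldd k : L2_fun (dd k) by exact: (subspaceB hX).
have ddI k : I (dd k) (dd k) < (8^-1) ^+ k.+1.
  by apply: hN => //; exact: leq_trans (phiS k).
(* The weight 4^k is balanced: against 8^-(k+1) it leaves the summable bound 2^-(k+1), while
   finiteness of the sum at a point forces the increments there to decay like 2^-k. *)
pose F k x : \bar R := ((4 ^+ k) * dd k x ^+ 2)%:E.
have mF k : measurable_fun D (F k).
  apply/measurable_EFinP; apply: measurable_funM => //.
  by apply: measurable_funX; exact: (Ldd k).1.
have F0 k x : D x -> (0 <= F k x)%E.
  by move=> _; rewrite lee_fin mulr_ge0 ?sqr_ge0// exprn_ge0.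
pose h x := (\sum_(k <oo) F k x)%E.
have mh : measurable_fun D h by apply: ge0_emeasurable_sum => // k x Dx _; exact: F0.
have h0 x : D x -> (0 <= h x)%E by move=> Dx; apply: nneseries_ge0 => k _ _; exact: F0.
have ih : (\int[mu]_(x in D) h x < +oo)%E.
  rewrite integral_nneseries//.
  apply: (@le_lt_trans _ _ (\sum_(k <oo) (1 / (2 ^ (k + 1))%:R)%:E)%E).
    apply: lee_nneseries => [k _ _|k _].
      by apply: integral_ge0 => x; exact: F0.
    rewrite /F; under eq_integral do rewrite EFinM.
    rewrite ge0_integralZl//; last 2 first.
    - exact: measurable_sqr (Ldd k).1.
    - by move=> x _; rewrite lee_fin sqr_ge0.
    rewrite -L2_ipE// -EFinM lee_fin.
    apply: (@le_trans _ _ (4 ^+ k * (8^-1) ^+ k.+1)).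
      by rewrite ler_wpM2l ?exprn_ge0// ltW.
    rewrite addn1 natrX div1r -exprVn.
    have -> : (2^-1 : R) ^+ k.+1 = 4 ^+ k.+1 * (8^-1) ^+ k.+1.
      by rewrite -exprMn; congr (_ ^+ _); field.
    rewrite ler_wpM2r ?exprn_ge0 ?invr_ge0// exprS ler_peMl ?exprn_ge0//.
    by rewrite ler1n.
  have /cvg_lim := @cvg_geometric_eseries_half R 1 0.
  by move=> /(_ (@ereal_hausdorff R)) ->; rewrite ltry.
have hae : {ae mu, forall x, D x -> h x \is a fin_num}.
  apply: integrable_ae => //; apply/integrableP; split=> //.
  rewrite (@eq_integral _ _ _ mu D h)// => x /set_mem Dx.
  by rewrite gee0_abs// h0.
pose E := D `&` h @^-1` `]-oo, (+oo%E)[%classic.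
have mE : measurable E by apply: mh => //; exact: emeasurable_itv.
(* Cutting off outside the set where the series is finite makes the sequence converge at every point
   of [D], so that its limit is measurable. *)
pose v k := u (phi k) \_ E.
have mv k : measurable_fun D (v k).
  apply/measurable_restrict => //; apply: measurable_funS (Lu (phi k)).1 => //.
have cv x : D x -> cvgn (v^~ x).
  move=> Dx; have [Ex|nEx] := pselect (E x); last first.
    rewrite (_ : v^~ x = cst 0); first exact: is_cvg_cst.
    by apply/funext => k; rewrite /v/patch (memNset nEx).
  rewrite (_ : v^~ x = fun k => u (phi k) x); last first.
    by apply/funext => k; rewrite /v patchT// mem_set.
  pose H := fine (h x).
  have hH : h x = H%:E.
    rewrite fineK// ge0_fin_numE ?h0//.
    by case: Ex => _ /=; rewrite in_itv/=.
  have dk k : `|dd k x| <= Num.sqrt H * (2^-1) ^+ k.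
    have : (F k x <= h x)%E.
      apply: (@le_trans _ _ (\sum_(0 <= i < k.+1) F i x)%E).
        by rewrite big_nat_recr//= leeDr//; apply: sume_ge0 => i _; exact: F0.
      by apply: nneseries_lim_ge => i i0 _; exact: F0.
    rewrite hH lee_fin => hk.
    have : Num.sqrt (4 ^+ k * dd k x ^+ 2) <= Num.sqrt H by exact: ler_wsqrtr.
    have -> : 4 ^+ k * dd k x ^+ 2 = (2 ^+ k * dd k x) ^+ 2.
      by rewrite exprMn -exprM mulnC exprM; congr (_ ^+ _ * _); ring.
    rewrite sqrtr_sqr normrM ger0_norm ?exprn_ge0// => hk2.
    by rewrite exprVn ler_pdivlMr ?exprn_gt0// mulrC.
  pose w k := u (phi k) x.
  have -> : (fun k => u (phi k) x) = (fun k => w 0 + series (telescope w) k).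
    by apply/funext => k; exact: eq_sum_telescope.
  apply: is_cvgD; first exact: is_cvg_cst.
  apply: normed_cvg.
  apply: (@series_le_cvg _ _ (geometric (Num.sqrt H) 2^-1)) => [k|k|k|].
  - exact: normr_ge0.
  - by rewrite /geometric/= mulr_ge0 ?sqrtr_ge0 ?exprn_ge0 ?invr_ge0.
  - exact: dk.
  - by apply: is_cvg_geometric_series; rewrite ger0_norm ?invr_ge0// invf_lt1 ?ltr1n.
pose l x := limn (v^~ x).
have ml : measurable_fun D l.
  by apply: (measurable_fun_cvg mv) => x Dx; exact: cv.
have vu k : {ae mu, forall x, D x -> v k x = u (phi k) x}.
  apply: filterS hae => x hx Dx; rewrite /v /patch mem_set//.
  by split=> //=; rewrite in_itv/= ltey_eq (hx Dx).
have Lv k : L2_fun (v k).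
  apply: ae_L2 (Lu (phi k)) => //; apply: filterS (vu k) => x hx Dx.
  by rewrite hx.
(* Fatou's lemma in the second index of the Cauchy property, the first one being fixed. *)
have key (e : R) : 0 < e -> exists N0, forall i, (N0 <= i)%N ->
    (\int[mu]_(x in D) ((u i x - l x) ^+ 2)%:E <= e%:E)%E.
  move=> e0; have [N0 hN0] := cu e e0; exists N0 => i Ni.
  pose G k x : \bar R := ((u i x - v k x) ^+ 2)%:E.
  have mG k : measurable_fun D (G k).
    by apply: measurable_sqr; apply: measurable_funB => //; exact: (Lu i).1.
  have G0 k x : D x -> (0 <= G k x)%E by move=> _; rewrite lee_fin sqr_ge0.
  have := fatou mu mD mG G0.
  rewrite (@eq_integral _ _ _ mu D (fun x => ((u i x - l x) ^+ 2)%:E)); last first.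
    move=> x /set_mem Dx; apply: (cvg_limn_einf_sup _).1; apply: cvg_EFin.
      exact: nearW.
    apply: cvgM; apply: cvgB; [exact: cvg_cst|exact: cv|exact: cvg_cst|exact: cv].
  move=> /le_trans; apply.
  rewrite limn_einf_lim; apply: lime_le; first exact: is_cvg_einfs.
  apply: nearW => j.
  pose k := maxn j N0.
  apply: (@le_trans _ _ (\int[mu]_(x in D) G k x)%E).
    by apply: ereal_inf_lbound; exists k => //=; exact: leq_maxl.
  have Nk : (N0 <= phi k)%N by rewrite (leq_trans (leq_maxr j N0))// leq_addr.
  apply: (@le_trans _ _ (I (u i - u (phi k)) (u i - u (phi k)))%:E); last first.
    by rewrite lee_fin ltW// hN0.
  have Ld := subspaceB hX (Lu i) (Lu (phi k)).
  rewrite L2_ipE// le_eqVlt; apply/orP; left; apply/eqP.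
  apply: ae_eq_integral => //; first exact: measurable_sqr Ld.1.
  by apply: filterS (vu k) => x hx Dx; rewrite /G hx.
have Ll : L2_fun l.
  have [N0 hN0] := key 1 ltr01.
  have -> : l = u N0 - (u N0 - l) by rewrite opprB addrC subrK.
  apply: (subspaceB hX) => //; split.
    by apply: measurable_funB => //; exact: (Lu N0).1.
  exact: le_lt_trans (hN0 N0 (leqnn _)) (ltry _).
exists l => // e e0; have [N0 hN0] := key (e / 2) ltac:(by rewrite divr_gt0).
exists N0 => i Ni; rewrite -lte_fin L2_ipE; last exact: (subspaceB hX).
by apply: le_lt_trans (hN0 i Ni) _; rewrite lte_fin; lra.
Qed.


End square_integrable.

(** * Lebesgue measure on R^n *)

Section borel_rV.
Context (R : realType) (n : nat).
Local Notation Rn := 'rV[R]_n.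

Definition open_box (a b : 'I_n -> R) : set Rn :=
  [set x | forall i, x 0 i \in `]a i, b i[].

Definition open_boxes : set (set Rn) := [set A | exists a b, A = open_box a b].

Lemma measurable_open_box a b : measurable (open_box a b).
Proof.
apply: (@measurable_rV_box R n (fun i => `]a i, b i[%classic)) => i.
exact: measurable_itv.
Qed.

Lemma coord_bounded (x : Rn) : exists k : nat, forall j, `|x 0 j| < k%:R.
Proof.
pose f j := (Num.trunc `|x 0 j|).+1; exists (\max_j f j)%N => j.
apply: (@lt_le_trans _ _ (f j)%:R); first by rewrite truncnS_gt.
by rewrite ler_nat; exact: leq_bigmax.
Qed.

(** Open boxes are stable under intersection, which the coordinate preimages defining the
    sigma-algebra are not; this opens the way to uniqueness of measures and Dynkin induction. *)
Lemma measurable_rVE : (measurable : set (set Rn)) = <<s open_boxes >>.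
Proof.
apply/seteqP; split; last first.
  apply: smallest_sub; first exact: sigma_algebra_measurable.
  by move=> _ [a [b ->]]; exact: measurable_open_box.
apply: smallest_sub; first exact: smallest_sigma_algebra.
suff h i : preimage_set_system setT (@rV_coord R n i) measurable `<=` <<s open_boxes >>.
  by elim/big_ind : _ => // A B hA hB X [/hA|/hB].
have -> : (measurable : set (set (measurableTypeR R))) = <<s @RGenOpens.G R >>.
  exact: RGenOpens.measurableE.
rewrite -[X in X `<=` _]g_sigma_preimageE; apply: smallest_sub.
  exact: smallest_sigma_algebra.
move=> _ [_ [a [b ->]] <-]; rewrite setTI.
(* The slab [a < x_i < b] is exhausted by boxes whose other sides are []-k, k[]. *)
pose lo k j := if j == i then a else - (k%:R : R).
pose hi k j := if j == i then b else (k%:R : R).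
rewrite (_ : _ @^-1` _ = \bigcup_k open_box (lo k) (hi k)).
  apply: (@bigcupT_measurable _ (g_sigma_algebraType open_boxes)) => k.
  by apply: sub_sigma_algebra; exists (lo k), (hi k).
apply/seteqP; split=> [x /= xab|x [k _] /(_ i)]; last by rewrite /lo /hi eqxx.
have [k hk] := coord_bounded x.
exists k => // j; rewrite /lo /hi; case: eqP => [->//|_].
by have := hk j; rewrite ltr_norml in_itv.
Qed.

Lemma open_box_setI a b c e : open_box a b `&` open_box c e =
  open_box (fun i => Num.max (a i) (c i)) (fun i => Num.min (b i) (e i)).
Proof.
apply/seteqP; split=> [x [h1 h2] i|x h].
  move: (h1 i) (h2 i); rewrite !in_itv/= => /andP[p1 p2] /andP[q1 q2].
  by rewrite gt_max lt_min p1 p2 q1 q2.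
split=> i; have := h i; rewrite !in_itv/= gt_max lt_min => /andP[/andP[p1 p2] /andP[q1 q2]].
  by rewrite p1 q1.
by rewrite p2 q2.
Qed.

Lemma open_boxI : setI_closed open_boxes.
Proof.
move=> _ _ [a [b ->]] [c [e ->]]; rewrite open_box_setI.
by eexists; eexists; reflexivity.
Qed.

Definition cube (k : nat) : set Rn := open_box (fun=> - k%:R) (fun=> k%:R).

Lemma cube_cover : \bigcup_k cube k = setT.
Proof.
apply/seteqP; split=> // x _.
have [k hk] := coord_bounded x.
by exists k => // j; have := hk j; rewrite ltr_norml in_itv.
Qed.

Lemma measure_rV_unique (m1 m2 : {measure set Rn -> \bar R}) :
  (forall a b, m1 (open_box a b) = m2 (open_box a b)) ->
  (forall k, m1 (cube k) < +oo)%E ->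
  forall A, measurable A -> m1 A = m2 A.
Proof.
move=> m12 m1oo A mA; apply: (@measure_unique _ _ _ open_boxes cube) => //.
- exact: measurable_rVE.
- exact: open_boxI.
- by move=> k; eexists; eexists; reflexivity.
- exact: cube_cover.
- by move=> _ [a [b ->]].
Qed.

Lemma lebesgue_open_box a b : lebesgue_rV R n (open_box a b) =
  (\prod_i Num.max (b i - a i) 0)%:E.
Proof.
rewrite (@lebesgue_rV_box R n (fun i => `]a i, b i[%classic)); last first.
  by move=> i; exact: measurable_itv.
rewrite -prodEFin; apply: eq_bigr => i _.
rewrite lebesgue_measure_itv/= lte_fin -EFinB.
case: ltP => h; first by rewrite max_l// subr_ge0 ltW.
by rewrite max_r// subr_le0.
Qed.

Lemma lebesgue_cube_lty k : (lebesgue_rV R n (cube k) < +oo)%E.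
Proof. by rewrite lebesgue_open_box ltry. Qed.

Lemma open_box_ball (x : Rn) (e : R) : 0 < e ->
  open_box (fun i => x 0 i - e) (fun i => x 0 i + e) = ball x e.
Proof.
move=> e0; apply/seteqP; split=> [y /= hy|y /= [_ hy] i].
  split=> // i j; have := hy j; rewrite in_itv/= ord1 /ball/=.
  by rewrite ltr_norml; lra.
by have := hy 0 i; rewrite /ball/= ltr_norml in_itv/=; lra.
Qed.

(** The sigma-algebra is generated by coordinates, not by the topology. Balls of the maximum norm
    are boxes, so an open set is the union of the countably many rational boxes it contains. *)
Lemma open_measurable_rV (U : set Rn) : open U -> measurable U.
Proof.
move=> oU.
pose F (c : 'rV[rat]_n * 'rV[rat]_n) : set Rn :=
  let B := open_box (fun i => ratr (c.1 0 i)) (fun i => ratr (c.2 0 i)) in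
  if `[< B `<=` U >] then B else set0.
have -> : U = \bigcup_c F c.
  apply/seteqP; split=> [x Ux|x [c _]]; last first.
    by rewrite /F; case: asboolP => // h /h.
  have /nbhs_ballP[e /= e0 eU] : nbhs x U by exact: open_nbhs_nbhs.
  have /choice[a ha] : forall i, exists q : rat, x 0 i - e < ratr q < x 0 i.
    by move=> i; have [q] := @rat_in_itvoo R (x 0 i - e) (x 0 i) ltac:(lra); exists q.
  have /choice[b hb] : forall i, exists q : rat, x 0 i < ratr q < x 0 i + e.
    by move=> i; have [q] := @rat_in_itvoo R (x 0 i) (x 0 i + e) ltac:(lra); exists q.
  exists (\row_i a i, \row_i b i) => //; rewrite /F/=.
  case: asboolP => [_ i|[]].
    by rewrite !mxE in_itv/=; have /andP[_ ->] := ha i; have /andP[-> _] := hb i.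
  apply: subset_trans eU; rewrite -open_box_ball// => y /= hy i.
  have := hy i; rewrite !mxE !in_itv/= => /andP[h1 h2].
  by have /andP[h3 _] := ha i; have /andP[_ h4] := hb i; rewrite (lt_trans h3 h1) (lt_trans h2 h4).
apply: countable_bigcupT_measurable => // c; rewrite /F.
by case: asboolP => // _; exact: measurable_open_box.
Qed.

Lemma lebesgue_open_gt0 (U : set Rn) x : open U -> U x -> (0 < lebesgue_rV R n U)%E.
Proof.
move=> oU Ux; have /nbhs_ballP[e /= e0 eU] : nbhs x U by exact: open_nbhs_nbhs.
apply: (@lt_le_trans _ _ (lebesgue_rV R n (ball x e))).
  rewrite -open_box_ball// lebesgue_open_box lte_fin; apply: prodr_gt0 => i _.
  by rewrite lt_max; apply/orP; left; lra.
apply: le_measure; rewrite ?inE//; last exact: open_measurable_rV.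
by rewrite -open_box_ball//; exact: measurable_open_box.
Qed.

Lemma lebesgue_bounded_lty (U : set Rn) k : measurable U -> U `<=` cube k ->
  (lebesgue_rV R n U < +oo)%E.
Proof.
move=> mU Uk; apply: le_lt_trans (lebesgue_cube_lty k).
by apply: le_measure; rewrite ?inE//; exact: measurable_open_box.
Qed.

Lemma continuous_measurable_rV (U : set Rn) (f : Rn -> R) : open U ->
  {in U, continuous f} -> measurable_fun U f.
Proof.
move=> oU cf.
apply: (measurability _ (RGenOInfty.measurableE R)) => _ [_ [r ->] <-].
apply: open_measurable_rV; rewrite openE => x [Ux fx].
move: fx; rewrite /= in_itv/= andbT => fx.
have h := cf x (mem_set Ux) _ (open_nbhs_nbhs (conj (@open_gt R r) fx)).
near=> y; split=> /=; first by near: y; exact: open_nbhs_nbhs.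
by rewrite in_itv/= andbT; near: y; exact: h.
Unshelve. all: by end_near.
Qed.

End borel_rV.

(** * Fubini along an arbitrary coordinate axis *)

Section insertion.
Context (R : realType) (n : nat) (i : 'I_n.+1).
Local Notation Rn := 'rV[R]_n.
Local Notation Rd := 'rV[R]_n.+1.

Definition ins (t : R) (x : Rn) : Rd :=
  \row_j if unlift i j is Some k then x 0 k else t.

Lemma ins_same t x : ins t x 0 i = t.
Proof. by rewrite mxE unlift_none. Qed.

Lemma ins_lift t x k : ins t x 0 (lift i k) = x 0 k.
Proof. by rewrite mxE liftK. Qed.

Lemma insK (y : Rd) : ins (y 0 i) (col' i y) = y.
Proof.
apply/rowP => j; have [k ->|->] := unliftP i j; last by rewrite ins_same.
by rewrite ins_lift mxE.
Qed.

Lemma col'_ins t x : col' i (ins t x) = x.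
Proof. by apply/rowP => k; rewrite mxE ins_lift. Qed.

Lemma insD t h x : ins (h + t) x = h *: delta_mx 0 i + ins t x.
Proof.
apply/rowP => j; rewrite !mxE eqxx/=; have [k ->|->] := unliftP i j.
  by rewrite eq_sym (negbTE (neq_lift _ _)) mulr0 add0r.
by rewrite eqxx mulr1.
Qed.

Local Notation insp := (fun tx : measurableTypeR R * Rn => ins tx.1 tx.2).

Lemma measurable_ins : measurable_fun setT insp.
Proof.
apply: measurable_fun_rV => j; have [k ->|->] := unliftP i j.
- rewrite (_ : (fun _ => _) = @rV_coord R n k \o snd); last first.
    by apply/funext => tx; rewrite ins_lift.
  by apply: measurableT_comp => //; exact: measurable_rV_coord.
- rewrite (_ : (fun _ => _) = fst) ?measurable_fst//; apply/funext => tx.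
  by rewrite ins_same.
Qed.

Lemma preimage_ins_open_box a b : insp @^-1` open_box a b =
  `]a i, b i[%classic `*` open_box (a \o lift i) (b \o lift i).
Proof.
apply/seteqP; split=> -[t x] /=.
  move=> h; split; first by have := h i; rewrite ins_same.
  by move=> k; have := h (lift i k); rewrite ins_lift.
move=> [ht hx] j; have [k ->|->] := unliftP i j; last by rewrite ins_same.
by rewrite ins_lift; exact: hx.
Qed.

(** The recursive definition peels off coordinate 0 only. Inserting any coordinate [i] gives a
    measure with the same values on boxes, hence the same measure, so slices in every direction
    become available. *)
Lemma lebesgue_rV_ins A : measurable A -> lebesgue_rV R n.+1 A =
  pushforward (@lebesgue_measure R \x lebesgue_rV R n)%E insp A.
Proof.
pose m2 := pushforward (@lebesgue_measure R \x lebesgue_rV R n)%E insp.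
pose M2 : {measure set Rd -> \bar R} := 
  measure_function_pushforward__canonical__measure_function_Measure
    (@lebesgue_measure R \x lebesgue_rV R n)%E measurable_ins.
move: A; apply: (@measure_rV_unique R n.+1 (lebesgue_rV R n.+1) M2); last first.
  by move=> k; exact: lebesgue_cube_lty.
move=> a b; transitivity ((@lebesgue_measure R \x lebesgue_rV R n)%E
    (`]a i, b i[%classic `*` open_box (a \o lift i) (b \o lift i))); last first.
  by rewrite -preimage_ins_open_box.
rewrite product_measure1E//; last exact: measurable_open_box.
transitivity (@lebesgue_measure R `]a i, b i[%classic *
    lebesgue_rV R n (open_box (a \o lift i) (b \o lift i)))%E; last by [].
rewrite lebesgue_open_box; etransitivity; first exact: lebesgue_open_box.
rewrite (bigD1_ord i)//= EFinM.
congr (_ * _)%E; rewrite lebesgue_measure_itv/= lte_fin -EFinB.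
case: ltP => h; first by rewrite max_l// subr_ge0 ltW.
by rewrite max_r// subr_le0.
Qed.

Lemma measurable_ins_section x : measurable_fun setT (fun t : measurableTypeR R => ins t x).
Proof. exact: (measurableT_comp measurable_ins (measurable_pair2 x)). Qed.

Lemma tonelli_ins (f : Rd -> \bar R) : measurable_fun setT f -> (forall y, 0 <= f y)%E ->
  (\int[lebesgue_rV R n.+1]_y f y =
   \int[lebesgue_rV R n]_x \int[@lebesgue_measure R]_t f (ins t x))%E.
Proof.
move=> mf f0.
pose M2 : {measure set Rd -> \bar R} := 
  measure_function_pushforward__canonical__measure_function_Measure
    (@lebesgue_measure R \x lebesgue_rV R n)%E measurable_ins.
rewrite (@eq_measure_integral _ _ _ setT M2); last first.
  by move=> A mA _; exact: lebesgue_rV_ins.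
rewrite /M2 ge0_integral_pushforward//; last exact: measurable_ins.
rewrite preimage_setT fubini_tonelli2//; last by move=> tx; exact: f0.
exact: (measurableT_comp mf measurable_ins).
Qed.

Lemma measurable_tonelli_ins (f : Rd -> \bar R) : measurable_fun setT f ->
  (forall y, 0 <= f y)%E ->
  measurable_fun setT (fun x => \int[@lebesgue_measure R]_t f (ins t x))%E.
Proof.
move=> mf f0.
apply: (@measurable_fun_fubini_tonelli_G _ _ _ _ _ (@lebesgue_measure R)
  (fun tx => f (ins tx.1 tx.2))) => //.
exact: (measurableT_comp mf measurable_ins).
Qed.

Lemma fubini_ins (f : Rd -> \bar R) : (lebesgue_rV R n.+1).-integrable setT f ->
  (\int[lebesgue_rV R n.+1]_y f y =
   \int[lebesgue_rV R n]_x \int[@lebesgue_measure R]_t f (ins t x))%E.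
Proof.
move=> fi; have /integrableP[mf foo] := fi.
have mfi := measurableT_comp mf measurable_ins.
have gi : (@lebesgue_measure R \x lebesgue_rV R n)%E.-integrable setT
    (fun tx => f (ins tx.1 tx.2)).
  apply/integrable21ltyP => //; move: foo.
  by rewrite (@tonelli_ins (fun y => `|f y|%E))//; exact: measurableT_comp.
pose M2 : {measure set Rd -> \bar R} := 
  measure_function_pushforward__canonical__measure_function_Measure
    (@lebesgue_measure R \x lebesgue_rV R n)%E measurable_ins.
rewrite (@eq_measure_integral _ _ _ setT M2); last first.
  by move=> A mA _; exact: lebesgue_rV_ins.
rewrite /M2 integral_pushforward//; last exact: measurable_ins.
by rewrite preimage_setT -integral21_prod_meas1.
Qed.

Lemma measurable_fubini_ins (f : Rd -> \bar R) : (lebesgue_rV R n.+1).-integrable setT f ->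
  measurable_fun setT (fun x => \int[@lebesgue_measure R]_t f (ins t x))%E.
Proof.
move=> fi; have /integrableP[mf foo] := fi.
have mfi := measurableT_comp mf measurable_ins.
have gi : (@lebesgue_measure R \x lebesgue_rV R n)%E.-integrable setT
    (fun tx => f (ins tx.1 tx.2)).
  apply/integrable21ltyP => //; move: foo.
  by rewrite (@tonelli_ins (fun y => `|f y|%E))//; exact: measurableT_comp.
exact: (measurable_fubini_G gi).
Qed.

Lemma continuous_ins x : continuous (fun t : R => ins t x : Rd).
Proof.
rewrite (_ : (fun t => ins t x) = (fun t => t *: delta_mx 0 i + ins 0 x)); last first.
  by apply/funext => t; rewrite -insD addr0.
move=> t; apply: cvgD; last exact: cvg_cst.
by apply: cvgZr_tmp; exact: cvg_id.
Qed.

End insertion.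

(** A line in direction [i] meets the hyperplane in one point, because [a i] is nonzero. *)
Lemma hyperplane_null (R : realType) (n : nat) (a : 'I_n -> R) (c : R) i : a i != 0 ->
  measurable [set x : 'rV[R]_n | \sum_j a j * x 0 j = c] /\
  lebesgue_rV R n [set x : 'rV[R]_n | \sum_j a j * x 0 j = c] = 0%E.
Proof.
case: n a i => [a []//|n a i ai].
set H := [set x | _].
have mH : measurable H.
  rewrite /H (_ : [set x | _] = (fun x => \sum_j a j * rV_coord j x) @^-1` [set c])//.
  rewrite -[X in measurable X]setTI; apply: measurable_sum => // j.
  by apply: measurable_funM => //; exact: measurable_rV_coord.
split=> //; transitivity (\int[lebesgue_rV R n.+1]_x (\1_H x)%:E)%E.
  by rewrite integral_indic// setIT.
rewrite (tonelli_ins i)//; last exact/measurable_EFinP/measurable_indic.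
apply: integral0_eq => x _.
pose r := (c - \sum_j a (lift i j) * x 0 j) / a i.
transitivity (\int[@lebesgue_measure R]_t (\1_[set r] t)%:E)%E; last first.
  by rewrite integral_indic// setIT; exact: lebesgue_measure_set1.
apply: eq_integral => t _; congr (_%:E); rewrite !indicE; congr (_ : bool)%:R.
have sE : \sum_j a j * ins i t x 0 j = a i * t + \sum_j a (lift i j) * x 0 j.
  rewrite (bigD1_ord i)//= ins_same; congr (_ + _).
  by apply: eq_bigr => j _; rewrite ins_lift.
apply/idP/idP => /set_mem /= h; apply/mem_set; rewrite /H/=.
  by move: h; rewrite /H/= sE /r => <-; rewrite addrK mulrC mulKf.
by rewrite sE h /r mulrC divfK// subrK.
Qed.

(** * Test functions *)

Section flat_exponential.
Context (R : realType).
Implicit Types (P : {poly R}) (t : R).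

(** The flat function exp(-1/t) with a polynomial factor in 1/t: the smallest family of this kind
    stable under differentiation. *)
Definition flat_exp P t : R := if 0 < t then P.[t^-1] * expR (- t^-1) else 0.

(** Each monomial satisfies y^i <= i! exp(y). *)
Lemma poly_expR_bounded P : exists2 C, 0 <= C & forall y, 0 <= y -> `|P.[y]| * expR (- y) <= C.
Proof.
pose c i : R := `|P`_i| * i`!%:R.
exists (\sum_(i < size P) c i); first by apply: sumr_ge0 => i _; rewrite mulr_ge0.
move=> y y0; rewrite expRN ler_pdivrMr ?expR_gt0// mulr_suml horner_coef.
apply: le_trans (ler_norm_sum _ _ _) _; apply: ler_sum => i _.
rewrite normrM -mulrA ler_wpM2l//.
rewrite ger0_norm ?exprn_ge0//.
case: i => -[|i] /= _.
  by rewrite expr0 fact0 mul1r; have := expR_ge1Dx y; lra.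
have := expR_ge1Dxn i y0; rewrite -ler_pdivrMl ?ltr0n ?fact_gt0// mulrC.
lra.
Qed.

(** For t > 0 the product and chain rules give t^-2 (P - P')(1/t) exp(-1/t). At 0 the function is
    O(h^2), so the difference quotient tends to 0. *)
Lemma is_derive_flat_exp P t :
  is_derive t 1 (flat_exp P) (flat_exp ('X^2 * (P - P^`())) t).
Proof.
have [t0|t0|->] := ltgtP t 0.
- rewrite [X in is_derive _ _ _ X]/flat_exp ltNge (ltW t0)/=.
  apply: (@near_eq_is_derive _ _ _ (cst 0)).
  near=> s; rewrite /flat_exp ltNge ltW//.
  by near: s; exact: lt_nbhsl.
- rewrite [X in is_derive _ _ _ X]/flat_exp t0.
  apply: (@near_eq_is_derive R R R (fun s : R => P.[s^-1] * expR (- s^-1))).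
    near=> s; rewrite /flat_exp ifT//.
    by near: s; exact: lt_nbhsr.
  have dV : is_derive t 1 (fun s : R => s^-1) (- t ^- 2).
    have := @is_deriveV R id t 1 1 (lt0r_neq0 t0) (is_derive_id _ _).
    by rewrite [_ *: _]mulr1.
  have dP : is_derive t 1 (fun s => P.[s^-1]) (P^`().[t^-1] * - t ^- 2).
    exact: (@is_derive1_comp _ (horner P) (fun s => s^-1)).
  have dE : is_derive t 1 (fun s => expR (- s^-1)) (expR (- t^-1) * t ^- 2).
    have dN : is_derive t 1 (fun s : R => - s^-1) (t ^- 2).
      by have := is_deriveN dV; rewrite opprK.
    exact: (@is_derive1_comp _ expR (fun s => - s^-1)).
  apply: is_derive_eq (is_deriveM dP dE) _.
  rewrite hornerM hornerXn hornerD hornerN /GRing.scale/= -!exprVn. ring.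
- rewrite [X in is_derive _ _ _ X]/flat_exp ltxx.
  (* The extra factor ['X^2] is what yields the bound [C * h ^+ 2]. *)
  have [C C0 hC] := poly_expR_bounded ('X^2 * P).
  have bound h : `|flat_exp P h| <= C * h ^+ 2.
    rewrite /flat_exp; case: ltP => h0; last by rewrite normr0 mulr_ge0 ?sqr_ge0.
    have := hC h^-1 ltac:(by rewrite invr_ge0 ltW).
    rewrite hornerM hornerXn normrM [`|_ ^+ 2|]ger0_norm ?sqr_ge0// => hb.
    rewrite normrM [`|expR _|]ger0_norm ?expR_ge0// -ler_pdivrMr ?exprn_gt0//.
    by rewrite mulrC mulrA -exprVn.
  have f0 : flat_exp P 0 = 0 by rewrite /flat_exp ltxx.
  apply/is_derive1_caratheodory; exists (fun z => flat_exp P z / z); split.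
  + move=> z; rewrite f0 !subr0; have [->|z0] := eqVneq z 0; first by rewrite mulr0 f0.
    by rewrite divfK.
  + have c0 : flat_exp P z / z @[z --> (0 : R)] --> (0 : R).
      apply/cvgr0Pnorm_lt => e e0; near=> z.
      apply: (@le_lt_trans _ _ (C * `|z|)).
        have [->|z0] := eqVneq z 0; first by rewrite f0 mul0r normr0 mulr0.
        rewrite normrM normfV ler_pdivrMr ?normr_gt0// -mulrA -expr2 real_normK ?num_real//.
      have : `|z| < e / (C + 1).
        near: z; apply: (@nbhs0_lt _ R^o); rewrite divr_gt0// ltr_wpDl//.
      rewrite ltr_pdivlMr; last by rewrite ltr_wpDl.
      by apply: le_lt_trans; rewrite mulrC ler_wpM2l// lerDl.
    have c1 : flat_exp P z / z @[z --> (0 : R)] --> flat_exp P 0 / 0.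
      by rewrite [X in _ --> X](_ : _ = 0) // f0 mul0r.
    exact: c1.
  + by rewrite f0 mul0r.
Unshelve. all: by end_near.
Qed.

Lemma flat_exp_derivable P t : derivable (flat_exp P) t 1.
Proof. by have [] := is_derive_flat_exp P t. Qed.




Lemma flat_exp1E t : flat_exp 1 t = if 0 < t then expR (- t^-1) else 0.
Proof. by rewrite /flat_exp hornerC mul1r. Qed.

Lemma flat_exp1_ge0 t : 0 <= flat_exp 1 t.
Proof. by rewrite flat_exp1E; case: ifP => // _; exact: expR_ge0. Qed.

Lemma flat_exp1_le1 t : flat_exp 1 t <= 1.
Proof.
rewrite flat_exp1E; case: ifP => // t0.
by rewrite -expR0 ler_expR oppr_le0 invr_ge0 ltW.
Qed.

Lemma flat_exp1_eq0 t : (flat_exp 1 t == 0) = (t <= 0).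
Proof.
rewrite flat_exp1E; case: ltP => _; rewrite ?eqxx//.
by apply/negbTE; rewrite gt_eqF// expR_gt0.
Qed.

Lemma flat_exp1_cvg t : 0 < t -> flat_exp 1 (k.+1%:R * t) @[k --> \oo] --> (1 : R).
Proof.
move=> t0.
have -> : (fun k => flat_exp 1 (k.+1%:R * t)) = (fun k => expR (- (k.+1%:R^-1 * t^-1))).
  by apply/funext => k; rewrite flat_exp1E mulr_gt0// invfM.
have h : - (k.+1%:R^-1 * t^-1) @[k --> \oo] --> (0 : R).
  rewrite -[X in _ --> X]oppr0; apply: cvgN; rewrite -[X in _ --> X](mul0r t^-1).
  by apply: cvgMr_tmp; exact: cvg_harmonic.
rewrite -[X in _ --> X]expR0; apply: (cvg_comp _ _ h); exact: (@continuous_expR R 0).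
Qed.

End flat_exponential.

Section smooth_functions.
Context (R : realType) (n : nat).
Local Notation Rd := 'rV[R]_n.+1.
Implicit Types f g : Rd -> R.

Lemma smooth_differentiable f x : smooth f -> differentiable f x.
Proof. by move=> /(_ [::] x). Qed.

Lemma smooth_partial i f : smooth f -> smooth (partial i f).
Proof. by move=> sf s x; have := sf (rcons s i) x; rewrite foldr_rcons. Qed.

(** A coinduction principle for smoothness: a class of differentiable functions stable under partial
    derivatives contains all iterated derivatives of its members. *)
Lemma smooth_closed (F : set (Rd -> R)) :
  (forall f x, F f -> differentiable f x) -> (forall i f, F f -> F (partial i f)) ->
  F `<=` @smooth R n.
Proof.
move=> dF pF f Ff s x; apply: dF; elim: s => //= i s; exact: pF.
Qed.

Lemma partialD i f g x : differentiable f x -> differentiable g x ->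
  partial i (f + g) x = partial i f x + partial i g x.
Proof. by move=> df dg; rewrite /partial deriveD//; exact: diff_derivable. Qed.

Lemma partialZ i a f x : differentiable f x ->
  partial i (a *: f) x = a * partial i f x.
Proof. by move=> df; rewrite /partial deriveZ//; exact: diff_derivable. Qed.

Lemma partialM i f g x : differentiable f x -> differentiable g x ->
  partial i (f * g) x = f x * partial i g x + g x * partial i f x.
Proof. by move=> df dg; rewrite /partial deriveM//; exact: diff_derivable. Qed.

Lemma smoothP a f g : smooth f -> smooth g -> smooth (a *: f + g).
Proof.
move=> sf sg.
apply: (@smooth_closed [set h | exists f g, [/\ smooth f, smooth g & h = a *: f + g]]).
- move=> h x [f1 [g1 [sf1 sg1 ->]]]; apply: differentiableD; last exact: smooth_differentiable.
  by apply: differentiableZ; exact: smooth_differentiable.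
- move=> i h [f1 [g1 [sf1 sg1 ->]]]; exists (partial i f1), (partial i g1).
  split; [exact: smooth_partial|exact: smooth_partial|].
  apply/funext => x; rewrite partialD ?partialZ//; try exact: smooth_differentiable.
  by apply: differentiableZ; exact: smooth_differentiable.
- by exists f, g.
Qed.

(** The bridge between partial derivatives in R^d and one-variable calculus on a line. *)
Lemma derive_ins i f t x : 'D_1 (fun s => f (ins i s x) : R) t = partial i f (ins i t x).
Proof.
rewrite /partial /derive; set F := (fun h : R => _); set G := (fun h : R => _).
suff -> : F = G by [].
by apply/funext => h; rewrite /F /G /= -insD [h *: 1]mulr1.
Qed.

Lemma derivable_ins i f t x : differentiable f (ins i t x) ->
  derivable (fun s => f (ins i s x) : R) t 1.
Proof.
move=> df; have : derivable f (ins i t x) (delta_mx 0 i) by exact: diff_derivable.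
rewrite /derivable.
set F := (fun h : R => _); set G := (fun h : R => _); suff -> : F = G by [].
by apply/funext => h; rewrite /F /G /= -insD [h *: 1]mulr1.
Qed.

(** Large enough for polynomials and bump functions, and closed under partial derivatives; the
    affine argument of [flat_exp] is kept general for the chain rule. *)
Inductive smooth_algebra : set (Rd -> R) :=
| alg_const c : smooth_algebra (cst c)
| alg_coord i : smooth_algebra (fun x => x 0 i)
| alg_flat P c a i : smooth_algebra (fun x => flat_exp P (c * (x 0 i - a)))
| alg_add f g : smooth_algebra f -> smooth_algebra g -> smooth_algebra (f + g)
| alg_mul f g : smooth_algebra f -> smooth_algebra g -> smooth_algebra (f * g).

Lemma differentiable_smooth_algebra f x : smooth_algebra f -> differentiable f x.
Proof.
elim=> {f} [c|i|P c a i|f g _ df _ dg|f g _ df _ dg].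
- exact: differentiable_cst.
- exact: differentiable_coord.
- apply: (@differentiable_comp _ _ _ _ (fun x : Rd => c * (x 0 i - a)) (flat_exp P)).
    apply: (@differentiableZ _ _ _ (fun x : Rd => x 0 i - a) c).
    by apply: differentiableB; [exact: differentiable_coord|exact: differentiable_cst].
  by apply/derivable1_diffP; exact: flat_exp_derivable.
- exact: differentiableD.
- exact: differentiableM.
Qed.

Lemma smooth_algebra_partial i f : smooth_algebra f -> smooth_algebra (partial i f).
Proof.
elim=> {f} [c|j|P c a j|f g bf pf bg pg|f g bf pf bg pg].
- have -> : partial i (cst c : Rd -> R) = cst 0; last exact: alg_const.
  by apply/funext => x; exact: derive_cst.
- have -> : partial i (fun x : Rd => x 0 j) = cst (j == i)%:R; last exact: alg_const.
  apply/funext => y; rewrite -{1}(insK i y) -derive_ins /=.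
  have [->|ij] := eqVneq j i.
    by under eq_fun do rewrite ins_same; exact: derive_id.
  have [k -> _] : { k | j = lift i k & unlift i j = Some k } by apply: unlift_some; rewrite eq_sym.
  under eq_fun do rewrite ins_lift.
  exact: derive_cst.
- have [->|ij] := eqVneq j i.
    have -> : partial i (fun x : Rd => flat_exp P (c * (x 0 i - a))) =
        cst c * (fun x => flat_exp ('X^2 * (P - P^`())) (c * (x 0 i - a))).
      apply/funext => y; rewrite -{1}(insK i y) -derive_ins.
      have -> : (fun s : R => flat_exp P (c * (ins i s (col' i y) 0 i - a))) =
          flat_exp P \o (fun s => c * (s - a)).
        by apply/funext => s /=; rewrite ins_same.
      have dA (t : R) : is_derive t 1 (fun s : R => c * (s - a)) c.
        have := is_deriveZ c (is_deriveB (is_derive_id t (1 : R)) (is_derive_cst (a : R) t 1)).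
        by rewrite subr0 [_ *: _]mulr1.
      have := @is_derive1_comp _ (flat_exp P) (fun s => c * (s - a)) (y 0 i) _ _
        (is_derive_flat_exp _ _) (dA _).
      by move=> [_ ->]; rewrite mulrC.
    by apply: alg_mul; [exact: alg_const|exact: alg_flat].
  have -> : partial i (fun x : Rd => flat_exp P (c * (x 0 j - a))) = cst 0.
    apply/funext => y; rewrite -{1}(insK i y) -derive_ins.
    have [k -> _] : { k | j = lift i k & unlift i j = Some k }.
      by apply: unlift_some; rewrite eq_sym.
    under eq_fun do rewrite ins_lift.
    exact: derive_cst.
  exact: alg_const.
- have -> : partial i (f + g) = partial i f + partial i g; last exact: alg_add.
  by apply/funext => x; rewrite partialD//; exact: differentiable_smooth_algebra.
- have -> : partial i (f * g) = f * partial i g + g * partial i f.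
    by apply/funext => x; rewrite partialM//; exact: differentiable_smooth_algebra.
  by apply: alg_add; exact: alg_mul.
Qed.

Lemma smooth_algebra_smooth : smooth_algebra `<=` @smooth R n.
Proof.
apply: smooth_closed; [exact: differentiable_smooth_algebra|exact: smooth_algebra_partial].
Qed.

End smooth_functions.

Lemma cvg_prod1 (R : realType) I (r : seq I) (u : I -> nat -> R) :
  (forall i, u i k @[k --> \oo] --> (1 : R)) ->
  (\prod_(i <- r) u i k) @[k --> \oo] --> (1 : R).
Proof.
move=> u1; elim: r => [|i r IH].
  by under eq_fun do rewrite big_nil; exact: cvg_cst.
have -> : (fun k => \prod_(j <- i :: r) u j k) =
    (u i : nat -> R) \* (fun k => \prod_(j <- r) u j k).
  by apply/funext => k; rewrite big_cons.
have := @cvgM _ _ _ eventually_filter _ _ _ _ (u1 i) IH; rewrite mulr1; exact.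
Qed.

(** * The fundamental lemma of the calculus of variations *)

Section fundamental_lemma.
Context (R : realType) (n : nat) (Omega : set 'rV[R]_n.+1).
Context (oO : open Omega) (finO : (lebesgue_rV R n.+1 Omega < +oo)%E).
Local Notation Rd := 'rV[R]_n.+1.
Local Notation mu := (lebesgue_rV R n.+1).
Implicit Types (a b : 'I_n.+1 -> R) (g : Rd -> R).

Let mO : measurable Omega. Proof. exact: open_measurable_rV. Qed.

Definition closed_box a b : set Rd := [set x | forall i, x 0 i \in `[a i, b i]].

(** Smooth functions with values in [0, 1] that tend pointwise to the indicator of the open box,
    since exp(-1/(k t)) tends to 1 for t > 0; no mollification is involved. *)
Definition bump a b (k : nat) : Rd -> R := fun x =>
  \prod_i (flat_exp 1 (k.+1%:R * (x 0 i - a i)) * flat_exp 1 (k.+1%:R * (b i - x 0 i))).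

Lemma smooth_bump a b k : smooth (bump a b k).
Proof.
apply: smooth_algebra_smooth; rewrite /bump; elim: (index_enum _) => [|i r IH].
  by under eq_fun do rewrite big_nil; exact: alg_const.
under eq_fun do rewrite big_cons; apply: (alg_mul _ IH).
apply: (@alg_mul R n (fun x => flat_exp 1 (k.+1%:R * (x 0 i - a i)))
  (fun x => flat_exp 1 (k.+1%:R * (b i - x 0 i)))); first exact: alg_flat.
under eq_fun do rewrite -opprB mulrN -mulNr.
exact: alg_flat.
Qed.

Lemma bump_ge0 a b k x : 0 <= bump a b k x.
Proof. by apply: prodr_ge0 => i _; rewrite mulr_ge0 ?flat_exp1_ge0. Qed.

Lemma bump_le1 a b k x : bump a b k x <= 1.
Proof.
apply: prodr_ile1 => i _; rewrite mulr_ge0 ?flat_exp1_ge0//=.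
by rewrite mulr_ile1 ?flat_exp1_ge0 ?flat_exp1_le1.
Qed.

Lemma bump_support a b k x : bump a b k x != 0 -> open_box a b x.
Proof.
rewrite prodf_seq_neq0 => /allP h i; have := h i (mem_index_enum _).
rewrite /= mulf_eq0 !flat_exp1_eq0 negb_or -!ltNge !pmulr_rgt0//.
by rewrite !subr_gt0 in_itv.
Qed.

Lemma bump_cvg a b x : bump a b k x @[k --> \oo] --> (\1_(open_box a b) x : R).
Proof.
rewrite indicE; have [xab|nxab] := boolP (x \in open_box a b); last first.
  rewrite (_ : (fun k => bump a b k x) = cst 0); first exact: cvg_cst.
  apply/funext => k; apply/eqP; apply: contraNT nxab => /bump_support.
  exact: mem_set.
apply: cvg_prod1 => i; have := set_mem xab i; rewrite in_itv/= => /andP[h1 h2].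
rewrite -[X in _ --> X](mulr1 (1 : R)).
by apply: cvgM; apply: flat_exp1_cvg; rewrite subr_gt0.
Qed.

Lemma closed_box_compact a b : compact (closed_box a b).
Proof.
apply: (@rV_compact R n.+1 (fun i => `[a i, b i]%classic)) => i.
exact: segment_compact.
Qed.

Lemma bump_test a b k : closed_box a b `<=` Omega -> test_function Omega (bump a b k).
Proof.
move=> abO.
have cl : closed (closed_box a b).
  by apply: compact_closed; [exact: norm_hausdorff|exact: closed_box_compact].
have sub : closure [set x | bump a b k x != 0] `<=` closed_box a b.
  rewrite (_ : closed_box a b = closure (closed_box a b)); last exact/closure_id.
  apply: closure_subset => x /= /bump_support h i; have := h i.
  by rewrite !in_itv/= => /andP[/ltW -> /ltW ->].
split; first exact: smooth_bump.
- by apply: (subclosed_compact _ (@closed_box_compact a b)) => //; exact: closed_closure.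
- exact: subset_trans sub abO.
Qed.

Section vanishing.
Context (g : Rd -> R) (Lg : in_L2 Omega g).
Hypothesis g_test : forall phi, test_function Omega phi -> ip Omega g phi = 0.

Let L1 : L2_fun mu Omega (cst 1).
Proof.
split; first exact: measurable_cst.
by under eq_integral do rewrite expr1n; rewrite integral_cst// mul1e.
Qed.

Let gi : mu.-integrable Omega (EFin \o g).
Proof.
have := integrable_mul mO Lg L1.
by rewrite (_ : EFin \o _ = EFin \o g)//; apply/funext => x /=; rewrite mulr1.
Qed.

(** Dominated convergence for the bumps of the box, with majorant |g|. *)
Lemma integral_box_eq0 a b : closed_box a b `<=` Omega ->
  (\int[mu]_(x in open_box a b) (g x)%:E = 0)%E.
Proof.
move=> abO.
have mB := @measurable_open_box R n.+1 a b.
have BO : open_box a b `<=` Omega.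
  apply: subset_trans abO => x h i; have := h i.
  by rewrite !in_itv/= => /andP[/ltW -> /ltW ->].
have mg : measurable_fun Omega g := Lg.1.
have mbump k : measurable_fun Omega (bump a b k).
  apply: continuous_measurable_rV => // x _.
  by apply: differentiable_continuous; exact: smooth_differentiable (smooth_bump a b k).
have [] := @dominated_convergence _ _ _ mu Omega mO
    (fun k x => (g x * bump a b k x)%:E) (fun x => (g x * \1_(open_box a b) x)%:E)
    (fun x => `|(g x)%:E|%E).
- by move=> k; apply/measurable_EFinP; exact: measurable_funM.
- by apply/measurable_EFinP; apply: measurable_funM => //; exact: measurable_indic.
- apply: aeW => x _; apply: cvg_EFin; first exact: nearW.
  by apply: cvgM; [exact: cvg_cst|exact: bump_cvg].
- exact: integrable_abse.
- apply: aeW => x k _; rewrite lee_fin normrM ler_piMr// ger0_norm ?bump_ge0//.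
  exact: bump_le1.
move=> _ _ lim0.
have e0 : (fun k => \int[mu]_(x in Omega) (g x * bump a b k x)%:E)%E = cst 0%E.
  apply/funext => k; rewrite -[LHS]fineK.
    by have := g_test (bump_test k abO); rewrite /ip /Rintegral => ->.
  apply: integrable_fin_num => //.
  apply: (integrable_mul mO Lg); split => //.
  apply: le_lt_trans L1.2; apply: ge0_le_integral => //.
  - by move=> x _; rewrite lee_fin sqr_ge0.
  - exact: measurable_sqr.
  - by apply/measurable_EFinP; exact: measurable_funX.
  - move=> x _; rewrite lee_fin expr1n expr_le1// ?bump_ge0 ?bump_le1//.
rewrite /= e0 in lim0.
have <- : (\int[mu]_(x in Omega) (g x * \1_(open_box a b) x)%:E = 0)%E.
  by apply: (cvg_unique _ lim0); [exact: ereal_hausdorff|exact: cvg_cst].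
rewrite -{1}(setIidr BO) integral_mkcondr; apply: eq_integral => x _.
rewrite /patch indicE; case: ifP => _; by rewrite ?mulr1// mulr0.
Qed.

(** The sets over whose intersection with the box [g] integrates to zero form a Dynkin class
    containing all boxes, hence all measurable sets. *)
Lemma ae_eq0_on_box a b : closed_box a b `<=` Omega ->
  ae_eq mu (open_box a b) (EFin \o g) (cst 0%E).
Proof.
move=> abO; have mB := @measurable_open_box R n.+1 a b.
have BO : open_box a b `<=` Omega.
  apply: subset_trans abO => x h i; have := h i.
  by rewrite !in_itv/= => /andP[/ltW -> /ltW ->].
have giB : mu.-integrable (open_box a b) (EFin \o g) by exact: integrableS gi.
have giA A : measurable A -> mu.-integrable (A `&` open_box a b) (EFin \o g).
  by move=> mA; apply: integrableS giB => //; exact: measurableI.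
pose P A := (\int[mu]_(x in A `&` open_box a b) (EFin \o g) x = 0)%E.
have PA A : measurable A -> P A.
  rewrite (@measurable_rVE R n.+1).
  apply: (dynkin_induction (G := @open_boxes R n.+1)).
  - exact: measurable_rVE.
  - exact: open_boxI.
  - by rewrite /P setTI; exact: integral_box_eq0.
  - move=> _ [c [e ->]]; rewrite /P.
    rewrite open_box_setI; apply: integral_box_eq0; apply: subset_trans abO.
    move=> x h i; have := h i; rewrite !in_itv/= ge_max le_min.
    by move=> /andP[/andP[_ ->] /andP[_ ->]].
  - move=> S mS PS; rewrite /P.
    have := integral_box_eq0 abO.
    rewrite -{1}(setTI (open_box a b)) -(setUv S) setIUl integral_setU//; last 4 first.
    + exact: measurableI.
    + by apply: measurableI => //; exact: measurableC.
    + rewrite -setIUl setUv setTI; exact: measurable_int giB.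
    + by rewrite disj_set2E setIACA setICr set0I.
    by rewrite [X in (X + _)%E]PS add0e.
  - move=> F mF tF PF; rewrite /P setI_bigcupl integral_bigcup.
    + by rewrite eseries0// => i _ _; exact: PF.
    + exact: trivIset_setIr.
    + by move=> k; exact: measurableI.
    + by rewrite -setI_bigcupl; apply: giA; exact: bigcupT_measurable.
apply: integral_ae_eq => // E EB mE; rewrite integral0.
by have := PA E mE; rewrite /P setIidl.
Qed.

(** Countably many rational boxes with closure in [Omega] cover it, so the exceptional null sets can
    be united. *)
Lemma fundamental_lemma : {ae mu, forall x, Omega x -> g x = 0}.
Proof.
pose c_ := ('rV[rat]_n.+1 * 'rV[rat]_n.+1)%type.
pose ra (c : c_) i : R := ratr (c.1 0 i); pose rb (c : c_) i : R := ratr (c.2 0 i).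
pose N (c : c_) := if `[< closed_box (ra c) (rb c) `<=` Omega >] then
  ~` [set x | open_box (ra c) (rb c) x -> (g x)%:E = 0%E] else set0.
have NN c : mu.-negligible (N c).
  rewrite /N; case: asboolP => [h|_]; last exact: negligible_set0.
  exact: ae_eq0_on_box h.
have [f fb] : exists f : nat -> c_, forall c, exists k, f k = c.
  exists (fun k => odflt (0, 0) (unpickle k)) => c; exists (pickle c).
  by rewrite pickleK.
apply: (negligibleS _ (negligible_bigcup (fun k => NN (f k)))) => x /= /not_implyP[Ox gx].
have /nbhs_ballP[e /= e0 eU] : nbhs x Omega by exact: open_nbhs_nbhs.
have /choice[a ha] : forall i, exists q : rat, x 0 i - e < ratr q < x 0 i.
  by move=> i; have [q] := @rat_in_itvoo R (x 0 i - e) (x 0 i) ltac:(lra); exists q.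
have /choice[b hb] : forall i, exists q : rat, x 0 i < ratr q < x 0 i + e.
  by move=> i; have [q] := @rat_in_itvoo R (x 0 i) (x 0 i + e) ltac:(lra); exists q.
have [k fk] := fb (\row_i a i, \row_i b i); exists k => //.
rewrite /N fk /ra /rb /=; case: asboolP => [_ /= h|[]].
  suff [] : (g x)%:E = 0%E by [].
  apply: h => i; rewrite !mxE in_itv/=.
  by have /andP[_ ->] := ha i; have /andP[-> _] := hb i.
apply: subset_trans eU; rewrite -open_box_ball// => y /= hy i.
have := hy i; rewrite !mxE !in_itv/= => /andP[h1 h2].
have /andP[h3 _] := ha i; have /andP[_ h4] := hb i.
by rewrite (lt_le_trans h3 h1) (le_lt_trans h2 h4).
Qed.


End vanishing.

End fundamental_lemma.

(** * Weak derivatives and completeness of H^1 *)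

Section weak_derivatives.
Context (R : realType) (n : nat) (Omega : set 'rV[R]_n.+1).
Context (oO : open Omega) (finO : (lebesgue_rV R n.+1 Omega < +oo)%E).
Local Notation Rd := 'rV[R]_n.+1.
Local Notation mu := (lebesgue_rV R n.+1).
Implicit Types (u v f g phi : Rd -> R).

Let mO : measurable Omega. Proof. exact: open_measurable_rV. Qed.

Lemma in_L2_subspace : subspace_of (in_L2 Omega : set (Rd -> R)).
Proof. exact: L2_subspace mO. Qed.

Lemma ip_semi_inner : semi_inner (in_L2 Omega : set (Rd -> R)) (ip Omega).
Proof. exact: L2_semi_inner mO. Qed.

Let hX := in_L2_subspace.
Let hI := ip_semi_inner.

Lemma bounded_L2 f (C : R) : measurable_fun Omega f -> (forall x, Omega x -> `|f x| <= C) ->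
  in_L2 Omega f.
Proof.
move=> mf fC; split=> //.
apply: (@le_lt_trans _ _ (\int[mu]_(x in Omega) (cst (C ^+ 2)%:E) x)%E).
  apply: ge0_le_integral => //.
  - by move=> x _; rewrite lee_fin sqr_ge0.
  - exact: measurable_sqr.
  - move=> x Ox; rewrite lee_fin -(real_normK (num_real (f x))).
    by rewrite ler_pXn2r ?nnegrE ?normr_ge0 ?fC// (le_trans _ (fC x Ox)).
by rewrite integral_cst// lte_mul_pinfty// lee_fin sqr_ge0.
Qed.

Lemma continuous_compact_bounded (K : set Rd) f : compact K ->
  (forall x, K x -> {for x, continuous f}) ->
  exists C, forall x, K x -> `|f x| <= C.
Proof.
move=> cK cf.
have : compact (f @` K).
  apply: continuous_compact => //; apply: continuous_in_subspaceT => x /set_mem; exact: cf.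
move=> /compact_bounded [M [_ hM]]; exists (M + 1) => x Kx.
by apply: hM; [rewrite ltrDl|exists x].
Qed.

Lemma test_bounded phi : test_function Omega phi -> exists C, forall x, `|phi x| <= C.
Proof.
move=> [sp cp _].
have [|C hC] := @continuous_compact_bounded _ phi cp.
  by move=> x _; apply: differentiable_continuous; exact: smooth_differentiable.
exists (Num.max C 0) => x; have [->|px] := eqVneq (phi x) 0.
  by rewrite normr0 le_max lexx orbT.
by rewrite le_max hC//; exact: subset_closure.
Qed.

Lemma smooth_measurable f (A : set Rd) : smooth f -> measurable A -> measurable_fun A f.
Proof.
move=> sf mA; apply: (@measurable_funS _ _ _ _ setT) => //.
apply: continuous_measurable_rV => [|x _]; first exact: openT.
by apply: differentiable_continuous; exact: smooth_differentiable.
Qed.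

Lemma test_L2 phi : test_function Omega phi -> in_L2 Omega phi.
Proof.
move=> tp; have [C hC] := test_bounded tp; apply: (@bounded_L2 _ C) => //.
by apply: smooth_measurable => //; case: tp.
Qed.

Lemma not_support_near phi x : ~ closure [set x | phi x != 0] x -> \near x, phi x = 0.
Proof.
move=> nx; have /open_nbhs_nbhs : open_nbhs x (~` closure [set x | phi x != 0]).
  by split=> //; apply: closed_openC; exact: closed_closure.
apply: filterS => y /= ny; apply: contrapT => /eqP py; apply: ny.
exact: subset_closure.
Qed.

Lemma partial_support i phi : [set x | partial i phi x != 0] `<=` closure [set x | phi x != 0].
Proof.
move=> x /= px; apply: contrapT => /not_support_near nx; move/eqP: px; apply.
rewrite /partial (@near_eq_derive _ _ _ phi (cst 0) x (delta_mx 0 i)) ?derive_cst//.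
Qed.

Lemma test_partial i phi : test_function Omega phi -> test_function Omega (partial i phi).
Proof.
move=> [sp cp sub].
have cl : closure [set x | partial i phi x != 0] `<=` closure [set x | phi x != 0].
  rewrite [X in _ `<=` X](_ : _ = closure (closure [set x | phi x != 0])).
    by apply: closure_subset; exact: partial_support.
  by apply/closure_id; exact: closed_closure.
split; first exact: smooth_partial.
- by apply: (subclosed_compact _ cp) => //; exact: closed_closure.
- exact: subset_trans cl sub.
Qed.

Lemma weak_partial_unique i u g g' : in_L2 Omega g -> in_L2 Omega g' ->
  is_weak_partial Omega i u g -> is_weak_partial Omega i u g' ->
  {ae mu, forall x, Omega x -> g x = g' x}.
Proof.
move=> Lg Lg' ug ug'.
have Ld := subspaceB hX Lg Lg'.
have /(fundamental_lemma oO finO Ld) : forall phi, test_function Omega phi -> ip Omega (g - g') phi = 0.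
  move=> phi tp; rewrite (formBl hI)//; last exact: test_L2.
  by have := ug phi tp; rewrite (ug' phi tp); lra.
by apply: filterS => x /= h Ox; apply/eqP; rewrite -subr_eq0; apply/eqP; exact: h.
Qed.

Lemma weak_partialP i u : in_H1 Omega u ->
  in_L2 Omega (weak_partial Omega i u) /\ is_weak_partial Omega i u (weak_partial Omega i u).
Proof.
move=> [_ /(_ i) [g Lg ug]]; rewrite /weak_partial.
by case: xgetP => [_ -> //|/(_ g)[]].
Qed.

(** The choice made by [xget] meets its specification because [g] does, and uniqueness identifies
    the two. *)
Lemma weak_partialE i u g : in_L2 Omega g -> is_weak_partial Omega i u g ->
  {ae mu, forall x, Omega x -> weak_partial Omega i u x = g x}.
Proof.
move=> Lg ug; apply: (@weak_partial_unique i u) => //.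
- by rewrite /weak_partial; case: xgetP => [_ -> []//|/(_ g)[]].
- by rewrite /weak_partial; case: xgetP => [_ -> []//|/(_ g)[]].
Qed.

Lemma is_weak_partialP i a u v g h : in_L2 Omega u -> in_L2 Omega v ->
  in_L2 Omega g -> in_L2 Omega h ->
  is_weak_partial Omega i u g -> is_weak_partial Omega i v h ->
  is_weak_partial Omega i (a *: u + v) (a *: g + h).
Proof.
move=> Lu Lv Lg Lh ug vh phi tp.
rewrite (form_linl hI (test_L2 (test_partial i tp)))// (form_linl hI (test_L2 tp))//.
by rewrite ug// vh//; ring.
Qed.

Lemma is_weak_partialB i u v g h : in_L2 Omega u -> in_L2 Omega v ->
  in_L2 Omega g -> in_L2 Omega h ->
  is_weak_partial Omega i u g -> is_weak_partial Omega i v h ->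
  is_weak_partial Omega i (u - v) (g - h).
Proof.
move=> Lu Lv Lg Lh ug vh; rewrite [u - v]addrC [g - h]addrC -(scaleN1r v) -(scaleN1r h).
exact: is_weak_partialP.
Qed.

Lemma ip_weak_partialE i u g : in_L2 Omega g -> is_weak_partial Omega i u g ->
  ip Omega (weak_partial Omega i u) (weak_partial Omega i u) = ip Omega g g.
Proof.
move=> Lg ug; have wg := weak_partialE Lg ug.
have Lw : in_L2 Omega (weak_partial Omega i u).
  by rewrite /weak_partial; case: xgetP => [_ -> []//|/(_ g)[]].
etransitivity; first exact: (ae_ip mO Lw Lg Lw wg).
etransitivity; first exact: (formC hI Lg Lw).
exact: (ae_ip mO Lw Lg Lg wg).
Qed.

Lemma in_H1_subspace : subspace_of (in_H1 Omega : set (Rd -> R)).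
Proof.
split.
  split; first exact: subspace0 hX.
  move=> i; exists 0; first exact: subspace0 hX.
  move=> phi tp; have Lp := test_L2 tp; have Ldp := test_L2 (test_partial i tp).
  have z1 := linear_on0 hX (form_linl hI Lp); have z2 := linear_on0 hX (form_linl hI Ldp).
  by rewrite z1 z2 oppr0.
move=> a u v [Lu Hu] [Lv Hv]; split; first exact: subspaceP hX _ _ _ Lu Lv.
move=> i; have [g Lg ug] := Hu i; have [h Lh vh] := Hv i.
exists (a *: g + h); first exact: subspaceP hX _ _ _ Lg Lh.
exact: is_weak_partialP.
Qed.

Lemma weak_partial_lin i a u v : in_H1 Omega u -> in_H1 Omega v ->
  {ae mu, forall x, Omega x -> weak_partial Omega i (a *: u + v) x =
    (a *: weak_partial Omega i u + weak_partial Omega i v) x}.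
Proof.
move=> Hu Hv; have [Lg ug] := weak_partialP i Hu; have [Lh vh] := weak_partialP i Hv.
apply: weak_partialE; first exact: subspaceP hX _ _ _ Lg Lh.
by apply: is_weak_partialP => //; [case: Hu|case: Hv].
Qed.

Lemma ip_semi_inner_H1 : semi_inner (in_H1 Omega : set (Rd -> R)) (ip Omega).
Proof. by apply: semi_innerS hI => u []. Qed.

(** The chosen representatives do not depend linearly on the function; linearity returns under the
    integral because they agree almost everywhere. *)
Lemma grad_semi_inner : semi_inner (in_H1 Omega : set (Rd -> R)) (grad_ip Omega).
Proof.
split.
- move=> u v Hu Hv; apply: eq_bigr => i _.
  by rewrite (formC hI)//; [have [] := weak_partialP i Hu|have [] := weak_partialP i Hv].
- move=> w Hw a u v Hu Hv; rewrite /grad_ip mulr_sumr -big_split/=; apply: eq_bigr => i _.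
  have [Lu _] := weak_partialP i Hu; have [Lv _] := weak_partialP i Hv.
  have [Lw _] := weak_partialP i Hw.
  have [Luv _] := weak_partialP i (subspaceP in_H1_subspace a Hu Hv).
  etransitivity; last exact: (form_linl hI Lw a Lu Lv).
  apply: (ae_ip mO Luv _ Lw); first exact: (subspaceP hX a Lu Lv).
  exact: weak_partial_lin.
- by move=> u Hu; apply: sumr_ge0 => i _; apply: (form_ge0 hI); have [] := weak_partialP i Hu.
Qed.

(** The factors 1 make it convertible with the form [H] of the abstract part, so that
    [semi_inner_sum] applies directly. *)
Definition H1_form u v := 1 * ip Omega u v + 1 * grad_ip Omega u v.

Lemma norm_H1E u : in_H1 Omega u -> norm_H1 Omega u = Num.sqrt (H1_form u u).
Proof.
move=> [Lu _]; rewrite /norm_H1 /H1_form !mul1r /norm_L2 sqr_sqrtr//.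
exact: (form_ge0 hI).
Qed.

Lemma ip_cvg (u : nat -> Rd -> R) v h : (forall k, in_L2 Omega (u k)) -> in_L2 Omega v ->
  in_L2 Omega h ->
  (forall e : R, 0 < e -> exists N, forall k, (N <= k)%N -> ip Omega (u k - v) (u k - v) < e) ->
  forall e : R, 0 < e -> exists N, forall k, (N <= k)%N -> `|ip Omega (u k) h - ip Omega v h| < e.
Proof.
move=> Lu Lv Lh uv e e0.
have h0 := form_ge0 hI Lh; pose C := ip Omega h h + 1.
have C0 : 0 < C by rewrite ltr_wpDl.
have [N hN] := uv (e ^+ 2 / C) ltac:(by rewrite divr_gt0 ?exprn_gt0).
exists N => k Nk; have Ld := subspaceB hX (Lu k) Lv.
rewrite -(formBl hI)//.
have := cauchy_schwarz hX hI Ld Lh.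
rewrite -(real_normK (num_real (ip Omega _ h))) => cs.
rewrite -(ltr_pXn2r (_ : (0 < 2)%N))// ?nnegrE ?ltW//.
apply: le_lt_trans cs _.
apply: (@le_lt_trans _ _ (ip Omega (u k - v) (u k - v) * C)).
  by rewrite ler_wpM2l ?(form_ge0 hI)// lerDl.
by rewrite -ltr_pdivlMr// hN.
Qed.

(** Functions and derivatives converge separately in L2; for each test function the identity
    defining weak derivatives survives the limit by [ip_cvg]. *)
Lemma H1_complete : complete_for (in_H1 Omega : set (Rd -> R)) H1_form.
Proof.
have hH := in_H1_subspace; have hG := grad_semi_inner.
move=> u Hu cu.
have Lu k : in_L2 Omega (u k) by case: (Hu k).
pose D i k := weak_partial Omega i (u k).
have LD i k : in_L2 Omega (D i k) by have [] := weak_partialP i (Hu k).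
have DB i j k : ip Omega (D i j - D i k) (D i j - D i k) <= grad_ip Omega (u j - u k) (u j - u k).
  have [_ wj] := weak_partialP i (Hu j); have [_ wk] := weak_partialP i (Hu k).
  have E := ip_weak_partialE (subspaceB hX (LD i j) (LD i k))
    (is_weak_partialB (Lu j) (Lu k) (LD i j) (LD i k) wj wk).
  rewrite -E.
  rewrite /grad_ip (bigD1 i)//= lerDl; apply: sumr_ge0 => l _; apply: (form_ge0 hI).
  by have [] := weak_partialP l (subspaceB hH (Hu j) (Hu k)).
have le1 j k : ip Omega (u j - u k) (u j - u k) <= H1_form (u j - u k) (u j - u k).
  by rewrite /H1_form !mul1r lerDl (form_ge0 hG)//; exact: subspaceB hH _ _ _ _.
have le2 i j k : ip Omega (D i j - D i k) (D i j - D i k) <= H1_form (u j - u k) (u j - u k).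
  apply: le_trans (DB i j k) _; rewrite /H1_form !mul1r lerDr (form_ge0 hI)//.
  exact: (subspaceB hX).
have [v Lv uv] : exists2 v, in_L2 Omega v & forall e : R, 0 < e ->
    exists N, forall k, (N <= k)%N -> ip Omega (u k - v) (u k - v) < e.
  apply: (L2_complete mO) => // e /cu[N hN]; exists N => j k Nj Nk.
  exact: le_lt_trans (le1 j k) (hN j k Nj Nk).
have /choice[g hg] : forall i, exists g, in_L2 Omega g /\ forall e : R, 0 < e ->
    exists N, forall k, (N <= k)%N -> ip Omega (D i k - g) (D i k - g) < e.
  move=> i; have [| |g Lg hg] := @L2_complete _ _ _ mu Omega mO (D i).
  - exact: LD.
  - move=> e /cu[N hN]; exists N => j k Nj Nk.
    exact: le_lt_trans (le2 i j k) (hN j k Nj Nk).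
  - by exists g.
have Lg i : in_L2 Omega (g i) by have [] := hg i.
have vg i : is_weak_partial Omega i v (g i).
  move=> phi tp; have Lp := test_L2 tp; have Ldp := test_L2 (test_partial i tp).
  apply/eqP; rewrite -subr_eq0 -normr_le0; apply/ler_addgt0Pr => e e0; rewrite add0r.
  have e2 : 0 < e / 2 by rewrite divr_gt0.
  have [N1 h1] := ip_cvg Lu Lv Ldp uv e2.
  have [N2 h2] := ip_cvg (LD i) (Lg i) Lp (hg i).2 e2.
  pose k := maxn N1 N2.
  have {}h1 := h1 k (leq_maxl _ _); have {}h2 := h2 k (leq_maxr _ _).
  have [_ /(_ phi tp) wk] := weak_partialP i (Hu k).
  rewrite opprK; rewrite wk -/(D i k) in h1.
  have -> : ip Omega v (partial i phi) + ip Omega (g i) phi =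
    (ip Omega v (partial i phi) - - ip Omega (D i k) phi) +
    (ip Omega (g i) phi - ip Omega (D i k) phi) by ring.
  apply: le_trans (ler_normD _ _) _; rewrite distrC [X in _ + X]distrC.
  by rewrite [leRHS]splitr lerD// ltW.
have Hv : in_H1 Omega v by split=> // i; exists (g i).
(* The tolerance is shared by the function and its [n.+1] derivatives, [n.+2] terms in all. *)
exists v => // e e0; pose d := e / (n.+2%:R).
have d0 : 0 < d by rewrite divr_gt0.
have [N1 h1] := uv d d0.
have /choice[N2 h2] : forall i, exists N, forall k, (N <= k)%N -> ip Omega (D i k - g i) (D i k - g i) < d.
  by move=> i; have [_] := hg i; apply.
exists (maxn N1 (\max_i N2 i)) => k; rewrite geq_max => /andP[Nk1 Nk2].
have -> : e = d + \sum_(i < n.+1) d.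
  by rewrite sumr_const card_ord -mulrS -[d *+ _]mulr_natr /d divfK// pnatr_eq0.
rewrite /H1_form !mul1r; apply: ltr_leD; first exact: h1.
apply: ler_sum => i _; have [_ wk] := weak_partialP i (Hu k).
have E := ip_weak_partialE (subspaceB hX (LD i k) (Lg i))
  (is_weak_partialB (Lu k) Lv (LD i k) (Lg i) wk (vg i)).
by rewrite E ltW// h2// (leq_trans (leq_bigmax i)).
Qed.


End weak_derivatives.

(** * Weak differentiability of piecewise smooth functions *)

Section fundamental_theorem_of_calculus.
Context (R : realType) (F G : R -> R) (C : R).
Local Notation mu1 := (@lebesgue_measure R).
Hypothesis cF : continuous F.
Hypothesis mG : measurable_fun setT G.
Hypothesis GC : forall t, `|G t| <= C.

Let good t := [/\ derivable F t 1, 'D_1 F t = G t & {for t, continuous G}].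

Lemma integrable_bounded_itv a b : mu1.-integrable `[a, b] (EFin \o G).
Proof.
apply: measurable_bounded_integrable => //.
- by rewrite /= lebesgue_measure_itv/=; case: ifP => // _; rewrite ltry.
- exact: measurable_funTS.
- exists C; split; first exact: num_real.
  by move=> M CM t _; apply: le_trans (GC t) (ltW CM).
Qed.

Lemma Rintegral_cat a c b : a <= c -> c <= b ->
  \int[mu1]_(t in `[a, b]) G t = \int[mu1]_(t in `[a, c]) G t + \int[mu1]_(t in `[c, b]) G t.
Proof.
move=> ac cb.
have ib := integrable_bounded_itv a b.
have := @Rintegral_itvB R G (BLeft a) (BRight b) c ib.
rewrite !bnd_simp => /(_ ac cb) /eqP; rewrite subr_eq addrC => /eqP ->; congr (_ + _).
apply: Rintegral_itv_obnd_cbnd; apply: integrableS (integrable_bounded_itv c b) => //.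
by apply: subset_itvr; rewrite bnd_simp.
Qed.

Lemma Rintegral_itv_le a b : a <= b -> `|\int[mu1]_(t in `[a, b]) G t| <= C * (b - a).
Proof.
move=> ab; apply: le_trans (le_normr_Rintegral _ (integrable_bounded_itv a b)) _ => //.
apply: (@le_trans _ _ (\int[mu1]_(t in `[a, b]) C)).
  apply: le_Rintegral => //.
  - exact: integrable_norm (integrable_bounded_itv a b).
  - apply: measurable_bounded_integrable => //.
    + by rewrite /= lebesgue_measure_itv/=; case: ifP => // _; rewrite ltry.
    + exists `|C|; split; first exact: num_real.
      by move=> M CM t _; exact: ltW.
rewrite Rintegral_cst//= lebesgue_measure_itv/= lte_fin; case: ltP => // ba.
by rewrite mulr0 (_ : a = b) ?subrr ?mulr0//; apply/eqP; rewrite eq_le ab.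
Qed.

Lemma ftc_closed a b : a < b -> (forall t, t \in `[a, b] -> good t) ->
  \int[mu1]_(t in `[a, b]) G t = F b - F a.
Proof.
move=> ab h; rewrite /Rintegral (@continuous_FTC2 R G F a b)//.
- by apply: continuous_in_subspaceT => t /set_mem /h [].
- split; first by move=> t /subset_itv_oo_cc /h [].
  + by apply: cvg_at_right_filter; exact: cF.
  + by apply: cvg_at_left_filter; exact: cF.
- by move=> t /subset_itv_oo_cc /h [_ <- _]; rewrite derive1E.
Qed.

(** [G] may jump at the end points, so the formula is applied on a slightly smaller interval;
    continuity of [F] and boundedness of [G] control the rest. *)
Lemma ftc_open a b : a < b -> (forall t, t \in `]a, b[ -> good t) ->
  \int[mu1]_(t in `[a, b]) G t = F b - F a.
Proof.
move=> ab h; apply/eqP; rewrite -subr_eq0 -normr_le0.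
apply/ler_addgt0Pr => e e0; rewrite add0r.
have e4 : 0 < e / 4 by rewrite divr_gt0.
have C0 : 0 <= C by exact: le_trans (normr_ge0 _) (GC 0).
have [da da0 hda] : exists2 d : R, 0 < d & forall t, `|t - a| < d -> `|F t - F a| < e / 4.
  have /cvgrPdist_lt /(_ _ e4) /nbhs_ballP[d /= d0 hd] := cF (x := a).
  by exists d => // t ta; rewrite distrC; apply: hd; rewrite /ball/= distrC.
have [db db0 hdb] : exists2 d : R, 0 < d & forall t, `|t - b| < d -> `|F t - F b| < e / 4.
  have /cvgrPdist_lt /(_ _ e4) /nbhs_ballP[d /= d0 hd] := cF (x := b).
  by exists d => // t ta; rewrite distrC; apply: hd; rewrite /ball/= distrC.
(* The four bounds make both increments of [F] and both end integrals at most [e / 4], and keep the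
   shrunken interval nonempty. *)
pose h0 := Num.min (Num.min (da / 2) (db / 2)) (Num.min ((b - a) / 4) (e / (4 * (C + 1)))).
have C1 : 0 < C + 1 by rewrite ltr_wpDl.
have h00 : 0 < h0.
  by rewrite !lt_min !divr_gt0 ?subr_gt0// mulr_gt0.
have [ha hb hab hC] : [/\ h0 <= da / 2, h0 <= db / 2, h0 <= (b - a) / 4 & h0 <= e / (4 * (C + 1))].
  by split; rewrite /h0 !ge_min lexx ?orbT.
clearbody h0.
have Ch : C * h0 <= e / 4.
  apply: (@le_trans _ _ ((C + 1) * h0)); first by rewrite ler_wpM2r ?ltW// ltrDl.
  rewrite mulrC -ler_pdivlMr//; apply: le_trans hC _.
  by rewrite le_eqVlt; apply/orP; left; apply/eqP; field; rewrite lt0r_neq0.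
have ac : a <= a + h0 by lra.
have cd : a + h0 < b - h0 by lra.
have db' : b - h0 <= b by lra.
rewrite (Rintegral_cat ac (le_trans (ltW cd) db')) (Rintegral_cat (ltW cd) db').
rewrite (ftc_closed cd); last first.
  move=> t; rewrite in_itv/= => /andP[t1 t2]; apply: h; rewrite in_itv/=; apply/andP; split; lra.
have I1 := Rintegral_itv_le ac; have I2 := Rintegral_itv_le db'.
have F1 := hda (a + h0) ltac:(rewrite addrC addKr gtr0_norm//; lra).
have F2 := hdb (b - h0) ltac:(rewrite addrAC subrr add0r normrN gtr0_norm//; lra).
have E1 : a + h0 - a = h0 by ring.
have E2 : b - (b - h0) = h0 by ring.
rewrite {}E1 in I1; rewrite {}E2 in I2.
move: I1 I2 F1 F2 Ch.
set x1 := \int[mu1]_(t in `[a, a + h0]) _; set x2 := \int[mu1]_(t in `[b - h0, b]) _.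
set y1 := F (a + h0); set y2 := F (b - h0); set y3 := F a; set y4 := F b; set z := C * h0.
clearbody x1 x2 y1 y2 y3 y4 z.
rewrite !ler_norml !ltr_norml => /andP[p1 p2] /andP[p3 p4] /andP[p5 p6] /andP[p7 p8] p9.
by apply/andP; split; lra.
Qed.

(** Induction on the number of exceptional points: the interval is cut at one of them, which then
    leaves the list. *)
Lemma ftc_except (s : seq R) a b : a <= b ->
  (forall t, t \in `]a, b[ -> t \notin s -> good t) ->
  \int[mu1]_(t in `[a, b]) G t = F b - F a.
Proof.
have [m] := ubnP (size s); elim: m s a b => // m IH s a b sm ab h.
have [ab'|ba] := ltP a b; last first.
  have -> : a = b by apply/eqP; rewrite eq_le ab.
  by rewrite set_itv1 Rintegral_set1 subrr.
have [/hasP[c cs cab]|/hasPn nos] := boolP (has (fun c => c \in `]a, b[) s); last first.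
  by apply: ftc_open => // t tab; apply: h => //; apply/negP => /nos; rewrite tab.
move: (cab); rewrite in_itv/= => /andP[ac cb].
have ss : (size (seq.filter (predC1 c) s) < m)%N.
  rewrite -ltnS; apply: leq_trans sm; rewrite ltnS size_filter -(count_predC (pred1 c) s).
  by rewrite -[X in (X < _)%N]add0n ltn_add2r -has_count has_pred1.
rewrite (Rintegral_cat (ltW ac) (ltW cb)).
rewrite (IH _ a c ss (ltW ac)) ?(IH _ c b ss (ltW cb)); first by ring.
  move=> t; rewrite in_itv/= mem_filter => /andP[t1 t2] ts; apply: h.
    by rewrite in_itv/= t2 (lt_trans ac).
  by move: ts; rewrite negb_and/= negbK => /orP[/eqP tc|//]; rewrite tc ltxx in t1.
move=> t; rewrite in_itv/= mem_filter => /andP[t1 t2] ts; apply: h.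
  by rewrite in_itv/= t1 (lt_trans _ cb).
by move: ts; rewrite negb_and/= negbK => /orP[/eqP tc|//]; rewrite tc ltxx in t2.
Qed.

Lemma ftc_compact_support (s : seq R) (M : R) :
  (forall t, M <= `|t| -> F t = 0 /\ G t = 0) ->
  (forall t, t \notin s -> good t) ->
  (\int[mu1]_t (G t)%:E = 0)%E.
Proof.
move=> hM h; pose M1 : R := `|M| + 1.
have M10 : 0 < M1 by rewrite ltr_wpDl.
have big t : M1 <= `|t| -> F t = 0 /\ G t = 0.
  by move=> tM; apply: hM; apply: le_trans tM; rewrite (le_trans (ler_norm _))// lerDl.
transitivity (\int[mu1]_(t in `[(- M1)%R, M1]) (G t)%:E)%E.
  rewrite [RHS]integral_mkcond; apply: eq_integral => t _; rewrite patchE.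
  case: ifPn => // /negP tn; rewrite (big t _).2//.
  rewrite leNgt; apply/negP => tM; apply: tn; apply/mem_set => /=.
  by move: tM; rewrite in_itv/= ltr_norml => /andP[/ltW -> /ltW ->].
have fin : (\int[mu1]_(t in `[(- M1)%R, M1]) (G t)%:E)%E \is a fin_num.
  by apply: integrable_fin_num => //; exact: integrable_bounded_itv.
rewrite -[LHS]fineK//; congr (_%:E).
have := @ftc_except s (- M1) M1; rewrite /Rintegral => ->.
- have [-> _] : F M1 = 0 /\ G M1 = 0 by apply: big; rewrite ler_norm.
  have [-> _] : F (- M1) = 0 /\ G (- M1) = 0 by apply: big; rewrite normrN ler_norm.
  by rewrite subrr.
- by apply: (@le_trans _ _ 0); rewrite ?oppr_le0 ltW.
- by move=> t _; exact: h.
Qed.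

End fundamental_theorem_of_calculus.

Section integration_by_parts.
Context (R : realType) (n : nat) (Omega : set 'rV[R]_n.+1) (M : nat).
Context (oO : open Omega) (OM : Omega `<=` @cube R n.+1 M).
Local Notation Rd := 'rV[R]_n.+1.
Local Notation mu := (lebesgue_rV R n.+1).
Implicit Types (u v f g phi : Rd -> R).

Let mO : measurable Omega. Proof. exact: open_measurable_rV. Qed.

Lemma bounded_domain_lty : (mu Omega < +oo)%E.
Proof. exact: lebesgue_bounded_lty OM. Qed.

Let finO := bounded_domain_lty.

(* Fubini along the lines parallel to the i-th axis: on almost every line [v] is
   continuous and differentiable off a finite set, so the fundamental theorem of
   calculus applies to [v * phi]. *)
Lemma weak_partial_lines i v g (C : R) (N : set 'rV[R]_n) :
  (forall x, Omega x -> {for x, continuous v}) -> measurable_fun Omega g ->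
  (forall x, Omega x -> `|v x| <= C) -> (forall x, Omega x -> `|g x| <= C) ->
  (lebesgue_rV R n).-negligible N ->
  (forall x, ~ N x -> exists s : seq R, forall t, t \notin s -> Omega (ins i t x) ->
    [/\ derivable (fun r : R => v (ins i r x)) t 1,
        'D_1 (fun r : R => v (ins i r x)) t = g (ins i t x)
      & {for t, continuous (fun r : R => g (ins i r x))}]) ->
  is_weak_partial Omega i v g.
Proof.
move=> cv mg vC gC NN lines phi tp.
have mv : measurable_fun Omega v.
  by apply: continuous_measurable_rV => // x /set_mem; exact: cv.
have Lv : in_L2 Omega v by exact: bounded_L2 vC.
have Lg : in_L2 Omega g by exact: bounded_L2 gC.
have tdp := test_partial i tp.
have Lp := test_L2 oO finO tp; have Ldp := test_L2 oO finO tdp.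
have sp : smooth phi by case: tp.
have sdp : smooth (partial i phi) by case: tdp.
have cphi x : {for x, continuous phi}.
  by apply: differentiable_continuous; exact: smooth_differentiable.
have cdphi x : {for x, continuous (partial i phi)}.
  by apply: differentiable_continuous; exact: smooth_differentiable.
pose K y := v y * partial i phi y + g y * phi y.
pose k := K \_ Omega.
have Ki : mu.-integrable Omega (EFin \o K).
  have h := integrableD mO (integrable_mul mO Lv Ldp) (integrable_mul mO Lg Lp).
  by apply: (eq_integrable mO _ _ _ h) => x _ /=; rewrite EFinD.
have ki : mu.-integrable setT (EFin \o k).
  by rewrite -restrict_EFin; apply/(integrable_mkcond (EFin \o K) mO).
suff : (\int[mu]_(x in Omega) (K x)%:E = 0)%E.
  move=> K0; apply/eqP; rewrite -subr_eq0 opprK /ip -RintegralD//; last 2 first.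
  - exact: integrable_mul.
  - exact: integrable_mul.
  by rewrite /Rintegral K0.
transitivity (\int[mu]_x (k x)%:E)%E.
  by rewrite integral_mkcond restrict_EFin.
rewrite (fubini_ins i)//.
transitivity (\int[lebesgue_rV R n]_x cst 0%E x)%E; last by rewrite integral0.
apply: ae_eq_integral => //; first exact: (measurable_fubini_ins i ki).
apply: (negligibleS _ NN) => x /= hx; apply: contrapT => nN; apply: hx => _.
have [s hs] := lines x nN.
pose F t := v (ins i t x) * phi (ins i t x).
have [Cp hCp] := test_bounded tp; have [Cd hCd] := test_bounded tdp.
have kC y : `|k y| <= `|C| * Cd + `|C| * Cp.
  have Cd0 : 0 <= Cd by exact: le_trans (normr_ge0 _) (hCd y).
  have Cp0 : 0 <= Cp by exact: le_trans (normr_ge0 _) (hCp y).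
  rewrite /k patchE; case: ifPn => [/set_mem Oy|_]; last first.
    by rewrite normr0 addr_ge0// mulr_ge0.
  apply: le_trans (ler_normD _ _) _; rewrite !normrM.
  have C1 z : z <= C -> z <= `|C| by move=> /le_trans; apply; exact: ler_norm.
  by rewrite lerD// ler_pM// C1// ?vC ?gC.
have ci t := @continuous_ins R n i x t.
(* Nothing is known of [v] outside [Omega], but the support of [phi] is a closed subset of [Omega];
   so near such a point the product vanishes identically and its extension by zero is harmless. *)
have off t : ~ Omega (ins i t x) -> \near t, F t = 0 /\ k (ins i t x) = 0.
  move=> nO; have ns : ~ closure [set x | phi x != 0] (ins i t x).
    by case: tp => _ _ sub /sub.
  have /open_nbhs_nbhs h : open_nbhs (ins i t x) (~` closure [set x | phi x != 0]).
    by split=> //; apply: closed_openC; exact: closed_closure.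
  have {}h := ci t _ h; near=> r.
  have nr : ~ closure [set x | phi x != 0] (ins i r x) by near: r; exact: h.
  have p0 : phi (ins i r x) = 0.
    by apply: contrapT => /eqP pr; apply: nr; exact: subset_closure.
  have d0 : partial i phi (ins i r x) = 0.
    by apply: contrapT => /eqP pr; apply: nr; exact: partial_support pr.
  split; first by rewrite /F p0 mulr0.
  by rewrite /k patchE; case: ifP => // _; rewrite /K p0 d0 !mulr0 addr0.
have cont_near (f : R -> R) t : (\near t, f t = 0) -> {for t, continuous f}.
  move=> h; rewrite /prop_for /continuous_at (nbhs_singleton h).
  have h' : \near t, cst 0 t = f t by apply: filterS h => z /= ->.
  by apply: cvg_trans (near_eq_cvg h') _; exact: cvg_cst.
have cF : continuous F.
  move=> t; have [Ot|nO] := pselect (Omega (ins i t x)); last first.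
    by apply: cont_near; apply: filterS (off t nO) => z [].
  apply: cvgM.
    by apply: (cvg_comp _ _ (ci t)); exact: cv.
  by apply: (cvg_comp _ _ (ci t)); exact: cphi.
have mk : measurable_fun setT (fun t => k (ins i t x)).
  have /integrableP[/measurable_EFinP mk _] := ki.
  exact: (measurableT_comp mk (measurable_ins_section i x)).
apply: (@ftc_compact_support R F (fun t => k (ins i t x)) _ cF mk (fun t => kC _) s M%:R).
  move=> t tM; have nO : ~ Omega (ins i t x).
    move=> /OM /(_ i); rewrite ins_same in_itv/= -ltr_norml => h.
    by move: (lt_le_trans h tM); rewrite ltxx.
  by have := nbhs_singleton (off t nO).
move=> t ts; have [Ot|nO] := pselect (Omega (ins i t x)); last first.
  have h := off t nO.
  have h1 : \near t, cst 0 t = F t by apply: filterS h => z /= [-> _].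
  have [d1 d2] := near_eq_is_derive h1 (is_derive_cst (0 : R) t 1).
  split=> //; first by rewrite d2 (nbhs_singleton h).2.
  by apply: cont_near; apply: filterS h => z [].
have [v1 v2 v3] := hs t ts Ot.
have p1 := derivable_ins (smooth_differentiable (ins i t x) sp).
have [d1 d2] := is_deriveM (derivableP v1) (derivableP p1).
split.
- exact: d1.
- rewrite d2 v2 derive_ins /k patchE mem_set// /K.
  by rewrite [_ *: _]/(_ * _) [X in _ + X]/(_ * _) [X in _ + X]mulrC.
have /open_nbhs_nbhs h : open_nbhs (ins i t x) Omega by [].
have {}h := ci t _ h.
have kK : \near t, K (ins i t x) = k (ins i t x).
  near=> r; rewrite /k patchE mem_set//.
  by near: r; exact: h.
have -> : (fun t => k (ins i t x)) = (k \o (fun t => ins i t x)) by [].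
rewrite /prop_for /continuous_at /= -(nbhs_singleton kK).
apply: cvg_trans (near_eq_cvg kK) _.
apply: cvgD; apply: cvgM.
- by apply: (cvg_comp _ _ (ci t)); exact: cv.
- exact: (cvg_comp (fun r => ins i r x) (partial i phi) (ci t) (cdphi _)).
- exact: v3.
- by apply: (cvg_comp _ _ (ci t)); exact: cphi.
Unshelve. all: by end_near.
Qed.

Lemma closed_cube_compact : compact (closed_box (fun=> - M%:R) (fun=> M%:R) : set Rd).
Proof. exact: closed_box_compact. Qed.

Lemma domain_closed_cube : Omega `<=` (closed_box (fun=> - M%:R) (fun=> M%:R) : set Rd).
Proof.
by move=> x /OM h i; have := h i; rewrite !in_itv/= => /andP[/ltW -> /ltW ->].
Qed.

Lemma continuous_bounded_domain f : continuous f -> exists C, forall x, Omega x -> `|f x| <= C.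
Proof.
move=> cf; have [C hC] := continuous_compact_bounded closed_cube_compact (fun x _ => cf x).
by exists C => x /domain_closed_cube; exact: hC.
Qed.

Lemma smooth_continuous f : smooth f -> continuous f.
Proof. by move=> sf x; apply: differentiable_continuous; exact: smooth_differentiable. Qed.

Lemma smooth_L2 f : smooth f -> in_L2 Omega f.
Proof.
move=> sf; have [C hC] := continuous_bounded_domain (smooth_continuous sf).
by apply: bounded_L2 hC => //; exact: smooth_measurable.
Qed.

Lemma smooth_weak_partial i f : smooth f -> is_weak_partial Omega i f (partial i f).
Proof.
move=> sf; have sdf := smooth_partial i sf.
have [C1 h1] := continuous_bounded_domain (smooth_continuous sf).
have [C2 h2] := continuous_bounded_domain (smooth_continuous sdf).
apply: (@weak_partial_lines i f (partial i f) (Num.max C1 C2) set0).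
- by move=> x _; exact: smooth_continuous.
- exact: smooth_measurable.
- by move=> x Ox; rewrite le_max h1.
- by move=> x Ox; rewrite le_max h2// orbT.
- exact: negligible_set0.
move=> x _; exists [::] => t _ _; split.
- by apply: derivable_ins; exact: smooth_differentiable.
- exact: derive_ins.
- apply: (@continuous_comp _ _ _ (fun r => ins i r x) (partial i f)).
    exact: continuous_ins.
  exact: smooth_continuous.
Qed.

Lemma smooth_H1 f : smooth f -> in_H1 Omega f.
Proof.
move=> sf; split; first exact: smooth_L2.
move=> i; exists (partial i f); last exact: smooth_weak_partial.
by apply: smooth_L2; exact: smooth_partial.
Qed.

End integration_by_parts.

(** * The finite element spaces *)

Section polynomials.
Context (R : realType) (n p : nat).
Local Notation Rd := 'rV[R]_n.+1.
Local Notation expo := {ffun 'I_n.+1 -> 'I_p.+1}.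

Definition poly_eval (c : expo -> R) (x : Rd) : R :=
  \sum_(a : expo | (\sum_i a i <= p)%N) c a * \prod_i x 0 i ^+ a i.

Lemma is_polynomialP (q : Rd -> R) : is_polynomial p q <-> exists c, q = poly_eval c.
Proof.
by split=> -[c hc]; exists c; [apply/funext => x; rewrite hc|rewrite hc].
Qed.

Lemma poly_eval_lin a c c' x :
  poly_eval (fun e => a * c e + c' e) x = a * poly_eval c x + poly_eval c' x.
Proof.
by rewrite /poly_eval mulr_sumr -big_split; apply: eq_bigr => e _; rewrite mulrDl mulrA.
Qed.

Lemma poly_eval_smooth c : smooth (poly_eval c).
Proof.
apply: smooth_algebra_smooth; rewrite /poly_eval.
elim: (index_enum _) => [|e r IH].
  by under eq_fun do rewrite big_nil; exact: alg_const.
under eq_fun do rewrite big_cons.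
case: (\sum_i e i <= p)%N; last exact: IH.
apply: (alg_add _ IH).
apply: (@alg_mul R n (cst (c e)) (fun x => \prod_i x 0 i ^+ e i)); first exact: alg_const.
elim: (index_enum _) => [|i s IHs].
  by under eq_fun do rewrite big_nil; exact: alg_const.
under eq_fun do rewrite big_cons.
apply: (alg_mul _ IHs); elim: (nat_of_ord (e i)) => [|k IHk].
  by under eq_fun do rewrite expr0; exact: alg_const.
under eq_fun do rewrite exprS.
by apply: (alg_mul _ IHk); exact: alg_coord.
Qed.

Lemma is_polynomial_smooth (q : Rd -> R) : is_polynomial p q -> smooth q.
Proof. by move=> /is_polynomialP[c ->]; exact: poly_eval_smooth. Qed.

Lemma is_polynomial_lin a (q q' : Rd -> R) : is_polynomial p q -> is_polynomial p q' ->
  is_polynomial p (a *: q + q').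
Proof.
move=> /is_polynomialP[c ->] /is_polynomialP[c' ->]; apply/is_polynomialP.
by exists (fun e => a * c e + c' e); apply/funext => x; rewrite poly_eval_lin.
Qed.

End polynomials.

(** * Barycentric coordinates of simplices *)

Section simplices.
Context (R : realType) (n : nat).
Local Notation Rd := 'rV[R]_n.+1.

Definition plane (h : Rd * R) : set Rd := [set x | \sum_k h.1 0 k * x 0 k = h.2].

(** The column of ones turns the affine equations for barycentric coordinates into one linear
    system, invertible for affinely independent vertices. *)
Definition extended (V : 'M[R]_(n.+2, n.+1)) : 'M[R]_n.+2 :=
  row_mx (const_mx 1 : 'M[R]_(n.+2, 1)) V.

Lemma mul_extended (t : 'rV[R]_(n.+2)) V :
  t *m extended V = row_mx (const_mx (\sum_i t 0 i) : 'M[R]_(1, 1)) (t *m V) :> 'M[R]_(1, 1 + n.+1).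
Proof.
etransitivity; first exact: (mul_mx_row t (const_mx 1) V).
congr row_mx.
apply/matrixP => i j; rewrite !mxE; apply: eq_bigr => k _.
by rewrite !mxE ord1 mulr1.
Qed.

Lemma extended_unit V : affinely_independent V -> extended V \in unitmx.
Proof.
move=> aV; rewrite -row_free_unit -kermx_eq0; apply/rowV0P => t /sub_kermxP.
move=> tB; have /eqP : row_mx (const_mx (\sum_i t 0 i) : 'M[R]_(1, 1)) (t *m V) = 0.
  by rewrite -mul_extended.
rewrite row_mx_eq0 => /andP[/eqP t1 /eqP tV].
have {}t1 : \sum_i t 0 i = 0 by move/matrixP: t1 => /(_ 0 0); rewrite !mxE.
pose s : 'rV[R]_n.+1 := \row_i t 0 (lift ord0 i).
have s0 : s = 0.
  apply: (row_free_inj aV); rewrite mul0mx; apply/rowP => k; rewrite !mxE.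
  have t0E : t 0 ord0 = - \sum_(i < n.+1) t 0 (lift ord0 i).
    by apply/eqP; rewrite -addr_eq0 -big_ord_recl t1.
  move/matrixP: tV => /(_ 0 k); rewrite !mxE big_ord_recl t0E mulNr mulr_suml addrC -sumrB => tV.
  by rewrite -[RHS]tV; apply: eq_bigr => i _; rewrite !mxE mulrBr.
have ts i : t 0 (lift ord0 i) = 0 by move/rowP: s0 => /(_ i); rewrite !mxE.
move: t1; rewrite big_ord_recl big1 ?addr0 => [t0|i _]; last exact: ts.
apply/rowP => i; rewrite [RHS]mxE; have [j ->|->] := unliftP ord0 i; first exact: ts.
exact: t0.
Qed.

(** The inverse of [extended V] computes the barycentric coordinates of [x] as affine functions of
    [x]; the open simplex is where all of them are positive. *)
Lemma simplex_halfspaces K : is_open_simplex K ->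
  exists A : 'I_n.+2 -> Rd * R, (forall j, (A j).1 != 0) /\
    K = [set x | forall j, (A j).2 < \sum_k (A j).1 0 k * x 0 k].
Proof.
move=> [V /extended_unit uB ->]; pose D := invmx (extended V).
pose A j : Rd * R := (\row_k D (lift ord0 k) j, - D ord0 j); exists A.
pose l (x : Rd) : 'rV[R]_n.+2 := (row_mx (const_mx 1 : 'M[R]_(1, 1)) x : 'rV[R]_(1 + n.+1)) *m D.
have lE x j : l x 0 j = \sum_k (A j).1 0 k * x 0 k - (A j).2.
  have rl k : (row_mx (const_mx 1 : 'M[R]_(1, 1)) x : 'rV[R]_(1 + n.+1)) 0 (lift ord0 k) = x 0 k.
    rewrite -[RHS](row_mxEr (const_mx 1 : 'M[R]_(1, 1)) x 0 k).
    by congr (row_mx _ _ _ _); exact/val_inj.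
  have r0 : (row_mx (const_mx 1 : 'M[R]_(1, 1)) x : 'rV[R]_(1 + n.+1)) 0 ord0 = 1.
    have -> : ord0 = lshift n.+1 (0 : 'I_1) by exact/val_inj.
    by rewrite row_mxEl mxE.
  rewrite /l mxE big_ord_recl r0 mul1r opprK addrC; congr (_ + _).
  by apply: eq_bigr => k _; rewrite rl [X in _ = X * _]mxE mulrC.
split.
  (* With a zero normal the j-th barycentric coordinate would be constant, yet it is 1 at vertex j
     and 0 at another vertex. *)
  move=> j; apply/eqP => A0.
  have A0k k : D (lift ord0 k) j = 0 by move/rowP: A0 => /(_ k); rewrite !mxE.
  have BD i : (extended V *m D) i j = D ord0 j.
    rewrite mxE big_ord_recl big1 ?addr0 => [|k _]; last by rewrite A0k mulr0.
    have E1 : row_mx (const_mx 1 : 'M[R]_(n.+2, 1)) V i (lshift n.+1 0) = 1.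
      by rewrite row_mxEl mxE.
    rewrite -[RHS]mul1r -[in RHS]E1; congr (_ * _); congr (row_mx _ _ _ _).
    exact/val_inj.
  have := BD (lift j ord0); rewrite -(BD j) mulmxV// !mxE eqxx.
  rewrite eq_sym (negbTE (neq_lift _ _)) => /esym/eqP.
  by rewrite oner_eq0.
apply/seteqP; split=> [x [t [tp t1 xE]] j|x h].
  rewrite -subr_gt0 -lE.
  pose T : 'rV[R]_n.+2 := \row_i t i.
  have -> : l x = T; last by rewrite mxE.
  have -> : l x = (T *m extended V) *m D.
    rewrite mul_extended /l; congr (row_mx _ _ *m _).
      apply/matrixP => a b; rewrite !mxE -t1; apply: eq_bigr => i _.
      by rewrite !mxE.
    rewrite xE mulmx_sum_row; apply: eq_bigr => i _.
    by rewrite mxE.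
  by rewrite -mulmxA mulmxV// mulmx1.
exists (fun j => l x 0 j).
have lB : l x *m extended V = row_mx (const_mx 1 : 'M[R]_(1, 1)) x :> 'M[R]_(1, 1 + n.+1).
  by rewrite /l -mulmxA mulVmx// mulmx1.
move: lB; rewrite mul_extended => /eq_row_mx[l1 l2]; split.
- by move=> j; rewrite lE subr_gt0.
- by move/matrixP: l1 => /(_ 0 0); rewrite !mxE.
- by rewrite -{1}l2 mulmx_sum_row.
Qed.

Lemma continuous_linear_form (a : Rd) : continuous (fun x : Rd => \sum_k a 0 k * x 0 k : R).
Proof.
apply: smooth_continuous; apply: smooth_algebra_smooth.
elim: (index_enum _) => [|k r IH].
  by under eq_fun do rewrite big_nil; exact: alg_const.
under eq_fun do rewrite big_cons.
apply: (alg_add _ IH); apply: (@alg_mul R n (cst (a 0 k)) (fun x => x 0 k)).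
  exact: alg_const.
exact: alg_coord.
Qed.

Lemma simplex_facets K : is_open_simplex K -> open K /\
  exists hs : seq (Rd * R), (forall h, h \in hs -> h.1 != 0) /\
    forall x, closure K x -> (forall h, h \in hs -> ~ plane h x) -> K x.
Proof.
move=> /simplex_halfspaces[A [A0 ->]].
have oj j : open [set x : Rd | (A j).2 < \sum_k (A j).1 0 k * x 0 k].
  exact: (open_comp (fun x _ => @continuous_linear_form (A j).1 x) (@open_gt R (A j).2)).
split.
  rewrite openE => x hx; apply: (@filter_forall _ _
    (fun j => [set x : Rd | (A j).2 < \sum_k (A j).1 0 k * x 0 k])
    (nbhs x) (nbhs_filter x)) => j.
  exact: open_nbhs_nbhs (conj (oj j) (hx j)).
exists (codom A); split=> [h /codomP[j ->]//|x cx nx j].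
rewrite lt_neqAle; apply/andP; split.
  by apply/eqP => e; apply: (nx (A j)); [exact: codom_f|rewrite /plane/= e].
rewrite leNgt; apply/negP => lt.
have [y [/= yK ylt]] := cx _ (open_nbhs_nbhs (conj
  (open_comp (fun x _ => @continuous_linear_form (A j).1 x) (@open_lt R (A j).2)) lt)).
by have := lt_trans (yK j) ylt; rewrite ltxx.
Qed.

End simplices.

(** * Finite element functions on a mesh *)

Section mesh.
Context (R : realType) (n : nat) (Omega : set 'rV[R]_n.+1) (M : nat).
Context (oO : open Omega) (OM : Omega `<=` @cube R n.+1 M).
Local Notation Rd := 'rV[R]_n.+1.
Local Notation mu := (lebesgue_rV R n.+1).
Context (T : set (set Rd)) (p : nat) (finT : finite_set T).
Context (simplT : forall K, T K -> is_open_simplex K).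
Context (coverT : closure Omega = \bigcup_(K in T) closure K).

Let mO : measurable Omega. Proof. exact: open_measurable_rV. Qed.
Let finO := bounded_domain_lty oO OM.

Lemma mesh_covered x : Omega x -> exists2 K, T K & closure K x.
Proof.
move=> Ox; have : closure Omega x by exact: subset_closure.
by rewrite coverT => -[K TK cK]; exists K.
Qed.

(** Collects the facet planes of all cells: off this finite family every point of the domain is
    interior to some cell. *)
Lemma mesh_facets : exists hs : seq (Rd * R), (forall h, h \in hs -> h.1 != 0) /\
  forall x, Omega x -> (forall h, h \in hs -> ~ plane h x) -> exists2 K, T K & K x.
Proof.
have /choice[f hf] : forall K, exists hs : seq (Rd * R), T K ->
    (forall h, h \in hs -> h.1 != 0) /\
    forall x, closure K x -> (forall h, h \in hs -> ~ plane h x) -> K x.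
  move=> K; have [TK|nT] := pselect (T K); last by exists [::].
  by have [_ [hs h]] := simplex_facets (simplT TK); exists hs.
have /finite_seqP[s Ts] := finT.
have sT K : K \in s -> T K by rewrite Ts.
exists (flatten [seq f K | K <- s]); split=> [h /flatten_mapP[K /sT TK hK]|x Ox nx].
  by have [+ _] := hf K TK; apply.
have [K TK cK] := mesh_covered Ox; exists K => //.
have [_] := hf K TK; apply => // h hK; apply: nx.
by apply/flatten_mapP; exists K => //; move: TK; rewrite Ts.
Qed.

Lemma open_mesh_cell K : T K -> open K.
Proof. by move=> /simplT /simplex_facets[]. Qed.

Lemma in_S_continuous v x : in_S Omega T p v -> Omega x -> {for x, continuous v}.
Proof.
move=> [cv _] Ox; move: cv; rewrite continuous_open_subspace// => cv.
by apply: cv; exact: mem_set.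
Qed.

(** Continuity carries the polynomial identity to the boundary of the cell, where the definition of
    the space says nothing. *)
Lemma in_S_closure v K q x : in_S Omega T p v -> is_polynomial p q ->
  (forall y, K y -> v y = q y) -> Omega x -> closure K x -> v x = q x.
Proof.
move=> Sv pq vq Ox cK; apply/eqP; rewrite -subr_eq0; apply: contraT => d0.
have cq : continuous q by exact: smooth_continuous (is_polynomial_smooth pq).
have cd : (v y - q y) @[y --> x] --> v x - q x.
  exact: (cvgB (in_S_continuous Sv Ox) (cq x)).
have [y [Ky /= dy]] := cK _ (cd _ (open_nbhs_nbhs (conj (@open_neq R 0) d0))).
by move: dy; rewrite vq// subrr eqxx.
Qed.

Lemma in_S_on (v q : Rd -> R) K : T K -> (forall y, K y -> v y = q y) ->
  forall y, K y -> \near y, q y = v y.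
Proof.
move=> TK vq y Ky; have := open_nbhs_nbhs (conj (open_mesh_cell TK) Ky).
by apply: filterS => z Kz; rewrite vq.
Qed.

Lemma mesh_bound (f : set Rd -> R) : exists C, forall K, T K -> f K <= C.
Proof.
have /finite_seqP[s Ts] := finT.
exists (\sum_(K <- s) `|f K|) => K; rewrite Ts /= => Ks.
rewrite (big_rem K)//= (le_trans (ler_norm _))// lerDl.
exact: sumr_ge0.
Qed.

(** The cellwise derivative is the weak derivative. A line in direction [i] crosses each facet plane
    not containing that direction once; the lines inside the other planes form a null family. *)
Lemma in_S_H1 v : in_S Omega T p v -> in_H1 Omega v.
Proof.
move=> Sv; have [_ vT] := Sv.
have /choice[q hq] : forall K, exists q : Rd -> R, T K -> is_polynomial p q /\
    forall x, K x -> v x = q x.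
  move=> K; have [TK|nT] := pselect (T K); last by exists (cst 0).
  by have [q pq vq] := vT K TK; exists q.
have sq K : T K -> smooth (q K) by move=> TK; have [] := hq K TK; move=> /is_polynomial_smooth.
have vC : exists C, forall x, Omega x -> `|v x| <= C.
  have /choice[c hc] : forall K, exists c, T K -> forall x, Omega x -> `|q K x| <= c.
    move=> K; have [TK|nT] := pselect (T K); last by exists 0.
    have [c hc] := continuous_bounded_domain OM (smooth_continuous (sq K TK)).
    by exists c.
  have [C hC] := mesh_bound c; exists C => x Ox; have [K TK cK] := mesh_covered Ox.
  have [pq vq] := hq K TK.
  by rewrite (in_S_closure Sv pq vq Ox cK) (le_trans _ (hC K TK))// hc.
have [C hC] := vC.
have mv : measurable_fun Omega v.
  by apply: continuous_measurable_rV => // x /set_mem; exact: in_S_continuous.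
have Lv : in_L2 Omega v by apply: (bounded_L2 oO finO mv hC).
split=> // i.
pose U := Omega `&` \bigcup_(K in T) K.
have oU : open U.
  by apply: openI => //; apply: bigcup_open => K TK; exact: open_mesh_cell.
have near_partial K y : T K -> K y -> \near y, partial i (q K) y = partial i v y.
  move=> TK Ky; have [pq vq] := hq K TK.
  have := open_nbhs_nbhs (conj (open_mesh_cell TK) Ky).
  apply: filterS => z Kz; apply: near_eq_derive.
  exact: in_S_on TK vq _ Kz.
(* On the facets the derivative may be junk, so it is replaced by 0 there, which keeps [g] bounded
   and measurable. *)
pose g := (partial i v) \_ U.
have gU y : U y -> g y = partial i v y by move=> Uy; rewrite /g patchE mem_set.
have mg : measurable_fun Omega g.
  apply/measurable_restrict => //; first exact: open_measurable_rV.
  have -> : Omega `&` U = U by rewrite /U setIA setIid.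
  apply: continuous_measurable_rV => // y /set_mem [Oy [K TK Ky]].
  have h := near_partial K y TK Ky.
  rewrite /prop_for /continuous_at -(nbhs_singleton h).
  apply: cvg_trans (near_eq_cvg h) _.
  by apply: smooth_continuous; apply: smooth_partial; exact: sq.
have [D hD] : exists C, forall x, Omega x -> `|g x| <= C.
  have /choice[c hc] : forall K, exists c, T K -> forall x, Omega x -> `|partial i (q K) x| <= c.
    move=> K; have [TK|nT] := pselect (T K); last by exists 0.
    have [c hc] := continuous_bounded_domain OM (smooth_continuous (smooth_partial i (sq K TK))).
    by exists c.
  have [D hD] := mesh_bound c; exists (Num.max 0 D) => x Ox.
  rewrite /g patchE; case: ifPn => [/set_mem[_ [K TK Kx]]|_]; last first.
    by rewrite normr0 le_max lexx.
  rewrite -(nbhs_singleton (near_partial K x TK Kx)) le_max.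
  by rewrite (le_trans (hc K TK x Ox) (hD K TK)) orbT.
exists g; first exact: (bounded_L2 oO finO mg hD).
have [hs [hs0 hsT]] := mesh_facets.
(* The facet planes parallel to the axis [i]; [N] collects the base points of the lines contained in
   one of them. *)
pose L := [seq h : Rd * R <- hs | h.1 0 i == 0].
pose N : set 'rV[R]_n := \bigcup_(h in [set` L] : set (Rd * R))
  [set x | \sum_k h.1 0 (lift i k) * x 0 k = h.2].
apply: (@weak_partial_lines R n Omega M oO OM i v g (Num.max C D) N) => //.
- by move=> x Ox; exact: in_S_continuous.
- by move=> x Ox; rewrite le_max hC.
- by move=> x Ox; rewrite le_max hD// orbT.
- rewrite /N bigcup_seq big_seq; elim/big_ind : _.
  + exact: negligible_set0.
  + by move=> A B; exact: negligibleU.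
  + move=> h; rewrite mem_filter => /andP[/eqP hi0 hhs].
    have [k hk] : exists k, h.1 0 (lift i k) != 0.
      apply: contrapT => hk; move/eqP: (hs0 h hhs); apply.
      apply/rowP => j; rewrite mxE; have [k ->|->] := unliftP i j => //.
      by apply: contrapT => /eqP hk'; apply: hk; exists k.
    have [mP P0] := @hyperplane_null R n (fun k => h.1 0 (lift i k)) h.2 k hk.
    by apply/negligibleP.
move=> x nN.
(* The parameters at which the line through [x] crosses the planes. For planes in [L] the division
   by zero gives a harmless extra point. *)
exists [seq (h.2 - \sum_k h.1 0 (lift i k) * x 0 k) / h.1 0 i | h : Rd * R <- hs] => t ts Oy.
have [K TK Ky] : exists2 K, T K & K (ins i t x).
  apply: hsT => // h hhs; rewrite /plane/= (bigD1_ord i)//= ins_same.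
  under eq_bigr do rewrite ins_lift.
  have [hi0|hi0] := eqVneq (h.1 0 i) 0.
    rewrite hi0 mul0r add0r => hx; apply: nN; exists h => //=.
    by rewrite mem_filter hi0 eqxx.
  move=> hx; move/negP: ts; apply; apply/mapP; exists h => //.
  by rewrite -hx addrK mulrC mulKf.
have [pq vq] := hq K TK.
have ci := @continuous_ins R n i x t.
have nv : \near t, q K (ins i t x) = v (ins i t x).
  exact: ci _ (in_S_on TK vq Ky).
have dq : derivable (fun r : R => q K (ins i r x)) t 1.
  by apply: derivable_ins; apply: smooth_differentiable; exact: sq.
have [d1 d2] := near_eq_is_derive nv (derivableP dq).
have Uy : U (ins i t x) by split=> //; exists K.
have ng : \near t, partial i (q K) (ins i t x) = g (ins i t x).
  have h1 := ci _ (near_partial K _ TK Ky).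
  have h2 := ci _ (open_nbhs_nbhs (conj oU Uy)).
  near=> r; rewrite gU; first by near: r; exact: h1.
  by near: r; exact: h2.
split=> //.
- by rewrite d2 derive_ins (nbhs_singleton ng).
- rewrite /prop_for /continuous_at -(nbhs_singleton ng).
  apply: cvg_trans (near_eq_cvg ng) _.
  apply: (@continuous_comp _ _ _ (fun r => ins i r x) (partial i (q K))); first exact: ci.
  by apply: smooth_continuous; apply: smooth_partial; exact: sq.
Unshelve. all: by end_near.
Qed.

Lemma continuous_at_lin a (u v : Rd -> R) x : {for x, continuous u} -> {for x, continuous v} ->
  {for x, continuous (a *: u + v)}.
Proof.
move=> cu cv; apply: continuousD => //.
by apply: continuousZl_tmp.
Qed.

Lemma in_S_subspace : subspace_of (in_S Omega T p : set (Rd -> R)).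
Proof.
split.
  split; first by rewrite continuous_open_subspace// => x _; exact: (@cst_continuous Rd R 0).
  move=> K TK; exists (cst 0) => //; apply/is_polynomialP; exists (fun=> 0).
  by apply/funext => x; rewrite /poly_eval big1// => e _; rewrite mul0r.
move=> a u v Su Sv; split.
  rewrite continuous_open_subspace// => x /set_mem Ox.
  exact: continuous_at_lin (in_S_continuous Su Ox) (in_S_continuous Sv Ox).
move=> K TK; have [_ /(_ K TK) [q pq uq]] := Su; have [_ /(_ K TK) [r pr vr]] := Sv.
exists (a *: q + r); first exact: is_polynomial_lin.
by move=> x Kx; rewrite /= -[LHS]/(a * u x + v x) uq// vr.
Qed.

(* More functions than coefficients on the cells are linearly dependent on Omega. *)
Lemma in_S_finite_dim (B : (Rd -> R) -> (Rd -> R) -> R) :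
  semi_inner (in_S Omega T p) B ->
  (forall u, in_S Omega T p u -> (forall x, Omega x -> u x = 0) -> B u u = 0) ->
  exists N, forall k (f : 'I_k -> Rd -> R), orthonormal (in_S Omega T p) B f -> (k <= N)%N.
Proof.
move=> hB B0; have hS := in_S_subspace.
have /finite_seqP[s Ts] := finT.
pose expo := {ffun 'I_n.+1 -> 'I_p.+1}.
pose I : finType := ('I_(size s) * expo)%type.
pose cell (j : 'I_(size s)) : set Rd := nth set0 s j.
have Tcell j : T (cell j) by rewrite Ts /= mem_nth.
exists #|I| => k f [Sf fo]; rewrite leqNgt; apply/negP => Ik.
have /choice[c hc] : forall i, exists c : 'I_(size s) -> expo -> R,
    forall j x, cell j x -> f i x = poly_eval (c j) x.
  move=> i; have /choice[c hc] : forall j, exists c : expo -> R,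
      forall x, cell j x -> f i x = poly_eval c x.
    move=> j; have [_ /(_ _ (Tcell j)) [q /is_polynomialP[c ->] fc]] := Sf i.
    by exists c.
  by exists c.
pose A : 'M[R]_(k, #|I|) := \matrix_(i, l) c i (enum_val l).1 (enum_val l).2.
(* The coefficient matrix has more rows than columns, so some nontrivial combination of the family
   has zero coefficients on every cell. *)
have [t /sub_kermxP tA t0] : exists2 t : 'rV_k, (t <= kermx A)%MS & t != 0.
  have : kermx A != 0.
    rewrite kermx_eq0; apply: contraL Ik => /eqP fA; rewrite -leqNgt -fA.
    exact: rank_leq_col.
  by move=> /rowV0Pn[t tk t0]; exists t.
pose u := \sum_i t 0 i *: f i.
have Su : in_S Omega T p u by apply: (subspace_sum hS (fun i => t 0 i)).
have uE x : u x = \sum_i t 0 i * f i x by rewrite /u fct_sumE.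
have u0 x : Omega x -> u x = 0.
  move=> Ox; have [K TK cK] := mesh_covered Ox.
  have [j Kj] : exists j, K = cell j.
    move: TK; rewrite Ts /= => Ks; have js : (index K s < size s)%N by rewrite index_mem.
    by exists (Ordinal js); rewrite /cell /= nth_index.
  rewrite (@in_S_closure u K (cst 0) x Su _ _ Ox cK)//.
    apply/is_polynomialP; exists (fun=> 0).
    by apply/funext => y; rewrite /poly_eval big1// => e _; rewrite mul0r.
  move=> y Ky; rewrite uE; rewrite Kj in Ky.
  under eq_bigr do rewrite (hc _ _ _ Ky) /poly_eval mulr_sumr.
  rewrite exchange_big/= big1// => e _.
  under eq_bigr do rewrite mulrA.
  rewrite -mulr_suml (_ : \sum_i _ = 0) ?mul0r//.
  move/rowP: tA => /(_ (enum_rank (j, e))); rewrite !mxE => tA; rewrite -[RHS]tA.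
  by apply: eq_bigr => i _; rewrite mxE enum_rankK.
move/eqP: t0; apply; apply/rowP => i; rewrite mxE.
have := form_eq0 hS hB Su (Sf i) (B0 u Su u0).
rewrite (linear_on_sum hS (form_linl hB (Sf i)) (fun i => t 0 i) Sf).
rewrite (bigD1 i)//= fo eqxx mulr1 big1 ?addr0// => j ji.
by rewrite fo (negbTE ji) mulr0.
Qed.

Lemma riesz_in_S (Y : set (Rd -> R)) (B : (Rd -> R) -> (Rd -> R) -> R) :
  Y `<=` in_S Omega T p -> subspace_of Y -> semi_inner (in_S Omega T p) B ->
  (forall u, in_S Omega T p u -> (forall x, Omega x -> u x = 0) -> B u u = 0) ->
  riesz Y B.
Proof.
move=> YS hY hB B0; have [N hN] := in_S_finite_dim hB B0.
apply: (@riesz_finite_dim R _ Y B N) => //; first exact: semi_innerS hB.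
by move=> k f [Yf fo]; apply: hN; split=> // i; exact: YS.
Qed.

(** The zero function is a weak derivative of [u], whatever [u] does outside [Omega]. *)
Lemma H1_form_eq0_on u : in_H1 Omega u -> (forall x, Omega x -> u x = 0) ->
  ip Omega u u = 0 /\ grad_ip Omega u u = 0.
Proof.
move=> Hu u0.
have ip0 g : ip Omega u g = 0.
  rewrite /ip (@eq_Rintegral _ _ _ mu Omega (cst 0)) ?Rintegral_cst ?mul0r//.
  by move=> x /set_mem Ox; rewrite u0// mul0r.
split=> //; rewrite /grad_ip big1// => i _.
have hL := @in_L2_subspace R n Omega oO.
have L0 : in_L2 Omega (0 : Rd -> R) by exact: subspace0 hL.
have ip0l g : ip Omega (0 : Rd -> R) g = 0.
  rewrite /ip (@eq_Rintegral _ _ _ mu Omega (cst 0)) ?Rintegral_cst ?mul0r//.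
  by move=> x _; rewrite mul0r.
rewrite (@ip_weak_partialE R n Omega oO finO i u 0)//.
by move=> phi tp; rewrite ip0 ip0l oppr0.
Qed.

End mesh.

(** * Integration against the Hausdorff measure *)

(* The Hausdorff measure is only an outer measure on the sets considered here, so
   its integral is a supremum over simple functions without additivity; the
   consequences of subadditivity below are all that is needed of it. *)
Section outer_integral.
Import HBNNSimple.
Context d (T : measurableType d) (R : realType) (m : set T -> \bar R) (D : set T).
Hypothesis m0 : m set0 = 0%E.
Hypothesis m_ge0 : forall A, (0 <= m A)%E.
Hypothesis m_le : forall A B, A `<=` B -> (m A <= m B)%E.
Hypothesis m_sub : forall A B, (m (A `|` B) <= m A + m B)%E.
Implicit Types (f g : T -> R) (h : {nnsfun T >-> R}).

Lemma outer_sintegral_term_ge0 h r : (0 <= r%:E * m (h @^-1` [set r]))%E.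
Proof.
have [r0|r0] := leP 0 r; first by rewrite mule_ge0.
rewrite (_ : h @^-1` [set r] = set0) ?m0 ?mule0//.
by apply/seteqP; split=> // x /= hx; move: r0; rewrite -hx ltNge fun_ge0.
Qed.

Lemma outer_sintegral_ge0 h : (0 <= sintegral m h)%E.
Proof. by apply: fsume_ge0 => r _; exact: outer_sintegral_term_ge0. Qed.

Lemma outer_sup_eq0 (f : T -> \bar R) : (forall x, f x = 0%E) ->
  ereal_sup [set sintegral m h | h in [set h : {nnsfun T >-> R} |
    forall x, ((h x)%:E <= f x)%E]] = 0%E.
Proof.
move=> f0; apply/eqP; rewrite eq_le; apply/andP; split.
  apply: ge_ereal_sup => _ [h /= h0 <-].
  apply: fsume_le0 => r _; have [->|r0] := eqVneq r 0; first by rewrite mul0e.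
  rewrite (_ : h @^-1` [set r] = set0) ?m0 ?mule0//.
  apply/seteqP; split=> // x /= hx; move/eqP: r0; apply.
  have := h0 x; rewrite f0 lee_fin => h0x.
  by apply/eqP; rewrite eq_le -hx fun_ge0 h0x.
apply: le_trans (ereal_sup_ubound _); last by exists nnsfun0 => // x /=; rewrite f0.
exact: outer_sintegral_ge0.
Qed.

Lemma outer_integralE f : (forall x, D x -> 0 <= f x) ->
  (\int[m]_(x in D) (f x)%:E = ereal_sup [set sintegral m h |
     h in [set h : {nnsfun T >-> R} | forall x, ((h x)%:E <= ((f \_ D) x)%:E)%E]])%E.
Proof.
move=> f0.
have fD0 x : 0 <= (f \_ D) x by rewrite patchE; case: ifPn => // /set_mem /f0.
rewrite /integral restrict_EFin.
have -> : ((EFin \o f \_ D)^\+)%E = EFin \o f \_ D.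
  by apply/funext => x; rewrite funeposE /= max_l// lee_fin.
have -> : ((EFin \o f \_ D)^\-)%E = cst 0%E.
  by apply/funext => x; rewrite funenegE /= max_r// lee_fin oppr_le0.
by rewrite (outer_sup_eq0 (f := cst 0%E)) ?oppe0 ?adde0.
Qed.

Lemma outer_integral_eq0 f : (forall x, D x -> f x = 0) -> (\int[m]_(x in D) (f x)%:E = 0)%E.
Proof.
move=> f0; rewrite outer_integralE; last by move=> x /f0 ->.
by apply: outer_sup_eq0 => x; rewrite patchE; case: ifPn => // /set_mem /f0 ->.
Qed.

Lemma outer_integral_ge0 f : (forall x, D x -> 0 <= f x) -> (0 <= \int[m]_(x in D) (f x)%:E)%E.
Proof.
move=> f0; rewrite outer_integralE//; apply: le_trans (ereal_sup_ubound _); last first.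
  by exists nnsfun0 => // x /=; rewrite lee_fin patchE; case: ifPn => // /set_mem /f0.
exact: outer_sintegral_ge0.
Qed.

(** The factor [c] undoes the scaling. Summing over the range of [h] lets the contributions of [A]
    and of its complement be compared term by term. *)
Lemma outer_sintegral_proj_scale h (A : set T) (mA : measurable A) (c : R) (c0 : 0 < c)
    (ci : 0 <= c^-1) :
  (c%:E * sintegral m (scale_nnsfun (proj_nnsfun h mA) ci) =
   \sum_(r \in range h) r%:E * m ([set x | A x /\ h x = r]))%E.
Proof.
rewrite /sintegral ge0_mule_fsumr; last exact: outer_sintegral_term_ge0.
rewrite (reindex_fsbigT (fun r : R => c^-1 * r))/=; last first.
  by exists (fun r => c * r) => r; [rewrite mulVKf ?gt_eqF|rewrite mulKf ?gt_eqF].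
have step r : (c%:E * ((c^-1 * r)%:E * m (scale_nnsfun (proj_nnsfun h mA) ci @^-1` [set (c^-1 * r)%R]))
    = r%:E * m ([set x | A x /\ h x = r]))%E.
  rewrite muleA -EFinM mulVKf ?gt_eqF//.
  have [->|r0] := eqVneq r 0; first by rewrite !mul0e.
  congr (_ * m _)%E; apply/seteqP; split=> x /=.
    move=> /mulfI => /(_ ltac:(by rewrite invr_neq0 ?gt_eqF)).
    rewrite mindicE; case: (boolP (x \in A)) => [/set_mem Ax|_]; first by rewrite mulr1.
    by rewrite mulr0 => /esym/eqP; rewrite (negbTE r0).
  by move=> [Ax <-]; rewrite mindicE mem_set// mulr1.
rewrite (eq_fsbigr (fun r => r%:E * m ([set x | A x /\ h x = r]))%E); last by move=> r _; exact: step.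
apply/esym; apply: fsbig_widen => // r [_ /= nr].
rewrite (_ : [set x | _] = set0) ?m0 ?mule0//.
by apply/seteqP; split=> // x /= [_ hx]; apply: nr; exists x.
Qed.

(** Substitute for additivity: a simple function below [F] is cut along the measurable set where
    [g <= f]; the two pieces lie below [c f] and [c g], and subadditivity on each level set
    recombines them. *)
Lemma outer_integral_max f g F (c : R) : 0 < c ->
  measurable_fun setT f -> measurable_fun setT g ->
  (forall x, D x -> 0 <= f x) -> (forall x, D x -> 0 <= g x) ->
  (forall x, D x -> 0 <= F x <= c * Num.max (f x) (g x)) ->
  (\int[m]_(x in D) (F x)%:E <= c%:E * (\int[m]_(x in D) (f x)%:E + \int[m]_(x in D) (g x)%:E))%E.
Proof.
move=> c0 mf mg f0 g0 Fc.
rewrite !outer_integralE//; last by move=> x /Fc/andP[].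
apply: ge_ereal_sup => _ [h /= hF <-].
pose A := [set x | g x <= f x].
have mA : measurable A.
  by rewrite /A -[X in measurable X]setTI; exact: measurable_fun_le.
have mA' : measurable (~` A) by exact: measurableC.
have ci : 0 <= c^-1 by rewrite invr_ge0 ltW.
pose h1 := scale_nnsfun (proj_nnsfun h mA) ci.
pose h2 := scale_nnsfun (proj_nnsfun h mA') ci.
have hle x : D x -> c^-1 * h x <= Num.max (f x) (g x).
  move=> Dx; have := hF x; rewrite lee_fin patchE mem_set// => hx.
  rewrite ler_pdivrMl//; apply: le_trans hx _.
  by have /andP[] := Fc x Dx.
have hD x : ~ D x -> h x = 0.
  move=> nD; have := hF x; rewrite lee_fin patchE memNset// => hx.
  by apply/eqP; rewrite eq_le fun_ge0 hx.
apply: (@le_trans _ _ (c%:E * (sintegral m h1 + sintegral m h2))%E); last first.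
  rewrite lee_pmul2l//; apply: leeD; apply: ereal_sup_ubound.
    exists h1 => // x /=; rewrite lee_fin patchE mindicE.
    case: (boolP (x \in D)) => [/set_mem Dx|/negP nD]; last first.
      by rewrite hD ?mul0r ?mulr0// => Dx; apply: nD; exact: mem_set.
    case: (boolP (x \in A)) => [/set_mem Ax|_]; last by rewrite !mulr0 f0.
    by rewrite mulr1 (le_trans (hle x Dx))// max_l.
  exists h2 => // x /=; rewrite lee_fin patchE mindicE.
  case: (boolP (x \in D)) => [/set_mem Dx|/negP nD]; last first.
    by rewrite hD ?mul0r ?mulr0// => Dx; apply: nD; exact: mem_set.
  case: (boolP (x \in ~` A)) => [/set_mem Ax|_]; last by rewrite !mulr0 g0.
  by rewrite mulr1 (le_trans (hle x Dx))// max_r//; apply/ltW; rewrite ltNge; exact/negP.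
rewrite ge0_muleDr ?outer_sintegral_ge0//.
rewrite !outer_sintegral_proj_scale// -fsbig_split//=.
rewrite /sintegral -(fsbig_widen (range h))//; last first.
  move=> r [_ /= nr]; rewrite (_ : h @^-1` [set r] = set0) ?m0 ?mule0//.
  by apply/seteqP; split=> // x /= hx; apply: nr; exists x.
apply: lee_fsum => // r [y _ <-].
rewrite -ge0_muleDr//; apply: lee_pmul => //; first by rewrite lee_fin fun_ge0.
apply: le_trans (m_sub _ _); apply: m_le => x /= hx.
by have [Ax|nA] := pselect (A x); [left|right].
Qed.

(** The simple function with value [a j] on [A j] lies below [f]. Distinct values allow its
    integral, a sum over values, to be indexed by [j]. *)
Lemma outer_integral_simple f N (A : 'I_N -> set T) (a : 'I_N -> R) :
  (forall x, D x -> 0 <= f x) -> (forall j, measurable (A j)) ->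
  (forall j, 0 <= a j) -> injective a ->
  (forall j, A j `<=` D) -> (forall i j x, A i x -> A j x -> i = j) ->
  (forall j x, A j x -> a j <= f x) ->
  (\sum_j (a j)%:E * m (A j) <= \int[m]_(x in D) (f x)%:E)%E.
Proof.
move=> f0 mA a0 ai AD Adis Af.
case: N A a mA a0 ai AD Adis Af => [|N] A a mA a0 ai AD Adis Af.
  rewrite big_ord0; exact: outer_integral_ge0.
pose u (j : nat) : {nnsfun T >-> R} :=
  scale_nnsfun (indic_nnsfun R (mA (inord j))) (a0 (inord j)).
pose h := sum_nnsfun u N.+1.
have hE x : h x = \sum_(j < N.+1) a j * \1_(A j) x.
  rewrite /h sum_nnsfunE; apply: eq_bigr => j _.
  by rewrite /u /= inord_val mindicE.
have hA j x : A j x -> h x = a j.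
  move=> Ajx; rewrite hE (bigD1 j)//= indicE mem_set// mulr1 big1 ?addr0// => i ij.
  rewrite indicE memNset ?mulr0// => Aix.
  by move/eqP: ij; apply; exact: Adis Aix Ajx.
have hn x : (forall j, ~ A j x) -> h x = 0.
  by move=> nA; rewrite hE big1// => j _; rewrite indicE memNset ?mulr0.
rewrite outer_integralE//; apply: le_trans (ereal_sup_ubound _); last first.
  exists h => // x /=; rewrite lee_fin; have [[j Ajx]|nA] := pselect (exists j, A j x).
    by rewrite (hA j x Ajx) patchE mem_set ?Af//; exact: AD Ajx.
  rewrite hn; last by move=> j Ajx; apply: nA; exists j.
  by rewrite patchE; case: ifPn => // /set_mem /f0.
rewrite /sintegral -(@fsbig_widen _ _ _ _ (a @` setT))//; last first.
  move=> r [_ /= nr]; have [->|r0] := eqVneq r 0; first by rewrite mul0e.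
  rewrite (_ : h @^-1` [set r] = set0) ?m0 ?mule0//.
  apply/seteqP; split=> // x /= hx.
  have [[j Ajx]|nA] := pselect (exists j, A j x).
    by apply: nr; exists j => //; rewrite -hx (hA j x).
  by move: r0; rewrite -hx hn ?eqxx// => j Ajx; apply: nA; exists j.
rewrite fsbig_image//; last by move=> i j _ _; exact: ai.
rewrite [leLHS]fsbig_seq ?index_enum_uniq//.
rewrite (_ : [set` index_enum 'I_N.+1] = setT); last first.
  by apply/seteqP; split=> // j _ /=; rewrite mem_index_enum.
apply: lee_fsum; first exact: finite_finset.
move=> j _; apply: lee_wpmul2l; first by rewrite lee_fin.
by apply: m_le => x Ajx /=; rewrite (hA j).
Qed.

End outer_integral.

(** * Hausdorff measure and its behaviour under projection *)

Section hausdorff_measure.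
Context (R : realType) (n s : nat).
Implicit Types (A B : set 'rV[R]_n).

Lemma enorm_coord (x : 'rV[R]_n) i : `|x 0 i| <= enorm x.
Proof.
rewrite -sqrtr_sqr; apply: ler_wsqrtr.
rewrite (bigD1 i)//= lerDl; apply: sumr_ge0 => j _; exact: sqr_ge0.
Qed.

Lemma ediam_ge0 A : (0 <= ediam A)%E.
Proof. by apply: ereal_sup_ubound; left. Qed.

Lemma ediam_coord A x y i : A x -> A y -> (`|x 0 i - y 0 i|%:E <= ediam A)%E.
Proof.
move=> Ax Ay; apply: (@le_trans _ _ (enorm (x - y))%:E).
  by rewrite lee_fin (le_trans _ (enorm_coord _ i))// !mxE.
by apply: ereal_sup_ubound; right; exists (x, y).
Qed.

Lemma hausdorff_gauge0 delta : @hausdorff_gauge R n s delta set0 = 0%E.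
Proof. by rewrite /hausdorff_gauge eqxx. Qed.

Lemma hausdorff_gauge_ge0 delta A : (0 <= hausdorff_gauge s delta A)%E.
Proof.
rewrite /hausdorff_gauge; case: ifPn => // _; case: ifPn => // _.
by rewrite expe_ge0// ediam_ge0.
Qed.

Let ge0 := hausdorff_gauge_ge0.
Let g0 := hausdorff_gauge0.

Lemma hausdorff_ge0 A : (0 <= hausdorff s A)%E.
Proof.
apply: (@le_trans _ _ (mu_ext (hausdorff_gauge s 1) A)).
  exact: mu_ext_ge0 (ge0 1) A.
by apply: ereal_sup_ubound; exists 1 => //=.
Qed.

Lemma hausdorff0 : @hausdorff R n s set0 = 0%E.
Proof.
apply/eqP; rewrite eq_le hausdorff_ge0 andbT.
apply: ge_ereal_sup => _ [e /= e0 <-].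
by rewrite (mu_ext0 (g0 e) (ge0 e)).
Qed.

Lemma le_hausdorff A B : A `<=` B -> (hausdorff s A <= hausdorff s B)%E.
Proof.
move=> AB; apply: ge_ereal_sup => _ [e /= e0 <-].
apply: (@le_trans _ _ (mu_ext (hausdorff_gauge s e) B)); first exact: le_mu_ext.
by apply: ereal_sup_ubound; exists e.
Qed.

Lemma hausdorffU A B : (hausdorff s (A `|` B) <= hausdorff s A + hausdorff s B)%E.
Proof.
apply: ge_ereal_sup => _ [e /= e0 <-].
pose m : {outer_measure set 'rV[R]_n -> \bar R} :=
  HB.pack (mu_ext (hausdorff_gauge s e)) (isOuterMeasure.Build R _
    (mu_ext (hausdorff_gauge s e)) (mu_ext0 (g0 e) (ge0 e)) (mu_ext_ge0 (ge0 e))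
    (@le_mu_ext _ _ R (hausdorff_gauge s e)) (mu_ext_sigma_subadditive (ge0 e))).
apply: le_trans (outer_measureU2 m A B) _.
by apply: leeD; apply: ereal_sup_ubound; exists e.
Qed.

End hausdorff_measure.

Section projection.
Context (R : realType) (n : nat).
Local Notation Rn := 'rV[R]_n.
Local Notation Rd := 'rV[R]_n.+1.

(** A set of diameter [D] projects into a cube of side [2 D] centred at the projection of any of its
    points, whence 2^n D^n. When the gauge is infinite, the whole space does. *)
Lemma gauge_projection (A : set Rd) : exists B : set Rn, [/\ measurable B,
  forall y, A y -> B (col' 0 y)
  & (lebesgue_rV R n B <= (2 ^+ n)%:E * hausdorff_gauge n 1 A)%E].
Proof.
rewrite /hausdorff_gauge; case: eqP => [->|/eqP/set0P[e Ae]].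
  exists set0; split=> //; by rewrite measure0 mule0.
case: ifPn => [dA|_]; last first.
  exists setT; split=> //; by rewrite gt0_muley ?leey// lte_fin exprn_gt0.
have [D dE] : exists D : R, ediam A = D%:E.
  exists (fine (ediam A)); rewrite fineK// ge0_fin_numE ?ediam_ge0//.
  exact: le_lt_trans dA (ltry _).
have D0 : 0 <= D by rewrite -lee_fin -dE ediam_ge0.
pose I (j : 'I_n) : set (measurableTypeR R) :=
  `[e 0 (lift 0 j) - D, e 0 (lift 0 j) + D]%classic.
exists [set x | forall j, I j (x 0 j)]; split.
- by apply: measurable_rV_box => j; exact: measurable_itv.
- move=> y Ay j; rewrite /I /= !mxE in_itv /=.
  have := ediam_coord (lift 0 j) Ay Ae; rewrite dE lee_fin ler_distl.
  by move=> /andP[h1 h2]; rewrite h1 h2.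
- rewrite lebesgue_rV_box; last by move=> j; exact: measurable_itv.
  rewrite (eq_bigr (fun=> (2 * D)%:E)); last first.
    move=> j _; rewrite lebesgue_measure_itv /= lte_fin.
    case: ltP => h; first by rewrite -EFinD; congr EFin; ring.
    by congr EFin; lra.
  by rewrite dE prodEFin prodr_const card_ord exprMn EFinM -EFin_expe.
Qed.

(** The projection of [E] itself need not be measurable; [B] is the union of the boxes of a covering
    that is optimal up to [delta]. *)
Lemma hausdorff_projection (E : set Rd) (delta : R) : (hausdorff n E < +oo)%E -> 0 < delta ->
  exists B : set Rn, [/\ measurable B, forall y, E y -> B (col' 0 y)
    & (lebesgue_rV R n B <= (2 ^+ n)%:E * (hausdorff n E + delta%:E))%E].
Proof.
move=> Eoo d0.
have le1 : (mu_ext (hausdorff_gauge n 1) E <= hausdorff n E)%E.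
  by apply: ereal_sup_ubound; exists 1 => //=.
have fin1 : mu_ext (hausdorff_gauge n 1) E \is a fin_num.
  rewrite ge0_fin_numE; first exact: le_lt_trans le1 Eoo.
  exact: mu_ext_ge0 (hausdorff_gauge_ge0 n 1) E.
have [_ [A [mA EA] <-] Alt] := lb_ereal_inf_adherent d0 fin1.
have [B hB] := choice (fun k => gauge_projection (A k)).
exists (\bigcup_k B k); split.
- by apply: bigcupT_measurable => k; have [] := hB k.
- by move=> y /EA[k _ Aky]; exists k => //; have [_ h _] := hB k; exact: h.
have mB k : measurable (B k) by have [] := hB k.
apply: (le_trans (generalized_Boole_inequality (lebesgue_rV R n) mB (bigcupT_measurable _ mB))).
apply: (@le_trans _ _ (\sum_(k <oo) (2 ^+ n)%:E * hausdorff_gauge n 1 (A k))%E).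
  by apply: lee_nneseries => // k _; have [_ _] := hB k.
rewrite nneseriesZl; last by move=> k _; exact: hausdorff_gauge_ge0.
rewrite lee_pmul2l ?lte_fin ?exprn_gt0//.
apply: le_trans (ltW Alt) _; exact: leeD.
Qed.

End projection.

(** * The trace and the Poincare inequality *)

Section boundary.
Context (R : realType) (n : nat) (Omega : set 'rV[R]_n.+1) (M : nat).
Context (oO : open Omega) (OM : Omega `<=` @cube R n.+1 M).
Local Notation Rn := 'rV[R]_n.
Local Notation Rd := 'rV[R]_n.+1.
Local Notation mu := (lebesgue_rV R n.+1).
Local Notation mu1 := (@lebesgue_measure R).
Local Notation Gam := (boundary Omega).
Implicit Types (w : Rd -> R).

Lemma boundaryE : Gam = closure Omega `\` Omega.
Proof. by rewrite /boundary (proj1 (interior_id Omega) oO). Qed.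

Lemma measurable_boundary : measurable Gam.
Proof.
rewrite boundaryE setDE; apply: measurableI.
  rewrite -[closure _]setCK; apply: measurableC; apply: open_measurable_rV.
  by rewrite openC; exact: closed_closure.
by apply: measurableC; exact: open_measurable_rV.
Qed.

Lemma boundary_closed_cube : Gam `<=` (closed_box (fun=> - M%:R) (fun=> M%:R) : set Rd).
Proof.
have /closure_id -> : closed (closed_box (fun=> - M%:R) (fun=> M%:R) : set Rd).
  by apply: compact_closed; [exact: norm_hausdorff|exact: closed_box_compact].
by rewrite boundaryE => x [Ox _]; exact: (closure_subset (@domain_closed_cube _ _ _ _ OM)).
Qed.

Lemma sub_boundary_bounded w : continuous w -> exists C, forall y, Gam y -> `|w y| <= C.
Proof.
move=> cw; have [C hC] := continuous_compact_bounded (@closed_cube_compact R n M) (fun x _ => cw x).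
by exists C => y /boundary_closed_cube; exact: hC.
Qed.

Local Notation I w := (\int[hausdorff n]_(x in Gam) ((w x) ^+ 2)%:E)%E.

(* Layer cake: the slab of Gam where [w^2] lies in [[j e, (j+1) e)] projects into
   a set of Lebesgue measure controlled by its Hausdorff measure. *)
Lemma boundary_majorant w (e : R) : smooth w -> (I w < +oo)%E -> 0 < e ->
  exists G : Rn -> R, [/\ measurable_fun setT G, forall x, 0 <= G x,
    forall y, Gam y -> w y ^+ 2 <= G (col' 0 y)
  & (\int[lebesgue_rV R n]_(x in cube M) (G x)%:E <=
      e%:E * (1 + lebesgue_rV R n (cube M)) + (2 ^+ n)%:E * I w)%E].
Proof.
move=> sw Ioo e0.
have cw := smooth_continuous sw.
have [C hC] := sub_boundary_bounded cw.
have mw2 : measurable_fun setT (fun x => w x ^+ 2).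
  by apply: measurable_funX; exact: smooth_measurable.
(* On the boundary w^2 <= C^2, so the slabs 0, ..., N of height [e] cover its range. *)
pose N := (Num.trunc (C ^+ 2 / e)).
have hN y : Gam y -> w y ^+ 2 < N.+1%:R * e.
  move=> /hC h; rewrite -ltr_pdivrMr//; apply: le_lt_trans (truncnS_gt _).
  by rewrite ler_pM2r ?invr_gt0// -[w y ^+ 2]ger0_norm ?sqr_ge0// normrX lerXn2r//
    nnegrE (le_trans (normr_ge0 _) h).
pose a (j : 'I_N.+1) : R := j%:R * e.
have a0 j : 0 <= a j by rewrite mulr_ge0// ltW.
have aE j : a j + e = j.+1%:R * e by rewrite /a -natr1 mulrDl mul1r.
pose A (j : 'I_N.+1) := Gam `&` [set y | a j <= w y ^+ 2 < a j + e].
have mA j : measurable (A j).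
  apply: measurableI; first exact: measurable_boundary.
  rewrite (_ : [set y | _] = (fun x => w x ^+ 2) @^-1` `[a j, a j + e[%classic); last first.
    by apply/seteqP; split=> x; rewrite /= in_itv.
  by rewrite -[X in measurable X]setTI; apply: mw2.
have ai : injective a.
  by move=> i j /(mulIf (lt0r_neq0 e0)) /eqP; rewrite eqr_nat => /eqP /val_inj.
have AI : (\sum_j (a j)%:E * hausdorff n (A j) <= I w)%E.
  apply: outer_integral_simple => //.
  - exact: hausdorff0.
  - exact: hausdorff_ge0.
  - by move=> *; exact: le_hausdorff.
  - by move=> x _; exact: sqr_ge0.
  - by move=> j x [].
  - move=> i j x [_ /= /andP[h1 h2]] [_ /= /andP[h3 h4]].
    have lt1 (k l : 'I_N.+1) : a k < a l + e -> (k <= l)%N.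
      by rewrite aE ltr_pM2r// ltr_nat ltnS.
    apply/val_inj/eqP; rewrite eqn_leq; apply/andP; split; apply: lt1.
      exact: le_lt_trans h1 h4.
    exact: le_lt_trans h3 h2.
  - by move=> j x [_ /= /andP[]].
have /choice[B hB] : forall j, exists B : set Rn, [/\ measurable B,
    forall y, A j y -> B (col' 0 y)
    & ((a j)%:E * lebesgue_rV R n B <=
       (2 ^+ n)%:E * ((a j)%:E * hausdorff n (A j)) + (e / N.+1%:R)%:E)%E].
  (* The lowest slab may have infinite Hausdorff measure, but its coefficient is 0; on higher slabs
     finiteness follows from that of the integral. *)
  move=> j; have [->|aj] := eqVneq (a j) 0.
    by exists setT; split=> //; rewrite !mul0e mule0 add0e lee_fin divr_ge0// ltW.
  have aj0 : 0 < a j by rewrite lt_neqAle eq_sym aj a0.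
  have Aoo : (hausdorff n (A j) < +oo)%E.
    rewrite ltey; apply/eqP => Aoo; move: Ioo; rewrite ltNge => /negP; apply.
    apply: le_trans AI; rewrite (bigD1 j)//= Aoo gt0_muley// addye ?leey//.
    rewrite gt_eqF// (@lt_le_trans _ _ 0%E)// sume_ge0// => i _.
    by apply: mule_ge0; [rewrite lee_fin|exact: hausdorff_ge0].
  (* After multiplication by [2 ^+ n * a j] this slack is [e / N.+1], hence [e] over all slabs. *)
  have d0 : 0 < e / N.+1%:R / (2 ^+ n * a j).
    by rewrite !divr_gt0// mulr_gt0// exprn_gt0.
  have [B [mB AB Ble]] := hausdorff_projection Aoo d0.
  exists B; split=> //; apply: le_trans (lee_wpmul2l _ Ble) _; first by rewrite lee_fin.
  rewrite (_ : (e / N.+1%:R)%:E = (2 ^+ n)%:E * ((a j)%:E *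
      (e / N.+1%:R / (2 ^+ n * a j))%:E))%E; last first.
    rewrite -!EFinM; congr EFin; field.
    by rewrite lt0r_neq0//= lt0r_neq0 ?exprn_gt0//= lt0r_neq0// ltr0n.
  by rewrite muleCA -!ge0_muleDr ?mule_ge0 ?hausdorff_ge0 ?lee_fin// ltW.
(* The constant [e] lifts [a j] to the upper edge of its slab. It accounts for the term with the
   measure of the cube, the slacks for the term 1. *)
exists (fun x => e + \sum_j a j * \1_(B j) x); split.
- apply: measurable_funD => //; apply: measurable_sum => j.
  by apply: measurable_funM => //; apply: measurable_indic; have [] := hB j.
- move=> x; apply: addr_ge0; first exact: ltW.
  by apply: sumr_ge0 => j _; rewrite mulr_ge0.
- move=> y Gy; have := hN y Gy; rewrite -ltr_pdivrMr// => lt1.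
  have jN : (Num.trunc (w y ^+ 2 / e) < N.+1)%N.
    by rewrite -(ltr_nat R); apply: le_lt_trans lt1; rewrite truncn_le divr_ge0 ?sqr_ge0// ltW.
  pose j : 'I_N.+1 := Ordinal jN.
  have Ajy : A j y.
    split=> //=; rewrite aE -ler_pdivlMr// -ltr_pdivrMr//.
    by rewrite truncn_le ?divr_ge0 ?sqr_ge0 ?ltW//= truncnS_gt.
  have [_ /(_ y Ajy) Bj _] := hB j.
  rewrite (bigD1 j)//= indicE mem_set// mulr1.
  case: Ajy => _ /= /andP[_ /ltW]; rewrite addrA [e + a j]addrC => h.
  apply: le_trans h _; rewrite lerDl sumr_ge0// => i _; by rewrite mulr_ge0.
have mcube := @measurable_open_box R n (fun=> - M%:R) (fun=> M%:R).
have mB j : measurable_fun (cube M) (EFin \o (fun x => a j * \1_(B j) x)).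
  apply/measurable_EFinP; apply: measurable_funTS; apply: measurable_funM => //.
  by apply: measurable_indic; have [] := hB j.
have B0 j x : (0 <= (a j * \1_(B j) x)%:E)%E by rewrite lee_fin mulr_ge0.
under eq_integral do rewrite EFinD -sumEFin.
rewrite ge0_integralD//; first last.
- exact: emeasurable_sum.
- by move=> x _; exact: sume_ge0.
- by move=> x _; rewrite lee_fin ltW.
rewrite (integral_cst _ mcube) ge0_integral_sum//.
rewrite muleDr// mule1 -addeA [X in (_ <= X)%E]addeCA; apply: leeD => //.
apply: (@le_trans _ _ (\sum_j ((2 ^+ n)%:E * ((a j)%:E * hausdorff n (A j)) + (e / N.+1%:R)%:E)%E)).
  apply: lee_sum => j _; have [mBj _ Bj] := hB j; apply: le_trans Bj.
  under eq_integral do rewrite EFinM.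
  rewrite ge0_integralZl_EFin//; last exact/measurable_EFinP/measurable_funTS/measurable_indic.
  rewrite integral_indic// lee_wpmul2l ?lee_fin// le_measure ?inE//; first exact: measurableI.
rewrite big_split /= -ge0_sume_distrr; last first.
  by move=> j _; apply: mule_ge0; [rewrite lee_fin|exact: hausdorff_ge0].
rewrite addeC; apply: leeD; last by rewrite lee_wpmul2l// lee_fin exprn_ge0.
rewrite sumEFin lee_fin sumr_const card_ord -[X in X <= _]mulr_natr divfK// pnatr_eq0.
Qed.


(** [a] is the supremum of the parameters below [t] where the line is outside [Omega]. Openness
    keeps that point outside, while points just above it are inside, so it lies on the boundary. *)
Lemma open_complement_below (x : Rn) : forall t, Omega (ins 0 t x) ->
  exists a : R, [/\ - M%:R <= a, a < t, t < M%:R, Gam (ins 0 a x)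
    & forall s, a < s <= t -> Omega (ins 0 s x)].
Proof.
move=> t Ot.
have inM s : Omega (ins 0 s x) -> - M%:R < s < M%:R.
  by move=> /OM /(_ 0); rewrite in_itv /= ins_same.
pose S := [set s : R | s <= t /\ ~ Omega (ins 0 s x)].
have S0 : S (- M%:R).
  split; first by have /andP[/ltW] := inM t Ot.
  by move=> /inM; rewrite ltxx.
have Ssup : has_sup S by split; [exists (- M%:R)|exists t => s []].
pose a := sup S.
have at_ : a <= t by apply: ge_sup; [exists (- M%:R)|move=> s []].
have ci : continuous (fun s : R => ins 0 s x : Rd) by exact: continuous_ins.
have nOa : ~ Omega (ins 0 a x).
  move=> Oa; have : \forall s \near a, Omega (ins 0 s x).
    by apply: (ci a); apply: open_nbhs_nbhs.
  move=> /nbhs_ballP[d /= d0 hd].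
  have [s [st nOs] ds] := sup_adherent d0 Ssup.
  have sa : s <= a := sup_upper_bound Ssup (conj st nOs).
  apply: nOs; apply: hd; rewrite /ball /= ltr_norml.
  by move: ds; rewrite -/a; clearbody a; lra.
have aS s : a < s <= t -> Omega (ins 0 s x).
  move=> /andP[as_ st]; apply: contrapT => nO.
  have : s <= a := sup_upper_bound Ssup (conj st nO).
  by rewrite leNgt as_.
have alt : a < t by rewrite lt_neqAle at_ andbT; apply/eqP => e; apply: nOa; rewrite e.
have Ma : - M%:R <= a := sup_upper_bound Ssup S0.
clearbody a; exists a; split=> //.
- by have /andP[] := inM t Ot.
rewrite boundaryE; split=> // U /ci /nbhs_ballP[d /= d0 hd].
pose s := a + Num.min (d / 2) (t - a).
exists (ins 0 s x); split.
  by apply: aS; rewrite /s; have := subr_gt0 a t; rewrite alt; case: (leP (d/2) (t - a)); lra.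
apply: hd; rewrite /ball /= ltr_norml /s.
by have := subr_gt0 a t; rewrite alt; case: (leP (d/2) (t - a)); lra.
Qed.

Let sq w : Rd -> \bar R := (fun y => ((w y) ^+ 2)%:E) \_ Omega.
Let J w (x : Rn) : \bar R := (\int[mu1]_t (sq (partial 0%R w) (ins 0%R t x)))%E.

Let mJ w : smooth w -> measurable_fun setT (sq w).
Proof.
move=> sw; apply/(measurable_restrictT _ _).1; first exact: open_measurable_rV.
apply/measurable_EFinP; apply: measurable_funX; apply: smooth_measurable => //.
exact: open_measurable_rV.
Qed.

Let J0 w y : (0 <= sq w y)%E.
Proof. by rewrite /sq patchE; case: ifP => // _; rewrite lee_fin sqr_ge0. Qed.

(* [w(t)] differs from its value at the last boundary point before [t] by the
   integral of the derivative in between. *)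
Lemma slice_bound w x (g : R) : smooth w -> 0 <= g ->
  (forall t, Gam (ins 0 t x) -> w (ins 0 t x) ^+ 2 <= g) ->
  forall t, Omega (ins 0 t x) ->
  ((w (ins 0 t x) ^+ 2)%:E <= (2 * g)%:E + (4 * M%:R)%:E * J w x)%E.
Proof.
move=> sw g0 wg t Ot.
have [a [Ma alt tM Ga Oa]] := open_complement_below Ot.
have sd := smooth_partial 0 sw.
pose F s := w (ins 0 s x); pose G s := partial 0 w (ins 0 s x).
have ci : continuous (fun s : R => ins 0 s x : Rd) by exact: continuous_ins.
have cF : continuous F.
  by move=> s; apply: (@continuous_comp _ _ _ (fun r => ins 0 r x) w);
    [exact: ci|exact: smooth_continuous].
have cG : continuous G.
  by move=> s; apply: (@continuous_comp _ _ _ (fun r => ins 0 r x) (partial 0 w));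
    [exact: ci|exact: smooth_continuous].
have mG (D : set R) : measurable_fun D G.
  by apply: measurable_funTS; exact: continuous_measurable_fun.
have ftc : \int[mu1]_(s in `[a, t]) G s = F t - F a.
  rewrite /Rintegral (@continuous_FTC2 R G F a t)//.
  - exact: continuous_subspaceT.
  - split; first by move=> s _; apply: derivable_ins; exact: smooth_differentiable.
    + by apply: cvg_at_right_filter; exact: cF.
    + by apply: cvg_at_left_filter; exact: cF.
  - by move=> s _; rewrite derive1E; exact: derive_ins.
have mI : measurable (`[a, t]%classic : set (measurableTypeR R)) by exact: measurable_itv.
have L1 : L2_fun mu1 `[a, t] (cst 1 : measurableTypeR R -> R).
  split; first exact: measurable_cst.
  under eq_integral do rewrite expr1n.
  by rewrite integral_cst// mul1e /= lebesgue_measure_itv /=; case: ifP => // _; rewrite ltry.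
have LG : L2_fun mu1 `[a, t] (G : measurableTypeR R -> R).
  split; first exact: mG.
  have /integrableP[_] : mu1.-integrable `[a, t] (EFin \o (fun s => G s ^+ 2)).
    apply: continuous_compact_integrable; first exact: segment_compact.
    by apply: continuous_subspaceT => s; apply: cvgM; exact: cG.
  apply: le_lt_trans; rewrite le_eqVlt; apply/orP; left; apply/eqP.
  by apply: eq_integral => s _; rewrite /= ger0_norm ?sqr_ge0.
(* Against the constant 1 this gives (F t - F a)^2 <= (t - a) times the integral of G^2, with t - a
   <= 2 M. *)
have cs := cauchy_schwarz (L2_subspace mu1 mI) (L2_semi_inner mu1 mI) L1 LG.
have i1 : \int[mu1]_(s in `[a, t]) ((cst 1 s : R) * cst 1 s) = t - a.
  rewrite /Rintegral /=; under eq_integral do rewrite mulr1.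
  by rewrite integral_cst// mul1e /= lebesgue_measure_itv /= lte_fin alt.
have iG : \int[mu1]_(s in `[a, t]) (cst 1 s * G s) = F t - F a.
  by rewrite -ftc; apply: eq_Rintegral => s _; rewrite /= mul1r.
(* The point at [a] is outside [Omega], where the integrand of [J] is cut to zero; hence the passage
   to the half-open interval. *)
have GJ : ((\int[mu1]_(s in `[a, t]) (G s * G s))%:E <= J w x)%E.
  rewrite (L2_ipE mI LG) -(@integral_itv_obnd_cbnd R a (BRight t)); last first.
    by apply/measurable_EFinP; apply: measurable_funX; exact: mG.
  rewrite /J integral_mkcond; apply: ge0_le_integral => //.
  - by move=> s _; rewrite patchE; case: ifP => // _; rewrite lee_fin sqr_ge0.
  - apply/(measurable_restrictT _ _).1; first exact: measurable_itv.
    by apply/measurable_EFinP; apply: measurable_funX; exact: mG.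
  - exact: (measurableT_comp (mJ sd) (measurable_ins_section 0 x)).
  - move=> s _; rewrite patchE; case: ifP => [/set_mem /= h|_]; last exact: J0.
    rewrite /sq patchE mem_set//; apply: Oa; move: h; by rewrite in_itv.
rewrite iG i1 in cs.
apply: (@le_trans _ _ (2 * g + (4 * M%:R) * \int[mu1]_(s in `[a, t]) (G s * G s))%:E); last first.
  rewrite EFinD EFinM [in X in (_ <= X)%E]EFinM; apply: leeD => //.
  by rewrite [in X in (X <= _)%E]EFinM; apply: lee_wpmul2l.
rewrite lee_fin -/(F t).
have Fa := wg a Ga; rewrite -/(F a) in Fa.
have K0 : 0 <= \int[mu1]_(s in `[a, t]) (G s * G s).
  by apply: Rintegral_ge0 => s _; rewrite -expr2 sqr_ge0.
set K := \int[mu1]_(s in _) _ in cs K0 *.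
have : (t - a) * K <= (2 * M%:R) * K by rewrite ler_wpM2r//; lra.
have := sqrB_le (F t - F a) (- F a).
rewrite opprK subrK sqrrN.
clearbody K; lra.
Qed.


(** [slice_bound] is integrated over t in an interval of length 2 M, which turns 2 and 4 M into 4 M
    and 8 M^2, then over the cube with the majorant [G]; finally the error of the majorant tends to
    zero. *)
Lemma boundary_poincare w : smooth w -> (I w < +oo)%E ->
  (\int[mu]_(y in Omega) (w y ^+ 2)%:E <= (4 * M%:R * 2 ^+ n)%:E * I w +
    (8 * M%:R ^+ 2)%:E * \int[mu]_(y in Omega) (partial 0%R w y ^+ 2)%:E)%E.
Proof.
move=> sw Ioo; have sd := smooth_partial 0 sw.
have mO : measurable Omega by exact: open_measurable_rV.
have mcube := @measurable_open_box R n (fun=> - M%:R) (fun=> M%:R).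
have M0 : 0 <= M%:R :> R by [].
have mJw : measurable_fun setT (J w) by apply: measurable_tonelli_ins; [exact: mJ|exact: J0].
have Jw0 x : (0 <= J w x)%E by apply: integral_ge0 => t _; exact: J0.
have JE : (\int[lebesgue_rV R n]_x J w x = \int[mu]_(y in Omega) (partial 0%R w y ^+ 2)%:E)%E.
  rewrite [RHS]integral_mkcond (tonelli_ins 0)//; [exact: (mJ sd)|exact: J0].
rewrite [in leLHS]integral_mkcond (tonelli_ins 0); [|exact: (mJ sw)|exact: J0].
have bound (e : R) : 0 < e ->
  (\int[lebesgue_rV R n]_x \int[mu1]_t sq w (ins 0%R t x) <=
   (4 * M%:R)%:E * (e%:E * (1 + lebesgue_rV R n (cube M)) + (2 ^+ n)%:E * I w) +
   (8 * M%:R ^+ 2)%:E * \int[mu]_(y in Omega) (partial 0%R w y ^+ 2)%:E)%E.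
  move=> e0; have [G [mG G0 wG Gint]] := boundary_majorant sw Ioo e0.
  pose H x : \bar R := ((4 * M%:R)%:E * (G x)%:E + (8 * M%:R ^+ 2)%:E * J w x)%E.
  have H1 x : (\int[mu1]_t sq w (ins 0%R t x) <= (H \_ (cube M)) x)%E.
    rewrite patchE; case: ifPn => [_|/negP nx]; last first.
      rewrite integral0_eq// => t _; rewrite /sq patchE memNset// => /OM Ot.
      apply: nx; apply/mem_set => j; have := Ot (lift 0 j); by rewrite ins_lift.
    pose c : \bar R := ((2 * G x)%:E + (4 * M%:R)%:E * J w x)%E.
    have c0 : (0 <= c)%E.
      by apply: adde_ge0; [rewrite lee_fin mulr_ge0|rewrite mule_ge0// lee_fin mulr_ge0].
    pose V : set (measurableTypeR R) := `]- M%:R, M%:R[%classic.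
    have vV : mu1 V = (2 * M%:R : R)%:E.
      rewrite lebesgue_measure_itv /= lte_fin -EFinB.
      by case: ltP => h; congr (_%:E); lra.
    have -> : H x = (\int[mu1]_(t in V) cst c t)%E.
      have -> : (\int[mu1]_(t in V) cst c t)%E = (c * (2 * M%:R : R)%:E)%E.
        rewrite integral_cst; last exact: measurable_itv.
        by congr (_ * _)%E; exact: vV.
      rewrite muleC ge0_muleDr ?lee_fin ?mulr_ge0//; last by rewrite mule_ge0// lee_fin mulr_ge0.
      rewrite /H muleA -!EFinM; congr (_%:E + _%:E * _)%E; ring.
    rewrite [leRHS]integral_mkcond; apply: ge0_le_integral => //.
    - exact: (measurableT_comp (mJ sw) (measurable_ins_section 0 x)).
    - by apply/(measurable_restrictT _ _).1; [exact: measurable_itv|exact: measurable_cst].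
    move=> t _; rewrite /sq [in leLHS]patchE; case: ifP => [/set_mem Ot|_]; last first.
      by rewrite patchE; case: ifP.
    rewrite patchE mem_set; last by have := OM Ot 0; rewrite ins_same.
    apply: slice_bound => // s Gs; by have := wG _ Gs; rewrite col'_ins.
  have mH : measurable_fun (cube M : set Rn) H.
    apply: measurable_funTS; apply: emeasurable_funD.
      by apply: emeasurable_funM => //; exact/measurable_EFinP.
    by apply: emeasurable_funM.
  apply: (@le_trans _ _ (\int[lebesgue_rV R n]_(x in cube M) H x)%E).
    rewrite [leRHS]integral_mkcond; apply: ge0_le_integral => //.
    - by move=> x _; apply: integral_ge0 => t _; exact: J0.
    - by apply: measurable_tonelli_ins; [exact: mJ|exact: J0].
    - by apply/(measurable_restrictT _ _).1.
  have A0 x : (0 <= (4 * M%:R)%:E * (G x)%:E)%E by rewrite -EFinM lee_fin !mulr_ge0.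
  have B0 x : (0 <= (8 * M%:R ^+ 2)%:E * J w x)%E by rewrite mule_ge0// lee_fin mulr_ge0 ?exprn_ge0.
  have mA : measurable_fun (cube M : set Rn) (fun x => (4 * M%:R)%:E * (G x)%:E)%E.
    by apply: measurable_funTS; apply: emeasurable_funM => //; exact/measurable_EFinP.
  have mB : measurable_fun (cube M : set Rn) (fun x => (8 * M%:R ^+ 2)%:E * J w x)%E.
    by apply: measurable_funTS; apply: emeasurable_funM.
  rewrite ge0_integralD//.
  apply: leeD.
    rewrite ge0_integralZl_EFin//; first by rewrite lee_wpmul2l// lee_fin mulr_ge0.
    - by move=> x _; rewrite lee_fin.
    - by apply/measurable_EFinP; exact: measurable_funTS.
  rewrite ge0_integralZl_EFin//; last exact: measurable_funTS.
  rewrite lee_wpmul2l ?lee_fin ?mulr_ge0 ?exprn_ge0// -JE.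
  by apply: ge0_subset_integral.
have Lfin : lebesgue_rV R n (cube M) \is a fin_num.
  by rewrite ge0_fin_numE//; exact: lebesgue_cube_lty.
have I0 : (0 <= I w)%E.
  by apply: (outer_integral_ge0 (@hausdorff0 R _ n) (@hausdorff_ge0 R _ n)) => x _; exact: sqr_ge0.
have Ifin : I w \is a fin_num by rewrite ge0_fin_numE.
apply/lee_addgt0Pr => d d0.
pose L := fine (lebesgue_rV R n (cube M)).
have L0 : 0 <= L by exact: fine_ge0.
(* With [e = d / c] the error 4 M (1 + L) e is at most [d]; the summand 1 keeps [c] positive for
   [M = 0]. *)
pose c := 4 * M%:R * (1 + L) + 1.
have c0 : 0 < c by rewrite ltr_wpDl// mulr_ge0// ?mulr_ge0// addr_ge0.
have dc0 : 0 < d / c by rewrite divr_gt0.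
apply: le_trans (bound _ dc0) _.
rewrite [leRHS]addeAC; apply: leeD => //.
rewrite -(fineK Lfin) -(fineK Ifin) -/L -!(EFinM, EFinD) lee_fin.
set i := fine _.
have -> : 4 * M%:R * (d / c * (1 + L) + 2 ^+ n * i) =
  4 * M%:R * 2 ^+ n * i + d * (4 * M%:R * (1 + L) / c).
  by ring.
rewrite lerD2l; apply: ler_piMr; first exact: ltW.
by rewrite ler_pdivrMr// mul1r /c lerDl.
Qed.

End boundary.

Lemma comb_lt (R : realType) (a x y d : R) : 0 < d -> x < d -> y < d ->
  2 * (a * (a * x) + y) < 2 * ((2 * a ^+ 2 + 2) * d).
Proof.
move=> d1 xd yd; have : a ^+ 2 * x <= a ^+ 2 * d by apply: ler_wpM2l; [exact: sqr_ge0|exact: ltW].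
have : 0 <= a ^+ 2 * d by rewrite mulr_ge0 ?sqr_ge0// ltW.
rewrite mulrA -expr2 mulrDl -mulrA.
by set p := a ^+ 2 * x; set q := a ^+ 2 * d; clearbody p q; lra.
Qed.

Lemma sqr_comb_le (R : realType) (a x y : R) :
  (a * x + y) ^+ 2 <= (2 * a ^+ 2 + 2) * Num.max (x ^+ 2) (y ^+ 2).
Proof.
have h1 : x ^+ 2 <= Num.max (x ^+ 2) (y ^+ 2) by rewrite le_max lexx.
have h2 : y ^+ 2 <= Num.max (x ^+ 2) (y ^+ 2) by rewrite le_max lexx orbT.
set m := Num.max _ _ in h1 h2 *.
have h3 : a ^+ 2 * x ^+ 2 <= a ^+ 2 * m by rewrite ler_wpM2l ?sqr_ge0.
have := sqrB_le (a * x) (- y); rewrite opprK sqrrN exprMn.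
have -> : (2 * a ^+ 2 + 2) * m = 2 * (a ^+ 2 * m) + 2 * m by ring.
move: h2 h3; set p := a ^+ 2 * x ^+ 2; set q := a ^+ 2 * m; set r := (_ + _) ^+ 2.
set t := y ^+ 2; clearbody p q m r t; lra.
Qed.

Lemma poincare_const (R : realType) n M (d : R) : 0 < d ->
  0 < 2 + 8 * M%:R * 2 ^+ n + 32 * M%:R ^+ 2 :> R /\
  0 < d / (2 + 8 * M%:R * 2 ^+ n + 32 * M%:R ^+ 2).
Proof.
move=> d0; have c0 : 0 < 2 + 8 * M%:R * 2 ^+ n + 32 * M%:R ^+ 2 :> R.
  by rewrite -addrA ltr_wpDr// addr_ge0// mulr_ge0 ?exprn_ge0// mulr_ge0.
by split=> //; exact: divr_gt0.
Qed.

(** Bookkeeping for unprimed w - v, primed v and doubly primed w. The denominator of [e] is the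
    total 2 + 2 (4 M 2^n) + 2 (8 M^2) 2 of the errors, and the last product is the Poincare
    constant. *)
Lemma poincare_arith (R : realType) n M (d m g m' g' m'' g'' : R) : 0 < d ->
  let e := d / (2 + 8 * M%:R * 2 ^+ n + 32 * M%:R ^+ 2) in
  0 <= m -> 0 <= g -> m + g < e -> m' <= 2 * (m + m'') -> g'' <= 2 * (g + g') ->
  m'' <= 4 * M%:R * 2 ^+ n * e + 8 * M%:R ^+ 2 * g'' ->
  m' <= 32 * M%:R ^+ 2 * g' + d.
Proof.
move=> d0 e m0 g0 mg h1 h2 h3; have [c0 e0] := poincare_const n M d0.
have -> : d = (2 + 8 * M%:R * 2 ^+ n + 32 * M%:R ^+ 2) * e.
  by rewrite /e mulrC divfK// lt0r_neq0.
rewrite -/e in e0; clearbody e; clear c0.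
have h4 : M%:R ^+ 2 * g'' <= M%:R ^+ 2 * (2 * (e + g')).
  apply: ler_wpM2l; first exact: sqr_ge0.
  by apply: le_trans h2 _; lra.
have -> : (2 + 8 * M%:R * 2 ^+ n + 32 * M%:R ^+ 2) * e =
  2 * e + 2 * (4 * M%:R * 2 ^+ n * e) + 32 * (M%:R ^+ 2 * e) by ring.
have -> : 32 * M%:R ^+ 2 * g' = 32 * (M%:R ^+ 2 * g') by ring.
move: h3 h4; rewrite -[8 * _ * g'']mulrA.
have -> : M%:R ^+ 2 * (2 * (e + g')) = 2 * (M%:R ^+ 2 * e) + 2 * (M%:R ^+ 2 * g') by ring.
set a := 4 * _ * _ * e; set b := M%:R ^+ 2 * e; set c := M%:R ^+ 2 * g'; set q := M%:R ^+ 2 * g''.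
by clearbody a b c q; lra.
Qed.

(** * Functions with zero trace *)

Section zero_trace.
Context (R : realType) (n : nat) (Omega : set 'rV[R]_n.+1) (M : nat).
Context (oO : open Omega) (OM : Omega `<=` @cube R n.+1 M).
Local Notation Rn := 'rV[R]_n.
Local Notation Rd := 'rV[R]_n.+1.
Local Notation mu := (lebesgue_rV R n.+1).
Local Notation Gam := (boundary Omega).
Local Notation H := (H1_form Omega).
Local Notation I w := (\int[hausdorff n]_(x in Gam) ((w x) ^+ 2)%:E)%E.
Implicit Types (u v w psi : Rd -> R).

Let finO := bounded_domain_lty oO OM.
Let hX := in_H1_subspace oO finO.
Let hm := ip_semi_inner_H1 oO.
Let hg := grad_semi_inner oO finO.
Let hH : semi_inner (in_H1 Omega : set (Rd -> R)) H := semi_inner_sum hm hg.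
Let sH w : smooth w -> in_H1 Omega w := smooth_H1 oO OM (f := w).

Let I_ge0 w : (0 <= I w)%E.
Proof.
by apply: (outer_integral_ge0 (@hausdorff0 R _ n) (@hausdorff_ge0 R _ n)) => x _; exact: sqr_ge0.
Qed.

(** Replaces the approximating sequence by a single tolerance for both errors, the form in which
    sums, limits and the Poincare inequality are easy to handle. *)
Lemma in_H10P u : in_H1 Omega u -> (in_H10 Omega u <->
  forall e : R, 0 < e -> exists w, [/\ smooth w, H (w - u) (w - u) < e & (I w < e%:E)%E]).
Proof.
move=> Hu; split.
  move=> [_ [_ [w [sw wu wG]]]] e e0.
  have e1 : 0 < Num.sqrt e by rewrite sqrtr_gt0.
  have Hwu k : in_H1 Omega (w k - u) by apply: subspaceB => //; exact: sH.
  have /cvgr0Pnorm_lt /(_ _ e1) n1 := wu.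
  have n2 : \forall k \near \oo, (I (w k) < e%:E)%E.
    have wI : I (w k) @[k --> \oo] --> 0%E.
      rewrite (_ : (fun k => I (w k)) = (fun k =>
        \int[hausdorff n]_(x in Gam) ((w k x - cst 0 x) ^+ 2)%:E)%E)//.
      by apply/funext => k; congr (integral _ _ _); apply/funext => x; rewrite subr0.
    have e0' : (0 < e%:E :> \bar R)%E by rewrite lte_fin.
    exact: (wI [set y | (y < e%:E)%E] (open_ereal_lt' e0')).
  have [k [k1 k2]] := filter_ex (filterI n1 n2).
  exists (w k); split => //.
  move: k1; rewrite [norm_H1 _ _](norm_H1E oO (Hwu k)) ger0_norm ?sqrtr_ge0// ltr_sqrt//.
move=> h; split=> //; split; first exact: measurable_cst.
have /choice[w hw] : forall k : nat, exists w, [/\ smooth w, H (w - u) (w - u) < k.+1%:R^-1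
    & (I w < (k.+1%:R^-1)%:E)%E].
  by move=> k; apply: h; rewrite invr_gt0.
have Hwu k : in_H1 Omega (w k - u).
  by apply: subspaceB => //; apply: sH; have [] := hw k.
exists w; split; first by move=> k; have [] := hw k.
  apply/cvgr0Pnorm_lt => e e0; have [N hN] := small_inv (exprn_gt0 2 e0).
  exists N => // k /= Nk; rewrite [norm_H1 _ _](norm_H1E oO (Hwu k)) ger0_norm ?sqrtr_ge0//.
  rewrite -[e]ger0_norm ?(ltW e0)// -sqrtr_sqr ltr_sqrt ?exprn_gt0//.
  by apply: lt_trans (hN k Nk); have [] := hw k.
move=> U U0; have /nbhs_ballP[e /= e0 eU] : nbhs (0 : R) (fun r : R => U r%:E) := U0.
have [N hN] := small_inv e0.
exists N => // k /= Nk.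
have -> : (\int[hausdorff n]_(x in Gam) ((w k x - cst 0 x) ^+ 2)%:E = I (w k))%E.
  by congr (integral _ _ _); apply/funext => x; rewrite subr0.
have [_ _ Iwk] := hw k.
have Ifin : I (w k) \is a fin_num by rewrite ge0_fin_numE// (lt_trans Iwk)// ltry.
rewrite -(fineK Ifin); apply: eU; rewrite /ball /= sub0r normrN ger0_norm ?fine_ge0//.
apply: lt_trans (hN k Nk); rewrite -lte_fin fineK//.
Qed.

(** The interior error of a combination is bounded by the semi-inner product, the boundary error by
    [outer_integral_max]; both lose the same factor 2 c. *)
Lemma in_H10_subspace : subspace_of (in_H10 Omega : set (Rd -> R)).
Proof.
split.
  have s0 : smooth (cst 0 : Rd -> R) by apply: smooth_algebra_smooth; exact: alg_const.
  apply/in_H10P; first exact: subspace0 hX.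
  move=> e e0; exists 0; split; first exact: s0.
    by rewrite subrr (linear_on0 hX (form_linl hH (subspace0 hX))).
  rewrite (outer_integral_eq0 (@hausdorff0 R _ n) (@hausdorff_ge0 R _ n)) ?lte_fin// => x _.
  by rewrite expr0n.
move=> a u v Hu Hv; have Xu := Hu.1; have Xv := Hv.1.
have Xauv := subspaceP hX a Xu Xv.
apply/in_H10P => // e e0.
pose c := 2 * a ^+ 2 + 2.
have c0 : 0 < c by rewrite ltr_wpDl// mulr_ge0// sqr_ge0.
have d0 : 0 < e / (2 * c) by rewrite divr_gt0// mulr_gt0.
have [w [sw Hw Iw]] := (in_H10P Xu).1 Hu _ d0.
have [w' [sw' Hw' Iw']] := (in_H10P Xv).1 Hv _ d0.
have Xw := sH sw; have Xw' := sH sw'.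
exists (a *: w + w'); split; first exact: smoothP.
  have -> : a *: w + w' - (a *: u + v) = a *: (w - u) + (w' - v).
    by rewrite scalerBr opprD addrACA.
  have X1 := subspaceB hX Xw Xu; have X2 := subspaceB hX Xw' Xv.
  have X3 := subspaceZ hX a X1.
  apply: le_lt_trans (formD_le hX hH X3 X2) _.
  rewrite (formZl hX hH _ X1 X3) (formZr hX hH _ X1 X1).
  apply: (lt_le_trans (comb_lt a d0 Hw Hw')); rewrite -/c.
  by rewrite le_eqVlt; apply/orP; left; apply/eqP; field; rewrite lt0r_neq0.
have le1 := @outer_integral_max _ _ _ (hausdorff n) Gam (@hausdorff0 R _ n)
  (@hausdorff_ge0 R _ n) (@le_hausdorff R _ n) (@hausdorffU R _ n)
  (fun x => w x ^+ 2) (fun x => w' x ^+ 2) (fun x => (a * w x + w' x) ^+ 2) c c0.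
apply: le_lt_trans (le1 _ _ _ _ _) _.
- by apply: measurable_funX; exact: smooth_measurable.
- by apply: measurable_funX; exact: smooth_measurable.
- by move=> x _; exact: sqr_ge0.
- by move=> x _; exact: sqr_ge0.
- by move=> x _; rewrite sqr_ge0 /=; exact: sqr_comb_le.
have Ifin v' : (I v' < (e / (2 * c))%:E)%E -> I v' \is a fin_num.
  by move=> Iv; rewrite ge0_fin_numE// (lt_trans Iv)// ltry.
rewrite -(fineK (Ifin _ Iw)) -(fineK (Ifin _ Iw')) -EFinD -EFinM lte_fin.
have h1 : fine (I w) < e / (2 * c) by rewrite -lte_fin (fineK (Ifin _ Iw)).
have h2 : fine (I w') < e / (2 * c) by rewrite -lte_fin (fineK (Ifin _ Iw')).
rewrite -ltr_pdivlMl//; have : c^-1 * e = e / (2 * c) + e / (2 * c) by field; rewrite lt0r_neq0.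
by move=> ->; exact: ltrD.
Qed.

Lemma in_H10_closed u : in_H1 Omega u ->
  (forall e : R, 0 < e -> exists2 v, in_H10 Omega v & H (v - u) (v - u) < e) -> in_H10 Omega u.
Proof.
move=> Xu h; apply/in_H10P => // e e0.
have e4 : 0 < e / 4 by rewrite divr_gt0.
have [v Hv vu] := h _ e4; have Xv := Hv.1.
have [w [sw Hw Iw]] := (in_H10P Xv).1 Hv _ e4.
have Xw := sH sw.
exists w; split=> //.
  have -> : w - u = (w - v) + (v - u) by rewrite addrA subrK.
  apply: le_lt_trans (formD_le hX hH (subspaceB hX Xw Xv) (subspaceB hX Xv Xu)) _.
  by move: vu Hw; set x := H _ _; set y := H _ _; clearbody x y; lra.
by apply: lt_trans Iw _; rewrite lte_fin ltr_pdivrMr// ltr_pMr// ltr1n.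
Qed.

(** [boundary_poincare] for a smooth approximation whose boundary term is below the tolerance; the
    constant does not depend on the approximation. *)
Lemma poincare v : in_H10 Omega v -> ip Omega v v <= 32 * M%:R ^+ 2 * grad_ip Omega v v.
Proof.
move=> Hv; have Xv := Hv.1.
apply/ler_addgt0Pr => d d0.
have M0 : 0 <= M%:R :> R by [].
have [c0 e0] := poincare_const n M d0.
have [w [sw Hw Iw]] := (in_H10P Xv).1 Hv _ e0.
have Xw := sH sw; have Xd := subspaceB hX Xw Xv.
set e := d / _ in e0 Hw Iw.
have m0 := form_ge0 hm Xd; have g0 := form_ge0 hg Xd.
have h1 : ip Omega v v <= 2 * (ip Omega (w - v) (w - v) + ip Omega w w).
  have := formD_le hX hm (subspaceB hX Xv Xw) Xw.
  by rewrite subrK (form_sqr_dist hX hm Xv Xw).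
have h2 : grad_ip Omega w w <= 2 * (grad_ip Omega (w - v) (w - v) + grad_ip Omega v v).
  by have := formD_le hX hg Xd Xv; rewrite subrK.
have h3 : ip Omega w w <= 4 * M%:R * 2 ^+ n * e + 8 * M%:R ^+ 2 * grad_ip Omega w w.
  have Lw := smooth_L2 oO OM sw; have sd := smooth_partial 0 sw.
  have Ld := smooth_L2 oO OM sd.
  have mO : measurable Omega by exact: open_measurable_rV.
  have hd : ip Omega (partial 0 w) (partial 0 w) <= grad_ip Omega w w.
    rewrite -(ip_weak_partialE oO finO Ld (smooth_weak_partial oO OM 0 sw)).
    rewrite /grad_ip (bigD1 0)//= lerDl sumr_ge0// => i _.
    apply: (form_ge0 (ip_semi_inner oO)); by have [] := weak_partialP i Xw.
  rewrite -lee_fin; have -> : (ip Omega w w)%:E = _ := L2_ipE mO Lw.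
  apply: le_trans (boundary_poincare oO OM sw (lt_trans Iw (ltry _))) _.
  rewrite EFinD; apply: leeD.
    by rewrite [leRHS]EFinM; apply: lee_wpmul2l; [rewrite lee_fin !mulr_ge0 ?exprn_ge0|exact: ltW].
  have <- : (ip Omega (partial 0 w) (partial 0 w))%:E = _ := L2_ipE mO Ld.
  rewrite -EFinM lee_fin ler_wpM2l// mulr_ge0//.
move: Hw; rewrite /H1_form !mul1r => Hw.
exact: (poincare_arith d0 m0 g0 Hw h1 h2 h3).
Qed.

(** By the Poincare inequality, Cauchy sequences for the gradient are Cauchy in H^1, and zero traces
    survive the limit. *)
Lemma riesz_in_H10 : riesz (in_H10 Omega : set (Rd -> R)) (grad_ip Omega).
Proof.
have XH : (in_H10 Omega : set (Rd -> R)) `<=` in_H1 Omega by move=> u [].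
apply: riesz_complete; [exact: in_H10_subspace|exact: semi_innerS hg|].
move=> u Hu cu; have Xu k := XH _ (Hu k).
pose K : R := 32 * M%:R ^+ 2 + 1.
have K0 : 0 < K by rewrite ltr_wpDl// mulr_ge0// exprn_ge0.
have [l Xl hl] : exists2 l, in_H1 Omega l & forall e : R, 0 < e ->
    exists N, forall i, (N <= i)%N -> H (u i - l) (u i - l) < e.
  apply: (H1_complete oO finO Xu) => e e0.
  have [N hN] := cu _ (divr_gt0 e0 K0); exists N => i j Ni Nj.
  have Hd := subspaceB in_H10_subspace (Hu i) (Hu j).
  apply: (@le_lt_trans _ _ (K * grad_ip Omega (u i - u j) (u i - u j))).
    by rewrite /H1_form !mul1r /K mulrDl mul1r lerD2r; exact: poincare.
  by rewrite mulrC -ltr_pdivlMr//; exact: hN.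
exists l.
  by apply: in_H10_closed => // e /hl[N hN]; exists (u N) => //; exact: hN.
move=> e /hl[N hN]; exists N => i /hN; apply: le_lt_trans.
by rewrite /H1_form !mul1r lerDr; exact: (form_ge0 hm (subspaceB hX (Xu i) Xl)).
Qed.

(** Energy and H^1 norm are equivalent as [lambda > 0], and orthogonality to H^1_0 passes to limits
    by Cauchy-Schwarz. *)
Lemma riesz_harmonic (lambda : R) : 0 < lambda ->
  riesz (orthogonal_in (grad_ip Omega) (in_H1 Omega) (in_H10 Omega) : set (Rd -> R))
    (fun u v => (lambda + 1) * ip Omega u v + lambda * grad_ip Omega u v).
Proof.
move=> l0; have ha := semi_inner_energy l0 hm hg.
have XH : (in_H10 Omega : set (Rd -> R)) `<=` in_H1 Omega by move=> u [].
have YX : (orthogonal_in (grad_ip Omega) (in_H1 Omega) (in_H10 Omega) : set (Rd -> R))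
  `<=` in_H1 Omega by move=> u [].
have hY := subspace_orthogonal hX hg (fun u h => h) XH hX.
apply: riesz_complete; [exact: hY|exact: semi_innerS YX ha|].
move=> u Hu cu; have Xu k := YX _ (Hu k).
have [l Xl hl] : exists2 l, in_H1 Omega l & forall e : R, 0 < e ->
    exists N, forall i, (N <= i)%N -> H (u i - l) (u i - l) < e.
  apply: (H1_complete oO finO Xu) => e e0.
  have [N hN] := cu _ (mulr_gt0 l0 e0); exists N => i j Ni Nj.
  have m0 := form_ge0 hm (subspaceB hX (Xu i) (Xu j)).
  rewrite -(ltr_pM2l l0); apply: le_lt_trans (hN i j Ni Nj).
  by rewrite /H1_form !mul1r mulrDr lerD2r ler_wpM2r// lerDl.
exists l.
  split=> // psi Hpsi; have Xpsi := XH _ Hpsi.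
  apply/eqP; rewrite -sqrf_eq0 eq_le sqr_ge0 andbT; apply/ler_addgt0Pr => e e0; rewrite add0r.
  have q0 := form_ge0 hg Xpsi.
  have q1 : 0 < grad_ip Omega psi psi + 1 by rewrite ltr_wpDl.
  have [N /(_ N (leqnn _)) hN] := hl _ (divr_gt0 e0 q1).
  have Xd := subspaceB hX (Xu N) Xl.
  have cs := cauchy_schwarz hX hg Xd Xpsi.
  have gd : grad_ip Omega (u N - l) psi = - grad_ip Omega l psi.
    by rewrite (formBl hg (Xu N) Xl Xpsi) (proj2 (Hu N) _ Hpsi) sub0r.
  rewrite gd sqrrN in cs; apply: le_trans cs _.
  have gH : grad_ip Omega (u N - l) (u N - l) <= e / (grad_ip Omega psi psi + 1).
    apply: ltW; apply: le_lt_trans hN; rewrite /H1_form !mul1r lerDr.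
    exact: (form_ge0 hm Xd).
  apply: (@le_trans _ _ (e / (grad_ip Omega psi psi + 1) * (grad_ip Omega psi psi + 1))).
    by apply: ler_pM; [exact: (form_ge0 hg Xd)|exact: q0|exact: gH|rewrite lerDl].
  by rewrite divfK// lt0r_neq0.
move=> e e0; have l1 : 0 < lambda + 1 by rewrite addr_gt0.
have [N hN] := hl _ (divr_gt0 e0 l1); exists N => i /hN; rewrite ltr_pdivlMr//.
apply: le_lt_trans; rewrite [leRHS]mulrC /H1_form !mul1r mulrDr lerD2l.
apply: ler_wpM2r; last by rewrite lerDl.
exact: (form_ge0 hg (subspaceB hX (Xu i) Xl)).
Qed.

End zero_trace.

(** * The optimality systems and the error estimate *)

Section optimality_system.
Context (R : realType) (n : nat) (Omega : set 'rV[R]_n.+1) (M : nat).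
Context (oO : open Omega) (OM : Omega `<=` @cube R n.+1 M).
Context (lambda : R) (lambda_gt0 : 0 < lambda).
Context (ud : 'rV[R]_n.+1 -> R) (Lud : in_L2 Omega ud).
Local Notation Rd := 'rV[R]_n.+1.
Local Notation mu := (lebesgue_rV R n.+1).
Local Notation H1 := (in_H1 Omega : set (Rd -> R)).
Local Notation H10 := (in_H10 Omega : set (Rd -> R)).
Local Notation m := (ip Omega).
Local Notation g := (grad_ip Omega).
Implicit Types (u v w f phi psi : Rd -> R).

Let finO := bounded_domain_lty oO OM.
Let hX := in_H1_subspace oO finO.
Let hm := ip_semi_inner_H1 oO.
Let hg := grad_semi_inner oO finO.
Let a u v := (lambda + 1) * m u v + lambda * g u v.
Let ha : semi_inner H1 a := semi_inner_energy lambda_gt0 hm hg.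
Let hL2 := in_L2_subspace oO.
Let hI := ip_semi_inner oO.

Lemma in_H10_H1 : H10 `<=` H1. Proof. by move=> u []. Qed.

Lemma ip_linear f : in_L2 Omega f -> linear_on H1 (m f).
Proof. by move=> Lf c u v [Lu _] [Lv _]; exact: (form_linr hL2 hI Lf). Qed.

Lemma ip_bounded f : in_L2 Omega f -> bounded_by H1 m (m f).
Proof. by move=> Lf; exists (m f f) => u [Lu _]; exact: (cauchy_schwarz hL2 hI Lf Lu). Qed.

(** A null set contains no nonempty open set, so for continuous functions almost everywhere becomes
    everywhere. *)
Lemma continuous_ip_eq0 v : (forall x, Omega x -> {for x, continuous v}) -> in_L2 Omega v ->
  m v v = 0 -> forall x, Omega x -> v x = 0.
Proof.
move=> cv Lv v0 x Ox; apply: contrapT => /eqP vx.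
have mO : measurable Omega by exact: open_measurable_rV.
have [N [mN N0 NS]] := L2_ip_eq0 mO Lv v0.
have : nbhs x (Omega `&` [set y | v y != 0]).
  apply: filterI; first exact: open_nbhs_nbhs.
  apply: (cv x Ox [set r : R | r != 0]); apply: open_nbhs_nbhs; split=> //.
rewrite nbhsE => -[U [oU Ux] UO].
have := lebesgue_open_gt0 oU Ux; rewrite ltNge => /negP; apply.
rewrite -N0; apply: le_measure; rewrite ?inE//; first exact: open_measurable_rV.
by move=> y Uy; apply: NS => /= h; have [Oy /eqP] := UO y Uy; apply; exact: h.
Qed.

Let sqr_norm_L2 f : in_L2 Omega f -> norm_L2 Omega f ^+ 2 = m f f.
Proof. by move=> Lf; rewrite sqr_sqrtr// (form_ge0 hI Lf). Qed.

Lemma costE v : H1 v -> cost Omega lambda ud v = 2^-1 * a v v - m ud v + 2^-1 * m ud ud.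
Proof.
move=> Xv; have Lv := Xv.1.
have -> : cost Omega lambda ud v = 2^-1 * m (v \- ud) (v \- ud) + lambda / 2 * (m v v + g v v).
  rewrite /cost (sqr_norm_L2 (subspaceB hL2 Lv Lud)) /norm_H1 (sqr_norm_L2 Lv) sqr_sqrtr//.
  by apply: addr_ge0; [exact: (form_ge0 hI Lv)|exact: (form_ge0 hg Xv)].
have -> : m (v \- ud) (v \- ud) = m v v - 2 * m v ud + m ud ud := formB_sqr hL2 hI Lv Lud.
by rewrite (formC hI Lv Lud) /a; field.
Qed.

Let solves u := forall v, weakly_harmonic Omega v -> a u v = m ud v.

Let harmonic_H1 u : weakly_harmonic Omega u -> H1 u. Proof. by case. Qed.

Lemma weakly_harmonic_subspace : subspace_of (weakly_harmonic Omega : set (Rd -> R)).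
Proof. exact: (subspace_orthogonal hX hg (fun u h => h) in_H10_H1 hX). Qed.

Lemma weakly_harmonic_solution : exists2 u, weakly_harmonic Omega u & solves u.
Proof.
have Lh := ip_linear Lud; have [C hC] := ip_bounded Lud.
apply: (riesz_harmonic oO OM lambda_gt0).
  by move=> c u v /harmonic_H1 Xu /harmonic_H1 Xv; exact: Lh.
exists (Num.max C 0) => u /harmonic_H1 Xu.
have m0 := form_ge0 hm Xu; have g0 := form_ge0 hg Xu.
apply: le_trans (hC u Xu) _; apply: (@le_trans _ _ (Num.max C 0 * m u u)).
  by apply: ler_wpM2r => //; rewrite le_max lexx.
apply: ler_wpM2l; first by rewrite le_max lexx orbT.
rewrite mulrDl mul1r -addrA [leRHS]addrCA lerDl.
by apply: addr_ge0; apply: mulr_ge0 => //; exact: ltW.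
Qed.

(** The cost is quadratic and its linear part vanishes at a solution of the Euler equation, so the
    excess is exactly half the energy of the difference. *)
Lemma cost_solution u v : weakly_harmonic Omega u -> solves u -> weakly_harmonic Omega v ->
  cost Omega lambda ud v = cost Omega lambda ud u + 2^-1 * a (v - u) (v - u).
Proof.
move=> Yu su Yv; have Xu := harmonic_H1 Yu; have Xv := harmonic_H1 Yv.
rewrite !costE// (formB_sqr hX ha Xv Xu) (formC ha Xv Xu).
by rewrite !su//; field.
Qed.

(** A minimiser is compared with the solution given by Riesz: their difference has zero energy, so
    the minimiser satisfies the same Euler equation. *)
Lemma minimizerP u : is_minimizer Omega lambda ud u <-> weakly_harmonic Omega u /\ solves u.
Proof.
have sa v : weakly_harmonic Omega v -> H1 v := @harmonic_H1 v.
split=> [[Yu umin]|[Yu su]]; last first.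
  split; [exact: Yu|move=> v Yv]; rewrite (cost_solution Yu su Yv) lerDl.
  apply: mulr_ge0; first by rewrite invr_ge0.
  exact: (form_ge0 ha (subspaceB hX (sa _ Yv) (sa _ Yu))).
split; [exact: Yu|move=> v Yv]; have [u0 Y0 s0] := weakly_harmonic_solution.
have Xd := subspaceB hX (sa _ Yu) (sa _ Y0).
have a0 : a (u - u0) (u - u0) = 0.
  apply/eqP; rewrite eq_le (form_ge0 ha Xd) andbT.
  by have := umin _ Y0; rewrite (cost_solution Y0 s0 Yu) gerDl pmulr_rle0.
have := form_eq0 hX ha Xd (sa _ Yv) a0.
rewrite (formBl ha (sa _ Yu) (sa _ Y0) (sa _ Yv)) s0// => /eqP.
by rewrite subr_eq0 => /eqP.
Qed.

Lemma minimizer_ae_unique u u' :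
  is_minimizer Omega lambda ud u -> is_minimizer Omega lambda ud u' ->
  {ae mu, forall x, Omega x -> u' x = u x}.
Proof.
move=> minu minu'; have [Yu su] := (minimizerP u).1 minu; have [Yu' _] := minu'.
have Xd := subspaceB hX (harmonic_H1 Yu') (harmonic_H1 Yu).
have m0 := form_ge0 hm Xd; have g0 := form_ge0 hg Xd.
have : cost Omega lambda ud u' <= cost Omega lambda ud u by apply: minu'.2.
rewrite (cost_solution Yu su Yu') gerDl pmulr_rle0// /a => h.
have mO : measurable Omega by exact: open_measurable_rV.
have l1 : 0 < lambda + 1 by rewrite addr_gt0.
have e0 : m (u' - u) (u' - u) = 0.
  apply/eqP; rewrite eq_le m0 andbT -(pmulr_rle0 _ l1); apply: le_trans h.
  by rewrite lerDl mulr_ge0// ltW.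
have := L2_ip_eq0 mO Xd.1 e0; apply: filterS => x h' Ox.
by apply/eqP; rewrite -subr_eq0; apply/eqP; exact: h' Ox.
Qed.

(** The given minimiser may differ from the state of the constructed saddle point on a null set; the
    difference has zero energy, so the multiplier can be kept. *)
Lemma minimizer_saddle_point u : is_minimizer Omega lambda ud u ->
  exists phi, saddle_point lambda m g H1 H10 (m ud) u phi.
Proof.
move=> /minimizerP[Yu su].
have [u2 [phi [X2 X0phi hu2 uo2]]] := saddle_point_exists lambda_gt0 hX hm hg
  (fun u h => h) in_H10_H1 hX (fun v => poincare oO OM (v := v)) (riesz_in_H10 oO OM)
  (riesz_harmonic oO OM lambda_gt0) (ip_linear Lud) (ip_bounded Lud).
have Xu := harmonic_H1 Yu; have Xphi := in_H10_H1 X0phi.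
have Y2 : weakly_harmonic Omega u2 := conj X2 uo2.
have Yd := subspaceB weakly_harmonic_subspace Yu Y2.
have Xd := harmonic_H1 Yd.
have a0 : a (u - u2) (u - u2) = 0.
  rewrite (formBl ha Xu X2 Xd) (su _ Yd).
  have := hu2 _ Xd; rewrite -/(a u2 _) (formC hg Xphi Xd) (Yd.2 _ X0phi) addr0 => ->.
  by rewrite subrr.
exists phi; split; [exact: Xu|exact: X0phi| |exact: Yu.2].
move=> v Xv; have /eqP := form_eq0 hX ha Xd Xv a0.
rewrite (formBl ha Xu X2 Xv) subr_eq0 => /eqP e.
exact: etrans (congr1 (fun r : R => r + g phi v) e) (hu2 v Xv).
Qed.

End optimality_system.

(** * Scaling of the Poisson approximation error *)

Section poisson.
Context (R : realType) (n : nat) (Omega : set 'rV[R]_n.+1) (M : nat).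
Context (oO : open Omega) (OM : Omega `<=` @cube R n.+1 M) (O0 : Omega !=set0).
Context (T : set (set 'rV[R]_n.+1)) (p : nat).
Hypothesis hS0 : subspace_of (in_S0 Omega T p : set ('rV[R]_n.+1 -> R)).
Local Notation Rd := 'rV[R]_n.+1.
Local Notation mu := (lebesgue_rV R n.+1).
Local Notation H1 := (in_H1 Omega : set (Rd -> R)).
Local Notation H10 := (in_H10 Omega : set (Rd -> R)).
Local Notation m := (ip Omega).
Local Notation g := (grad_ip Omega).
Implicit Types (u v w f phi psi : Rd -> R).

Let finO := bounded_domain_lty oO OM.
Let hX := in_H1_subspace oO finO.
Let hm := ip_semi_inner_H1 oO.
Let hg := grad_semi_inner oO finO.
Let hH : semi_inner H1 (H1_form Omega) := semi_inner_sum hm hg.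
Let hL2 := in_L2_subspace oO.
Let hI := ip_semi_inner oO.
Let hX0 := in_H10_subspace oO OM.

Lemma poisson_solution_exists f : in_L2 Omega f -> exists v, poisson_solution Omega f v.
Proof.
move=> Lf.
have [v Xv hv] : exists2 v, H10 v & forall w, H10 w -> g v w = m f w.
  apply: (riesz_in_H10 oO OM).
    by move=> c u v /in_H10_H1 Xu /in_H10_H1 Xv; exact: (ip_linear oO Lf).
  exists (m f f * (32 * M%:R ^+ 2)) => u Hu; have Xu := in_H10_H1 Hu.
  apply: le_trans (cauchy_schwarz hL2 hI Lf Xu.1) _.
  rewrite -mulrA; apply: ler_wpM2l; first exact: (form_ge0 hI Lf).
  exact: (poincare oO OM Hu).
by exists v.
Qed.

Lemma norm_L2Z (c : R) f : in_L2 Omega f -> norm_L2 Omega (c *: f) = `|c| * norm_L2 Omega f.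
Proof.
move=> Lf; have Lcf := subspaceZ hL2 c Lf.
rewrite /norm_L2 (formZl hL2 hI _ Lf Lcf) (formZr hL2 hI _ Lf Lf) mulrA -expr2.
by rewrite sqrtrM ?sqr_ge0// sqrtr_sqr.
Qed.

Lemma norm_H1Z (c : R) u : H1 u -> norm_H1 Omega (c *: u) = `|c| * norm_H1 Omega u.
Proof.
move=> Xu; have Xcu := subspaceZ hX c Xu.
rewrite (norm_H1E oO Xu) (norm_H1E oO Xcu).
rewrite (formZl hX hH _ Xu Xcu) (formZr hX hH _ Xu Xu) mulrA -expr2.
by rewrite sqrtrM ?sqr_ge0// sqrtr_sqr.
Qed.

Lemma normalized_L2 f : in_L2 Omega f -> 0 < norm_L2 Omega f ->
  in_L2 Omega ((norm_L2 Omega f)^-1 *: f) /\ norm_L2 Omega ((norm_L2 Omega f)^-1 *: f) = 1.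
Proof.
move=> Lf f0; split; first exact: (subspaceZ hL2 _ Lf).
by rewrite norm_L2Z// ger0_norm ?invr_ge0 ?(ltW f0)// mulVf// lt0r_neq0.
Qed.

Lemma best_error_fin (A : set (Rd -> R)) v : A 0 -> exists2 r : R, 0 <= r &
  ereal_inf [set (norm_H1 Omega (v \- w))%:E | w in A] = r%:E.
Proof.
move=> A0; set e := ereal_inf _.
have lb : (0 <= e)%E by apply: le_ereal_inf_tmp => _ [w _ <-]; rewrite lee_fin sqrtr_ge0.
have ub : (e <= (norm_H1 Omega (v \- 0))%:E)%E by apply: ereal_inf_lbound; exists 0.
have fin : e \is a fin_num by rewrite ge0_fin_numE//; exact: le_lt_trans ub (ltry _).
by exists (fine e); rewrite ?fine_ge0 ?fineK.
Qed.

Lemma best_error_S0_ub v w : in_S0 Omega T p w ->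
  (best_error_S0 Omega T p v <= (norm_H1 Omega (v \- w))%:E)%E.
Proof. by move=> Sw; apply: ereal_inf_lbound; exists w. Qed.

Lemma best_error_S0_fin v : exists2 r : R, 0 <= r & best_error_S0 Omega T p v = r%:E.
Proof. exact: best_error_fin (subspace0 hS0). Qed.

Lemma best_error_S0_le_poisson f v : in_L2 Omega f -> norm_L2 Omega f = 1 ->
  poisson_solution Omega f v -> (best_error_S0 Omega T p v <= poisson_error Omega T p)%E.
Proof. by move=> Lf f1 fv; apply: ereal_sup_ubound; exists f, v. Qed.

(** The supremum of an empty set would be [-oo]. The normalised constant function on the nonempty
    open domain, with its Poisson solution, shows that the set is inhabited. *)
Lemma poisson_error_ge0 : (0 <= poisson_error Omega T p)%E.
Proof.
have L1 : in_L2 Omega (cst 1).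
  apply: (smooth_L2 oO OM); apply: smooth_algebra_smooth; exact: alg_const.
have n1 : 0 < norm_L2 Omega (cst 1).
  rewrite /norm_L2 sqrtr_gt0 /ip /Rintegral.
  rewrite (_ : (fun x : Rd => _) = cst 1%E); last by apply/funext => x; rewrite mulr1.
  rewrite integral_cst; last exact: open_measurable_rV.
  have [x Ox] := O0; rewrite mul1e fine_gt0// (lebesgue_open_gt0 oO Ox)//=.
have [Lf f1] := normalized_L2 L1 n1.
have [v fv] := poisson_solution_exists Lf.
apply: le_trans (best_error_S0_le_poisson Lf f1 fv).
by have [r r0 ->] := best_error_S0_fin v; rewrite lee_fin.
Qed.

Lemma best_error_S0_le f v : in_L2 Omega f -> poisson_solution Omega f v ->
  (best_error_S0 Omega T p v <= (norm_L2 Omega f)%:E * poisson_error Omega T p)%E.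
Proof.
move=> Lf [Hv hv]; have Xv := in_H10_H1 Hv.
(* Data of norm zero cannot be normalised; its solution has zero gradient and, by the Poincare
   inequality, zero H^1 norm. *)
have [f0|fn] := eqVneq (norm_L2 Omega f) 0.
  have mf0 : m f f = 0.
    by apply/eqP; rewrite eq_le (form_ge0 hI Lf) andbT -sqrtr_eq0; apply/eqP; exact: f0.
  have gv0 : g v v = 0 by rewrite hv// (form_eq0 hL2 hI Lf Xv.1 mf0).
  have mv0 : m v v = 0.
    apply/eqP; rewrite eq_le (form_ge0 hm Xv) andbT.
    by apply: le_trans (poincare oO OM Hv) _; rewrite gv0 mulr0.
  rewrite f0 mul0e; apply: (@le_trans _ _ (norm_H1 Omega (v \- 0))%:E).
    exact: best_error_S0_ub (subspace0 hS0).
  have -> : v \- 0 = v by apply/funext => x; rewrite /= subr0.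
  by rewrite lee_fin (norm_H1E oO Xv) /H1_form gv0 mv0 !mulr0 addr0 sqrtr0.
have c0 : 0 < norm_L2 Omega f by rewrite lt_neqAle eq_sym fn sqrtr_ge0.
set c := norm_L2 Omega f in fn c0 *.
have [Lcf cf1] := normalized_L2 Lf c0; rewrite -/c in Lcf cf1.
have ci0 : 0 < c^-1 by rewrite invr_gt0.
have sol : poisson_solution Omega (c^-1 *: f) (c^-1 *: v).
  split; first exact: (subspaceZ hX0 _ Hv).
  move=> w Hw; have Xw := in_H10_H1 Hw.
  by rewrite (formZl hX hg _ Xv Xw) hv// (formZl hL2 hI _ Lf Xw.1).
apply: (@le_trans _ _ (c%:E * best_error_S0 Omega T p (c^-1 *: v))%E); last first.
  by apply: lee_wpmul2l; [rewrite lee_fin ltW|exact: (best_error_S0_le_poisson Lcf cf1 sol)].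
have [r r0 rE] := best_error_S0_fin (c^-1 *: v); rewrite rE -EFinM.
have [s s0 sE] := best_error_S0_fin v; rewrite sE lee_fin -ler_pdivrMl// -lee_fin -rE.
apply: le_ereal_inf_tmp => _ [w Sw <-]; rewrite lee_fin ler_pdivrMl// -lee_fin -sE.
apply: le_trans (best_error_S0_ub v (subspaceZ hS0 c Sw)) _.
have Xw := in_H10_H1 Sw.2.
have Xd : H1 (c^-1 *: v - w) by apply: subspaceB => //; exact: subspaceZ.
have <- : c *: (c^-1 *: v - w) = v \- (c *: w).
  by rewrite scalerBr scalerA mulfV ?lt0r_neq0// scale1r.
by rewrite (norm_H1Z _ Xd) ger0_norm// ltW.
Qed.

End poisson.

(** * Well-posedness and error of the discrete problem *)

Section discretisation.
Context (R : realType) (n : nat) (Omega : set 'rV[R]_n.+1) (M : nat).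
Context (oO : open Omega) (OM : Omega `<=` @cube R n.+1 M).
Context (lambda : R) (lambda_gt0 : 0 < lambda).
Context (ud : 'rV[R]_n.+1 -> R) (Lud : in_L2 Omega ud).
Context (kappa : R) (p : nat) (T : set (set 'rV[R]_n.+1)).
Context (hT : shape_regular_mesh Omega kappa T).
Local Notation Rd := 'rV[R]_n.+1.
Local Notation mu := (lebesgue_rV R n.+1).
Local Notation H1 := (in_H1 Omega : set (Rd -> R)).
Local Notation H10 := (in_H10 Omega : set (Rd -> R)).
Local Notation S := (in_S Omega T p : set (Rd -> R)).
Local Notation S0 := (in_S0 Omega T p : set (Rd -> R)).
Local Notation m := (ip Omega).
Local Notation g := (grad_ip Omega).
Implicit Types (u v w f phi psi : Rd -> R).

Let finO := bounded_domain_lty oO OM.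
Let hX := in_H1_subspace oO finO.
Let hm := ip_semi_inner_H1 oO.
Let hg := grad_semi_inner oO finO.
Let hX0 := in_H10_subspace oO OM.
Let hS := in_S_subspace oO T p.
Let finT := mesh_finite hT.
Let coverT := mesh_cover hT.
Let SX : S `<=` H1 := in_S_H1 oO OM finT (mesh_simplex hT) coverT (p := p).
Let S0S : S0 `<=` S. Proof. by move=> u []. Qed.

Lemma in_S0_subspace : subspace_of S0.
Proof.
split; first by split; [exact: (subspace0 hS)|exact: (subspace0 hX0)].
by move=> a u v [Su Hu] [Sv Hv]; split; [exact: (subspaceP hS)|exact: (subspaceP hX0)].
Qed.

Let hS0 := in_S0_subspace.
Let poinc psi : S0 psi -> m psi psi <= 32 * M%:R ^+ 2 * g psi psi.
Proof. by case=> _; exact: poincare. Qed.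

Lemma riesz_in_S0 : riesz S0 g.
Proof.
apply: (riesz_in_S oO finT coverT S0S hS0); first exact: semi_innerS SX hg.
by move=> u /SX Xu u0; have [] := H1_form_eq0_on oO OM Xu u0.
Qed.

Lemma discrete_solution_exists : exists uh phih, discrete_solution Omega lambda ud T p uh phih.
Proof.
have ha := semi_inner_energy lambda_gt0 hm hg.
have hY := subspace_orthogonal hX hg SX S0S hS.
have rY : riesz (orthogonal_in g S S0)
    (fun u v => (lambda + 1) * m u v + lambda * g u v).
  have YS : (orthogonal_in g S S0 : set (Rd -> R)) `<=` S by move=> u [].
  apply: (riesz_in_S oO finT coverT YS hY); first exact: semi_innerS SX ha.
  move=> u /SX Xu u0; have [-> ->] := H1_form_eq0_on oO OM Xu u0.
  by rewrite !mulr0 addr0.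
have Lh := ip_linear oO Lud; have [C hC] := ip_bounded oO Lud.
apply: (saddle_point_exists lambda_gt0 hX hm hg SX S0S hS poinc riesz_in_S0 rY).
  by move=> c u v /SX Xu /SX Xv; exact: Lh.
by exists C => u /SX; exact: hC.
Qed.

(** The abstract result says only that the differences have L2 norm zero; continuity of finite
    element functions makes this pointwise. *)
Lemma discrete_solution_unique uh phih uh' phih' :
  discrete_solution Omega lambda ud T p uh phih ->
  discrete_solution Omega lambda ud T p uh' phih' ->
  forall x, Omega x -> uh' x = uh x /\ phih' x = phih x.
Proof.
move=> h h'; have [Su Sp _ _] := h; have [Su' Sp' _ _] := h'.
have [eu ep] := saddle_point_unique lambda_gt0 hX hm hg SX S0S hS hS0 poinc h h'.
have zero v : S v -> m v v = 0 -> forall x, Omega x -> v x = 0.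
  move=> Sv; apply: (continuous_ip_eq0 oO); last by have [] := SX Sv.
  by move=> x Ox; exact: (in_S_continuous oO Sv Ox).
move=> x Ox; split; apply/eqP; rewrite -subr_eq0; apply/eqP.
  exact: (zero _ (subspaceB hS Su' Su) eu x Ox).
exact: (zero _ (subspaceB hS (S0S Sp') (S0S Sp)) ep x Ox).
Qed.

(** The infima need not be attained, so one is taken at a time with the other variable fixed. *)
Lemma mul_infimum_le (c N : R) (A B : set R) (E F : R) : 0 < c ->
  ereal_inf (EFin @` A) = E%:E -> ereal_inf (EFin @` B) = F%:E ->
  (forall x y, A x -> B y -> N <= c * (x + y)) -> N <= c * (E + F).
Proof.
move=> c0 EA EB h.
have h1 x : A x -> N / c - x <= F.
  move=> Ax; rewrite -lee_fin -EB; apply: le_ereal_inf_tmp => _ [y By <-].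
  by rewrite lee_fin lerBlDl ler_pdivrMr// mulrC; exact: h.
have h2 : N / c - F <= E.
  rewrite -lee_fin -EA; apply: le_ereal_inf_tmp => _ [x Ax <-].
  by rewrite lee_fin lerBlDl -lerBlDr h1.
by rewrite mulrC -ler_pdivrMr// -lerBlDr.
Qed.

Lemma best_error_S_fin v : exists2 r : R, 0 <= r & best_error_S Omega T p v = r%:E.
Proof. exact: best_error_fin (subspace0 hS). Qed.

(** The constant of [quasi_optimality] with the Poincare constant [32 M^2] inserted. *)
Definition stability_const : R :=
  (1 + (lambda + 1) / lambda) * (1 + Num.sqrt (32 * M%:R ^+ 2 + 1)) + lambda^-1.

Lemma stability_const_gt0 : 0 < stability_const.
Proof.
rewrite /stability_const ltr_wpDl ?invr_gt0//.
have l1 : 0 <= lambda + 1 by rewrite addr_ge0// ltW.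
by apply: mulr_ge0; rewrite addr_ge0 ?sqrtr_ge0// divr_ge0// ltW.
Qed.

Lemma error_estimate u phi uh phih :
  saddle_point lambda m g H1 H10 (m ud) u phi ->
  discrete_solution Omega lambda ud T p uh phih ->
  ((norm_H1 Omega (u \- uh))%:E <= stability_const%:E *
     (best_error_S Omega T p u + best_error_S0 Omega T p phi))%E.
Proof.
move=> hu huh; have [Xu Hphi _ _] := hu; have [Suh _ _ _] := huh.
have Xphi := in_H10_H1 Hphi.
have K0 : 0 <= 32 * M%:R ^+ 2 :> R by rewrite mulr_ge0// exprn_ge0.
have [E _ EE] := best_error_S_fin u; have [F _ FF] := best_error_S0_fin hS0 phi.
rewrite EE FF -EFinD -EFinM lee_fin.
apply: (@mul_infimum_le _ _ [set norm_H1 Omega (u \- w) | w in S]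
  [set norm_H1 Omega (phi \- w) | w in S0]).
- exact: stability_const_gt0.
- by rewrite -EE /best_error_S image_comp.
- by rewrite -FF /best_error_S0 image_comp.
move=> _ _ [w Sw <-] [psi S0psi <-].
have S0X0 : S0 `<=` H10 by move=> v [].
have e1 : norm_H1 Omega (u \- uh) = _ := norm_H1E oO (subspaceB hX Xu (SX Suh)).
have e2 : norm_H1 Omega (u \- w) = _ := norm_H1E oO (subspaceB hX Xu (SX Sw)).
have e3 : norm_H1 Omega (phi \- psi) = _ := norm_H1E oO (subspaceB hX Xphi (SX (S0S S0psi))).
rewrite e1 e2 e3.
exact: (quasi_optimality lambda_gt0 K0 hX hm hg (@in_H10_H1 R n Omega) SX S0S S0X0 hX0 hS hS0
  (fun v => poincare oO OM (v := v)) riesz_in_S0 hu huh Sw S0psi).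
Qed.

End discretisation.

Lemma bounded_set_cube (R : realType) (n : nat) (A : set 'rV[R]_n.+1) :
  bounded_set A -> exists k, A `<=` @cube R n.+1 k.
Proof.
move=> [C [_ hC]]; have {}hC := hC (C + 1) ltac:(by rewrite ltrDl).
exists (Num.trunc (C + 1)).+1 => x /hC h i.
have k0 : 0 < (Num.trunc (C + 1)).+1%:R :> R by rewrite ltr0n.
have : ball (0 : 'rV[R]_n.+1) (Num.trunc (C + 1)).+1%:R x.
  by rewrite -ball_normE /= sub0r normrN; apply: le_lt_trans h (truncnS_gt _).
by rewrite -(open_box_ball 0 k0) => /(_ i); rewrite !mxE sub0r add0r.
Qed.

Theorem theorem2 (R : realType) (n : nat) (Omega : set 'rV[R]_n.+1)
    (lambda : R) (ud : 'rV[R]_n.+1 -> R) (kappa : R) (p : nat)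
    (hOmega : polyhedral_lipschitz_domain Omega) (hlambda : 0 < lambda)
    (hud : in_L2 Omega ud) (hp : (1 <= p)%N) :
  (forall T, shape_regular_mesh Omega kappa T ->
    exists uh phih, discrete_solution Omega lambda ud T p uh phih /\
      forall uh' phih', discrete_solution Omega lambda ud T p uh' phih' ->
        forall x, Omega x -> uh' x = uh x /\ phih' x = phih x) /\
  (exists u, is_minimizer Omega lambda ud u /\
    forall u', is_minimizer Omega lambda ud u' ->
      {ae lebesgue_rV R n.+1, forall x, Omega x -> u' x = u x}) /\
  (forall u, is_minimizer Omega lambda ud u ->
    exists2 C : R, 0 < C &
      forall T, shape_regular_mesh Omega kappa T ->
      forall uh phih, discrete_solution Omega lambda ud T p uh phih ->
        ((norm_H1 Omega (u \- uh))%:E <=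
          C%:E * (best_error_S Omega T p u + poisson_error Omega T p))%E).

Proof.
have [[oO _ O0 bO] _] := hOmega; have [M OM] := bounded_set_cube bO.
split; [|split].
- move=> T hT; have [uh [phih h]] := discrete_solution_exists oO OM hlambda hud p hT.
  exists uh, phih; split=> // uh' phih' h'.
  exact: (discrete_solution_unique oO OM hlambda hT h h').
- have [u Yu su] := weakly_harmonic_solution oO OM hlambda hud.
  have minu : is_minimizer Omega lambda ud u by apply/(minimizerP oO OM hlambda hud).
  by exists u; split=> // u'; exact: (minimizer_ae_unique oO OM hlambda hud minu).
move=> u minu.
have [phi hu] := minimizer_saddle_point oO OM hlambda hud minu.
have [Xu Hphi hphi uo] := hu.
pose f := ud - (lambda + 1) *: u.
have hL2 := in_L2_subspace oO; have hI := ip_semi_inner oO.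
have Lu := Xu.1; have Llu := subspaceZ hL2 (lambda + 1) Lu.
have Lf : in_L2 Omega f := subspaceB hL2 hud Llu.
have fphi : poisson_solution Omega f phi.
  split=> // w Hw; have Xw := in_H10_H1 Hw.
  rewrite (formBl hI hud Llu Xw.1) (formZl hL2 hI _ Lu Xw.1).
  by rewrite -(hphi w Xw) (uo w Hw) mulr0 addr0 addrAC subrr add0r.
(* The first summand of the estimate needs the factor 1, the second the norm of [f] from the
   scaling; [K] is fixed before the mesh is introduced. *)
pose K := Num.max 1 (norm_L2 Omega f).
have K1 : 1 <= K by rewrite le_max lexx.
have Kf : norm_L2 Omega f <= K by rewrite le_max lexx orbT.
have c0 := stability_const_gt0 M hlambda.
exists (stability_const M lambda * K); first by rewrite mulr_gt0// (lt_le_trans ltr01).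
move=> T hT uh phih h; have hS0 := in_S0_subspace oO OM p T.
apply: le_trans (error_estimate oO OM hlambda hT hu h) _.
have P0 := poisson_error_ge0 oO OM O0 hS0.
have [E E0 EE] := best_error_S_fin oO p T u; rewrite EE.
rewrite EFinM -muleA; apply: lee_wpmul2l; first by rewrite lee_fin ltW.
rewrite ge0_muleDr ?lee_fin//; apply: leeD.
  by rewrite -EFinM lee_fin ler_peMl.
apply: le_trans (best_error_S0_le oO OM hS0 Lf fphi) _.
by apply: lee_wpmul2r; rewrite ?lee_fin.
Qed.
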